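(* Let $n\ge 4$ and let $(V,[\,\cdot,\dots,\cdot\,],\langle\cdot,\cdot\rangle)$ be a finite-dimensional indecomposable lorentzian metric Lie $n$-algebra. Then exactly one of the following holds: (i) $V$ is one-dimensional; (ii) $V$ is simple; (iii) $V=\mathbb{R}u\oplus\mathbb{R}v\oplus W$ as a vector space, where $\langle u,u\rangle=\langle v,v\rangle=0$, $\langle u,v\rangle=1$, $u,v\perp W$, and the restriction of $\langle\cdot,\cdot\rangle$ to $W$ is positive definite. In this case there is an alternating $(n-1)$-linear bracket $[x_1,\dots,x_{n-1}]$ on $W$ such that the only nonzero $n$-brackets of $V$ are those obtained by skew-symmetry from $$[u,x_1,\dots,x_{n-1}]=[x_1,\dots,x_{n-1}],\qquad [x_1,\dots,x_n]=(-1)^n\langle [x_1,\dots,x_{n-1}],x_n\rangle\, v,$$ for $x_i\in W$ (in particular every bracket containing $v$, or containing $u$ twice, vanishes). Moreover, this $(n-1)$-bracket makes $W$ (with the restricted inner product) into a euclidean metric Lie $(n-1)$-algebra isomorphic to an orthogonal direct sum of $m$ copies of the simple euclidean Lie $(n-1)$-algebra $\mathfrak{s}^{(n-1)}$, for some integer $m\ge 1$. In particular $\dim V=mn+2$.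
   Context: All vector spaces are real and finite-dimensional. For $k\ge 2$, a Lie $k$-algebra is a vector space $V$ with an alternating $k$-linear map $[\cdot,\dots,\cdot]:\Lambda^kV\to V$ such that for all $x_1,\dots,x_{k-1}\in V$ the map $\mathrm{ad}_{x_1,\dots,x_{k-1}}:y\mapsto[x_1,\dots,x_{k-1},y]$ is a derivation of the bracket (for $k=2$ this is a Lie algebra). An ideal is a subspace $I$ with $[I,V,\dots,V]\subset I$. A Lie $k$-algebra is simple if it is not one-dimensional and its only ideals are $0$ and $V$. A metric Lie $k$-algebra is a Lie $k$-algebra with a nondegenerate symmetric bilinear form $\langle\cdot,\cdot\rangle$ such that every $\mathrm{ad}_{x_1,\dots,x_{k-1}}$ is skew-symmetric. It is euclidean if the form is positive definite, and lorentzian if the form has exactly one negative eigenvalue (signature $(1,\dim V-1)$, one timelike direction). A metric Lie $k$-algebra is indecomposable if it has no nondegenerate ideal other than $0$ and $V$ (equivalently, it is not an orthogonal direct sum of two nonzero ideals). Isomorphism of metric Lie $k$-algebras means a linear isometry preserving brackets. For $k\ge 3$, $\mathfrak{s}^{(k)}$ denotes the $(k+1)$-dimensional Lie $k$-algebra with basis $\boldsymbol e_1,\dots,\boldsymbol e_{k+1}$ and bracket $[\boldsymbol e_1,\dots,\widehat{\boldsymbol e_i},\dots,\boldsymbol e_{k+1}]=(-1)^i\boldsymbol e_i$ (hat denotes omission), equipped with an inner product for which this basis is orthogonal with all $\langle\boldsymbol e_i,\boldsymbol e_i\rangle$ equal to the same positive number; this is the simple euclidean Lie $k$-algebra (unique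 up to the scale of the inner product). *)

(* Defs.v *)
(* Real numbers are modelled by an arbitrary real closed
   field R : rcfType (the statement is first order in each fixed dimension,
   so this is a faithful generalisation of the case R = reals). *)
From HB Require Import structures.
From mathcomp Require Import all_boot all_order all_algebra.
Set Implicit Arguments. Unset Strict Implicit. Unset Printing Implicit Defensive.
Import Order.TTheory GRing.Theory Num.Theory.
Local Open Scope ring_scope.

Section LieKAlgebras.
Variable R : rcfType.

Definition upd (T : Type) k (x : 'I_k -> T) (i : 'I_k) (y : T) : 'I_k -> T :=
  fun j => if j == i then y else x j.

(* (a, y_0, ..., y_{m-1}) as a k-tuple (used with k = m + 1) *)
Definition tcons (T : zmodType) k m (a : T) (y : 'I_m -> T) : 'I_k -> T :=
  fun j => if val j is p.+1 then
             (match (insub p : option 'I_m) with Some q => y q | None => 0 end)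
           else a.

(* (y_0, ..., y_{m-1}, a) as a k-tuple (used with k = m + 1) *)
Definition tsnoc (T : zmodType) k m (y : 'I_m -> T) (a : T) : 'I_k -> T :=
  fun j => match (insub (val j) : option 'I_m) with Some q => y q | None => a end.

Section OnV.
Variables (V : vectType R) (k : nat).
Variable br : ('I_k -> V) -> V.
Variable b : V -> V -> R.

Definition multilinear :=
  forall (x : 'I_k -> V) i (a : R) (y z : V),
    br (upd x i (a *: y + z)) = a *: br (upd x i y) + br (upd x i z).

Definition alternating :=
  forall (x : 'I_k -> V) (i j : 'I_k), i != j -> x i = x j -> br x = 0.

(* ad_{x_1..x_{k-1}} : y |-> [x_1,..,x_{k-1},y]; by skew-symmetry the free
   slot may be taken to be any slot i (the entry x i is then ignored). *)
Definition ad (x : 'I_k -> V) (i : 'I_k) (y : V) : V := br (upd x i y).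

Definition ad_derivations :=
  forall (x : 'I_k -> V) (i : 'I_k) (z : 'I_k -> V),
    ad x i (br z) = \sum_(j < k) br (upd z j (ad x i (z j))).

Definition lie_alg := [/\ multilinear, alternating & ad_derivations].

Definition sym_bilinear :=
  (forall (a : R) (x y z : V), b (a *: x + y) z = a * b x z + b y z) /\
  (forall x y, b x y = b y x).

Definition nondegenerate := forall x, (forall y, b x y = 0) -> x = 0.

Definition ad_skew :=
  forall (x : 'I_k -> V) (i : 'I_k) (y z : V),
    b (ad x i y) z + b y (ad x i z) = 0.

Definition metric_lie_alg :=
  [/\ lie_alg, sym_bilinear, nondegenerate & ad_skew].

Definition euclidean := forall x, x != 0 -> 0 < b x x.

(* signature (1, dim V - 1): an orthogonal basis with exactly one vector of
   norm -1 (the first) and all others of norm 1 (Sylvester normal form). *)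
Definition lorentzian :=
  exists e : seq V,
    [/\ basis_of fullv e,
        forall i j, (i < size e)%N -> (j < size e)%N -> i != j -> b e`_i e`_j = 0,
        b e`_0 e`_0 = -1 &
        forall i, (0 < i < size e)%N -> b e`_i e`_i = 1].

Definition ideal (I : {vspace V}) :=
  forall (x : 'I_k -> V) (i : 'I_k), x i \in I -> br x \in I.

Definition simple :=
  \dim (fullv : {vspace V}) != 1%N /\
  forall I : {vspace V}, ideal I -> I = 0%VS \/ I = fullv.

Definition nondegenerate_on (I : {vspace V}) :=
  forall x, x \in I -> (forall y, y \in I -> b x y = 0) -> x = 0.

Definition indecomposable :=
  forall I : {vspace V}, ideal I -> nondegenerate_on I -> I = 0%VS \/ I = fullv.

End OnV.

(* The metric Lie k-algebra (Wt, brW, bW) is isomorphic to an orthogonal direct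
   sum of m copies of s^(k) (copy a carrying the inner product scaled by
   c a > 0): there is a basis e a i (a < m, i < k+1) of Wt, orthogonal, with
   <e a i, e a i> = c a, [e a 0, .., ^e a i^, .., e a k] = (-1)^(i+1) e a i
   (1-based index i+1), and brackets of basis vectors from different copies
   vanish.  (Together with multilinearity and alternation this determines the
   bracket, i.e. it describes the isomorphism with the model on its basis.) *)
Definition sum_of_simple_copies k (Wt : vectType R)
    (brW : ('I_k -> Wt) -> Wt) (bW : Wt -> Wt -> R) (m : nat) :=
  exists (c : 'I_m -> R) (e : 'I_m -> 'I_k.+1 -> Wt),
    [/\ forall a, 0 < c a,
        basis_of fullv [seq e p.1 p.2 | p : 'I_m * 'I_k.+1],
        forall a i a' i', bW (e a i) (e a' i') = if (a == a') && (i == i') then c a else 0,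
        forall a (i : 'I_k.+1), brW (fun j => e a (lift i j)) = (-1) ^+ i.+1 *: e a i &
        forall f : 'I_k -> 'I_m * 'I_k.+1,
          (exists j j', (f j).1 != (f j').1) -> brW (fun j => e (f j).1 (f j).2) = 0].

Definition case_iii n (V : vectType R) (br : ('I_n -> V) -> V) (b : V -> V -> R) :=
  exists (u v : V) (W : {vspace V}),
    [/\ b u u = 0 /\ b v v = 0 /\ b u v = 1,
        forall w, w \in W -> b u w = 0 /\ b v w = 0,
        (<[u]> + <[v]> + W)%VS = fullv /\ directv (<[u]> + <[v]> + W),
        forall w, w \in W -> w != 0 -> 0 < b w w &
    exists brW : ('I_n.-1 -> subvs_of W) -> subvs_of W,
      let bW := fun a c : subvs_of W => b (vsval a) (vsval c) in
      [/\ (forall x : 'I_n -> V, (exists i, x i = v) -> br x = 0) /\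
          (forall x : 'I_n -> V, (exists i j, i != j /\ x i = u /\ x j = u) -> br x = 0),
          forall y : 'I_n.-1 -> subvs_of W,
            br (tcons u (fun j => vsval (y j))) = vsval (brW y),
          forall (y : 'I_n.-1 -> subvs_of W) (w : subvs_of W),
            br (tsnoc (fun j => vsval (y j)) (vsval w)) = ((-1) ^+ n * bW (brW y) w) *: v,
          metric_lie_alg brW bW /\ euclidean bW &
          exists2 m, (0 < m)%N &
            sum_of_simple_copies brW bW m /\ \dim (fullv : {vspace V}) = (m * n + 2)%N]].

End LieKAlgebras.

(* Main.v *)
Require Import Defs.
From HB Require Import structures.
From mathcomp Require Import all_boot all_order all_algebra.
From mathcomp Require Import fingroup perm ring complex.
From Stdlib Require Import Classical_Prop Classical_Pred_Type FunctionalExtensionality.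
Set Implicit Arguments. Unset Strict Implicit. Unset Printing Implicit Defensive.
Import Order.TTheory GRing.Theory Num.Theory.
Local Open Scope ring_scope.

(** An ideal that is neither 0 nor V is degenerate, so it meets its orthogonal in a
    null line [v], which is central.  With a null partner [u] of [v] and
    [W = {u, v}^perp], which is euclidean, the invariant (n+1)-form
    [<[x_1, .., x_n], x_0>] is described by its restriction [F] to [W] and by the
    n-form [phi] obtained by inserting [u]; both are invariant forms, i.e. they are
    killed by the skew operators obtained from them by filling all slots but two.

    An invariant K-form with K >= 4 on a euclidean space is an orthogonal sum of
    volume forms of K-dimensional subspaces (blocks).  For K = 4 one complexifies and
    uses weights with respect to a maximal subspace H with [[H, H, H] = 0]: weights
    are decomposable 2-forms on H, and a weight of maximal norm, with its weight
    vector and the conjugate, spans a block.  For larger K one contracts with a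
    vector: the rotations of a block of the contracted form kill the given form, and
    this forces the block to be completed by one more vector.

    A block of [F], lifted along [v], is a nondegenerate ideal of V; hence [F = 0].
    The part of [W] orthogonal to the blocks of [phi] is central and nondegenerate;
    hence [W] is the sum of these blocks. *)

(** * Complexified euclidean Lie 3-algebras *)

(** The bound K >= 4 cannot be lowered: an invariant 3-form is the Cartan form of a compact Lie
    algebra, which need not split into 3-dimensional pieces. Since phi has n slots, this is where n
    >= 4 enters.

    Forms are preferred to brackets because all slots then play the same role and contraction with a
    vector preserves invariance, which permits induction on the arity.

    A block for K = 4 has dimension 4 because ad takes two arguments from H: weights are 2-forms,
    decomposable ones have rank two, so a weight contributes a plane of H, and its weight vector
    with the conjugate contributes the other two dimensions. No classification of roots is needed,
    only the fact that a sum of weights cannot exceed the maximal norm.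

    A block of F on W is visible only modulo v, since phi also pairs its vectors with u. Its span is
    in general not an ideal; each vector must first be corrected by a multiple of v read off from
    phi. *)

Section RowVectors.
Variables (C : numClosedFieldType) (d : nat).
Local Notation U := 'rV[C]_d.

Definition dot (x y : U) : C := (x *m y^T) 0 0.
Definition cj (x : U) : U := map_mx Num.conj x.

Lemma dotE x y : dot x y = \sum_i x 0 i * y 0 i.
Proof. by rewrite /dot mxE; apply: eq_bigr => i _; rewrite mxE. Qed.

Lemma dotC x y : dot x y = dot y x.
Proof. by rewrite !dotE; apply: eq_bigr => i _; rewrite mulrC. Qed.

Lemma dotDl x y z : dot (x + y) z = dot x z + dot y z.
Proof. by rewrite /dot mulmxDl mxE. Qed.

Lemma dotZl a x z : dot (a *: x) z = a * dot x z.
Proof. by rewrite /dot -scalemxAl mxE. Qed.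

Lemma dotDr x y z : dot z (x + y) = dot z x + dot z y.
Proof. by rewrite ![dot z _]dotC dotDl. Qed.

Lemma dotZr a x z : dot z (a *: x) = a * dot z x.
Proof. by rewrite ![dot z _]dotC dotZl. Qed.

Lemma dotNl x z : dot (- x) z = - dot x z.
Proof. by rewrite -scaleN1r dotZl mulN1r. Qed.

Lemma dotNr x z : dot z (- x) = - dot z x.
Proof. by rewrite dotC dotNl dotC. Qed.

Lemma dot0l z : dot 0 z = 0.
Proof. by rewrite -(scale0r 0) dotZl mul0r. Qed.

Lemma dot0r z : dot z 0 = 0.
Proof. by rewrite dotC dot0l. Qed.

Lemma cjK x : cj (cj x) = x.
Proof. by apply/rowP => i; rewrite !mxE conjCK. Qed.

Lemma cjD x y : cj (x + y) = cj x + cj y.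
Proof. by apply/rowP => i; rewrite !mxE rmorphD. Qed.

Lemma cjZ a x : cj (a *: x) = a^* *: cj x.
Proof. by apply/rowP => i; rewrite !mxE rmorphM. Qed.

Lemma cjN x : cj (- x) = - cj x.
Proof. by apply/rowP => i; rewrite !mxE rmorphN. Qed.

Lemma cj0 : cj 0 = 0.
Proof. by apply/rowP => i; rewrite !mxE rmorph0. Qed.

Lemma dot_cj x y : dot (cj x) (cj y) = (dot x y)^*.
Proof.
rewrite !dotE rmorph_sum; apply: eq_bigr => i _.
by rewrite !mxE rmorphM.
Qed.

Lemma dot_cj_gt0 x : x != 0 -> 0 < dot x (cj x).
Proof.
move=> x0; rewrite dotE.
have P0 i : 0 <= x 0 i * cj x 0 i by rewrite mxE mul_conjC_ge0.
rewrite lt_def sumr_ge0 // andbT; apply: contraNneq x0 => /eqP.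
rewrite psumr_eq0 // => /allP A; apply/eqP/rowP => i; rewrite mxE.
by have := A i (mem_index_enum _); rewrite mxE mul_conjC_eq0 => /eqP.
Qed.

Lemma cj_eq0 x : (cj x == 0) = (x == 0).
Proof. by apply/eqP/eqP => [H|->]; [rewrite -[x]cjK H cj0|rewrite cj0]. Qed.

End RowVectors.

(* The complexification of a euclidean metric Lie 3-algebra: [cj] is the real
   structure, [dot] the complex-bilinear extension of the inner product. *)
Section Complex3Algebra.
Variables (C : numClosedFieldType) (d : nat).
Local Notation U := 'rV[C]_d.
Variable B : U -> U -> U -> U.
Hypothesis Blin : forall x y a z t, B x y (a *: z + t) = a *: B x y z + B x y t.
Hypothesis B12 : forall x y z, B x y z = - B y x z.
Hypothesis B23 : forall x y z, B x y z = - B x z y.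
Hypothesis Bskew : forall x y z t, dot (B x y z) t = - dot z (B x y t).
Hypothesis BFI : forall x y z t w,
  B x y (B z t w) = B (B x y z) t w + B z (B x y t) w + B z t (B x y w).
Hypothesis Bcj : forall x y z, cj (B x y z) = B (cj x) (cj y) (cj z).

Lemma BDr x y z t : B x y (z + t) = B x y z + B x y t.
Proof. by rewrite -[z]scale1r Blin !scale1r. Qed.

Lemma B0r x y : B x y 0 = 0.
Proof. by apply: (@addrI _ (B x y 0)); rewrite -BDr !addr0. Qed.

Lemma BZr x y a z : B x y (a *: z) = a *: B x y z.
Proof. by rewrite -[a *: z]addr0 Blin B0r addr0. Qed.

Lemma BNr x y z : B x y (- z) = - B x y z.
Proof. by rewrite -scaleN1r BZr scaleN1r. Qed.

Lemma BDm x y z t : B x (y + z) t = B x y t + B x z t.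
Proof. by rewrite B23 BDr opprD -!B23. Qed.

Lemma BZm x a y z : B x (a *: y) z = a *: B x y z.
Proof. by rewrite B23 BZr -scalerN -B23. Qed.

Lemma B0m x y : B x 0 y = 0.
Proof. by rewrite B23 B0r oppr0. Qed.

Lemma BNm x y z : B x (- y) z = - B x y z.
Proof. by rewrite -scaleN1r BZm scaleN1r. Qed.

Lemma BDl x y z t : B (x + y) z t = B x z t + B y z t.
Proof. by rewrite B12 BDm opprD -!B12. Qed.

Lemma BZl a x y z : B (a *: x) y z = a *: B x y z.
Proof. by rewrite B12 BZm -scalerN -B12. Qed.

Lemma B0l x y : B 0 x y = 0.
Proof. by rewrite B12 B0m oppr0. Qed.

Lemma BNl x y z : B (- x) y z = - B x y z.
Proof. by rewrite -scaleN1r BZl scaleN1r. Qed.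

Lemma Bcyc x y z : B x y z = B y z x.
Proof. by rewrite B12 B23 opprK. Qed.

Lemma vec_eq_opp (x : U) : x = - x -> x = 0.
Proof.
move=> /eqP; rewrite -addr_eq0 -mulr2n -scaler_nat scaler_eq0.
by rewrite pnatr_eq0 => /eqP.
Qed.

Lemma B11 x z : B x x z = 0.
Proof. exact/vec_eq_opp/B12. Qed.

Lemma B22 x z : B x z z = 0.
Proof. exact/vec_eq_opp/B23. Qed.

(** * Weights with respect to a maximal real subspace H with [H, H, H] = 0 *)

Section Cartan.
Variables (r : nat) (h : 'M[C]_(r, d)).
Definition inH (p : U) := (p <= h)%MS.
Hypothesis Hreal : map_mx Num.conj h = h.
Hypothesis HB : forall p q s, inH p -> inH q -> inH s -> B p q s = 0.
Hypothesis Hmax : forall z, cj z = z ->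
  (forall p q, inH p -> inH q -> B p q z = 0) -> inH z.

Lemma inHD p q : inH p -> inH q -> inH (p + q).
Proof. exact: addmx_sub. Qed.

Lemma inHZ a p : inH p -> inH (a *: p).
Proof. exact: scalemx_sub. Qed.

Lemma inHcj p : inH p -> inH (cj p).
Proof. by rewrite /inH => /submxP[D ->]; rewrite /cj map_mxM Hreal submxMl. Qed.

Lemma inH_row i : inH (row i h).
Proof. exact: row_sub. Qed.

Lemma cj_row i : cj (row i h) = row i h.
Proof. by rewrite /cj map_row Hreal. Qed.

(** [Hmax] speaks of real vectors only. The vectors killed by all [B p q] are stable under [cj], so
    it applies to the real and imaginary parts of [z] separately. *)
Lemma inH_zero_weight z : (forall p q, inH p -> inH q -> B p q z = 0) -> inH z.
Proof.
move=> z0.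
have zc p q : inH p -> inH q -> B p q (cj z) = 0.
  move=> Hp Hq; rewrite -[p]cjK -[q]cjK -Bcj z0 ?cj0 //; exact: inHcj.
have H1 : inH (z + cj z).
  apply: Hmax; first by rewrite cjD cjK addrC.
  by move=> p q Hp Hq; rewrite BDr z0 // zc // addr0.
have H2 : inH ('i *: (z - cj z)).
  apply: Hmax.
    by rewrite cjZ cjD cjN cjK conjCi scaleNr -scalerN opprB.
  by move=> p q Hp Hq; rewrite BZr BDr BNr z0 // zc // subr0 scaler0.
have -> : z = 2^-1 *: ((z + cj z) - 'i *: ('i *: (z - cj z))).
  rewrite scalerA -expr2 sqrCi scaleN1r opprK addrACA subrr addr0.
  by rewrite -mulr2n -scaler_nat scalerA mulVf ?scale1r // pnatr_eq0.
by apply/inHZ/inHD => //; rewrite -scaleNr; apply: inHZ.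
Qed.

Lemma inH_nondeg z : inH z -> (forall q, inH q -> dot z q = 0) -> z = 0.
Proof.
move=> Hz z0; apply/eqP; apply: contraT => /dot_cj_gt0.
by rewrite z0 ?ltxx //; apply: inHcj.
Qed.

(* The weight of [X] (meaningful for weight vectors [X] and [p], [q] in H), as a
   Rayleigh quotient, which makes its bilinearity in [p], [q] obvious. *)
Definition om (X p q : U) := dot (B p q X) (cj X) / dot X (cj X).

(** The zero weight is allowed; nonzero weights are singled out later by [0 < nn X]. *)
Definition wt (X : U) := X != 0 /\
  forall p q, inH p -> inH q -> B p q X = om X p q *: X.

Lemma omE X p q c : X != 0 -> B p q X = c *: X -> om X p q = c.
Proof.
by move=> X0 E; rewrite /om E dotZl mulfK // gt_eqF // dot_cj_gt0.
Qed.

Lemma wtI X (f : U -> U -> C) : X != 0 ->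
  (forall p q, inH p -> inH q -> B p q X = f p q *: X) -> wt X.
Proof. by move=> X0 E; split=> // p q Hp Hq; rewrite (omE X0 (E p q Hp Hq)) E. Qed.

Lemma om_cj X p q : om (cj X) p q = - om X p q.
Proof.
rewrite /om cjK [dot (cj X) X]dotC -mulNr; congr (_ / _).
by rewrite Bskew dotC.
Qed.

Lemma wt_cj X : wt X -> wt (cj X).
Proof.
case=> X0 E; apply: (@wtI _ (fun p q => (om X (cj p) (cj q))^*)).
  by rewrite cj_eq0.
move=> p q Hp Hq; rewrite -{1}[p]cjK -{1}[q]cjK -Bcj E ?cjZ //; exact: inHcj.
Qed.

Lemma omDl X p p' q : om X (p + p') q = om X p q + om X p' q.
Proof. by rewrite /om BDl dotDl mulrDl. Qed.

Lemma omZl X a p q : om X (a *: p) q = a * om X p q.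
Proof. by rewrite /om BZl dotZl mulrA. Qed.

Lemma omC X p q : om X p q = - om X q p.
Proof. by rewrite /om B12 dotNl mulNr. Qed.

Lemma omDr X p q q' : om X p (q + q') = om X p q + om X p q'.
Proof. by rewrite omC omDl opprD -!omC. Qed.

Lemma omZr X a p q : om X p (a *: q) = a * om X p q.
Proof. by rewrite omC omZl -mulrN -omC. Qed.

Lemma om_conj X p q : wt X -> inH p -> inH q ->
  (om X p q)^* = - om X (cj p) (cj q).
Proof.
move=> wX Hp Hq; rewrite -om_cj; apply/esym/omE.
  by rewrite cj_eq0; case: wX.
by rewrite -Bcj; case: wX => _ ->; rewrite ?cjZ.
Qed.

(** Analogue of the bracket of two opposite root vectors. There is one for each [p]: up to the
    factor [dot X (cj X)] it represents the linear form [om X p] on H, see [dot_coroot]. *)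
Definition coroot (X p : U) : U := B p X (cj X).

Lemma wt_B p X Y q s : inH p -> wt X -> wt Y -> inH q -> inH s ->
  B q s (B p X Y) = (om X q s + om Y q s) *: B p X Y.
Proof.
move=> Hp [_ wX] [_ wY] Hq Hs; rewrite BFI (HB Hq Hs Hp) B0l add0r.
by rewrite (wX q s) // (wY q s) // BZm BZr scalerDl.
Qed.

(** The weights of [X] and [cj X] cancel, so the bracket has weight zero. *)
Lemma inH_coroot X p : wt X -> inH p -> inH (coroot X p).
Proof.
move=> wX Hp; apply: inH_zero_weight => q s Hq Hs.
by rewrite wt_B //; [rewrite om_cj subrr scale0r|apply: wt_cj].
Qed.

Lemma dot_coroot X p q : wt X -> inH p -> inH q ->
  dot (coroot X p) q = om X p q * dot X (cj X).
Proof.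
move=> wX Hp Hq; rewrite /coroot Bskew B23 dotNr opprK.
by case: wX => _ ->; rewrite // dotZr dotC.
Qed.

(* Plücker relation, from [ad_{p,X} [q,s,t] = 0]: weights are decomposable. *)
Lemma om_plucker X p q s t : wt X -> inH p -> inH q -> inH s -> inH t ->
  om X p q * om X s t + om X p s * om X t q + om X p t * om X q s = 0.
Proof.
move=> [X0 wX] Hp Hq Hs Ht.
have E u : inH u -> B p X u = - (om X p u) *: X.
  by move=> Hu; rewrite B23 wX // scaleNr.
have E1 : B X s t = om X s t *: X by rewrite Bcyc wX.
have E2 : B q X t = om X t q *: X by rewrite B23 wX // omC scaleNr opprK.
have := BFI p X q s t.
rewrite (HB Hq Hs Ht) B0r !E // !(BZl, BZm, BZr) E1 E2 wX // !scalerA -!scalerDl.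
move=> /esym/eqP; rewrite scaler_eq0 (negPf X0) orbF => /eqP H.
by rewrite -[RHS]oppr0 -H; ring.
Qed.

(** * Two weight vectors X, Y with [H, X, Y] = 0 *)

Section Pair.
Variables X Y : U.
Hypotheses (wX : wt X) (wY : wt Y).
Hypothesis XY : forall p, inH p -> B p X Y = 0.
Local Notation N q := (B q (cj X) Y).
Local Notation C0 := (B X (cj X) Y).

Lemma B_X_N p q : inH p -> inH q ->
  B p X (N q) = om Y q (coroot X p) *: Y - om X p q *: C0.
Proof.
move=> Hp Hq; rewrite BFI XY // B0r addr0 addrC; congr (_ + _).
  by case: wY => _; apply=> //; apply: inH_coroot.
by rewrite [B p X q]B23; case: (wX) => _ ->; rewrite // BNl BZl.
Qed.

(** [[q, X, N p]] is computed twice, by [B_X_N] and by expanding [ad p Y] on [[q, X, cj X]]. The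
    multiples of [Y] agree, and the difference is [om X p q + om Y p q] times [C0]. *)
Lemma pair_C0 p q : inH p -> inH q -> om X p q + om Y p q != 0 -> C0 = 0.
Proof.
move=> Hp Hq nz.
have E : B q X (N p) = om Y p (coroot X q) *: Y - om Y p q *: C0.
  have := BFI p Y q X (cj X).
  have -> : B p Y X = 0 by rewrite B23 XY // oppr0.
  have -> : B p Y (cj X) = - N p by rewrite B23.
  rewrite B0m addr0 BNr [B p Y q]B23; case: (wY) => _ wY'; rewrite wY' // BNl BZl.
  rewrite [B p Y (B q X _)]B23 -/(coroot X q) wY' ?inH_coroot //.
  rewrite [B Y X (cj X)]Bcyc -opprD => /oppr_inj ->.
  by rewrite addrC addKr.
move: (B_X_N Hq Hp); rewrite E [om X q p]omC scaleNr opprK.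
move/addrI/eqP; rewrite eq_sym -addr_eq0 -scalerDl scaler_eq0.
by rewrite (negPf nz) => /eqP.
Qed.

(** The operator [B p (cj X)] kills [a] and [b], hence commutes with [B a b]. So [N p] has
    eigenvalue [om Y a b] under [B a b], but also [om Y a b - om X a b]. *)
Lemma N_radical p a b : inH p -> inH a -> inH b -> om X a b != 0 ->
  om X p a = 0 -> om X p b = 0 -> N p = 0.
Proof.
move=> Hp Ha Hb ab pa pb.
case: (wY) => _ wY'; case: (wt_cj wX) => _ wX'.
have := BFI p (cj X) a b Y.
have -> : B p (cj X) a = 0 by rewrite B23 wX' // om_cj pa oppr0 scale0r oppr0.
have -> : B p (cj X) b = 0 by rewrite B23 wX' // om_cj pb oppr0 scale0r oppr0.
rewrite B0l B0m !add0r wY' // BZr (wt_B Hp (wt_cj wX) wY Ha Hb) om_cj.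
rewrite scalerDl => /eqP; rewrite -subr_eq0 opprD addrCA subrr addr0.
by rewrite -scaleNr opprK scaler_eq0 (negPf ab) => /eqP.
Qed.

End Pair.
(** Weights are imaginary on the real rows of [h], so the factor ['i] makes these coordinates real;
    [nn] and [inn] are then the euclidean squared norm and product of coordinate vectors. *)
Definition qq (X : U) (k : 'I_r * 'I_r) := 'i * om X (row k.1 h) (row k.2 h).
Definition nn (X : U) := \sum_k qq X k ^+ 2.
Definition inn (X Y : U) := \sum_k qq X k * qq Y k.

Lemma qq_real X k : wt X -> qq X k \is Num.real.
Proof.
move=> wX; rewrite CrealE /qq rmorphM /= conjCi om_conj ?inH_row //.
by rewrite !cj_row mulrNN.
Qed.

Lemma nn_ge0 X : wt X -> 0 <= nn X.
Proof.
by move=> wX; apply: sumr_ge0 => k _; rewrite real_exprn_even_ge0 // qq_real.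
Qed.

Lemma inn_real X Y : wt X -> wt Y -> inn X Y \is Num.real.
Proof.
by move=> wX wY; apply: rpred_sum => k _; rewrite realM // qq_real.
Qed.

Lemma nn_comb a c X Y Z :
  (forall k, qq Z k = a * qq X k + c * qq Y k) ->
  nn Z = a ^+ 2 * nn X + c ^+ 2 * nn Y + 2 * a * c * inn X Y.
Proof.
move=> E; rewrite /nn /inn !mulr_sumr -!big_split; apply: eq_bigr => k _ /=.
rewrite E; ring.
Qed.

Lemma nn_eq0 X : wt X -> nn X = 0 -> forall k, qq X k = 0.
Proof.
move=> wX /eqP; rewrite psumr_eq0; last first.
  by move=> k _; rewrite real_exprn_even_ge0 // qq_real.
by move=> /allP A k; have := A k (mem_index_enum _); rewrite sqrf_eq0 => /eqP.
Qed.

Lemma qq_om X k : qq X k = 0 -> om X (row k.1 h) (row k.2 h) = 0.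
Proof. by move=> /eqP; rewrite mulf_eq0 (negPf (neq0Ci _)) => /eqP. Qed.

Lemma inH_ind (P : U -> Prop) : P 0 ->
  (forall a x y, P x -> P y -> P (a *: x + y)) ->
  (forall i, P (row i h)) -> forall p, inH p -> P p.
Proof.
move=> P0 PD Pr p /submxP[D ->]; rewrite mulmx_sum_row.
by elim/big_rec: _ => [|i x _ Px]; [exact: P0|exact: PD].
Qed.

Lemma om0l X q : om X 0 q = 0.
Proof. by rewrite -(scale0r 0) omZl mul0r. Qed.

Lemma om_rows_eq X Y : (forall k, om X (row k.1 h) (row k.2 h) = om Y (row k.1 h) (row k.2 h)) ->
  forall p q, inH p -> inH q -> om X p q = om Y p q.
Proof.
move=> E p q Hp Hq; move: p Hp.
apply: inH_ind => [|a x y Ex Ey|i]; first by rewrite !om0l.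
  by rewrite !omDl !omZl Ex Ey.
move: q Hq; apply: inH_ind => [|a x y Ex Ey|j]; first by rewrite !(omC _ (row i h)) !om0l.
  by rewrite !omDr !omZr Ex Ey.
exact: (E (i, j)).
Qed.

Lemma coroot_cj X p : cj (coroot X p) = - coroot X (cj p).
Proof. by rewrite /coroot Bcj cjK B23. Qed.

Lemma wt_BP p X Y : inH p -> wt X -> wt Y -> B p X Y != 0 -> wt (B p X Y).
Proof.
move=> Hp wX wY Z0; apply: (@wtI _ (fun q s => om X q s + om Y q s) Z0) => q s.
exact: wt_B.
Qed.

Lemma om_B p X Y q s : inH p -> wt X -> wt Y -> B p X Y != 0 ->
  inH q -> inH s -> om (B p X Y) q s = om X q s + om Y q s.
Proof. by move=> Hp wX wY Z0 Hq Hs; apply: omE => //; apply: wt_B. Qed.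

Lemma qq_B p X Y k : inH p -> wt X -> wt Y -> B p X Y != 0 ->
  qq (B p X Y) k = qq X k + qq Y k.
Proof. by move=> Hp wX wY Z0; rewrite /qq om_B ?inH_row // mulrDr. Qed.

Lemma qq_cj X k : qq (cj X) k = - qq X k.
Proof. by rewrite /qq om_cj mulrN. Qed.

(** * Splitting off the span of p1, p2, X, cj X for a weight of maximal norm *)

Section MaximalWeight.
Variable X : U.
Hypothesis wX : wt X.
Hypothesis X_gt0 : 0 < nn X.
Hypothesis X_max : forall Y, wt Y -> nn Y <= nn X.
Variables a1 a2 : U.
Local Notation p1 := (coroot X a1).
Local Notation p2 := (coroot X a2).
Hypotheses (Ha1 : inH a1) (Ha2 : inH a2) (p12 : om X p1 p2 != 0).

(* [om X + om Y] would be a weight of larger norm than [om X]. *)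
Lemma max_Z Y p : wt Y -> 0 < nn Y -> 0 <= inn X Y -> inH p -> B p X Y = 0.
Proof.
move=> wY Y0 XY Hp; apply/eqP; apply: contraT => Z0.
have E k : qq (B p X Y) k = 1 * qq X k + 1 * qq Y k by rewrite qq_B // !mul1r.
have := X_max (wt_BP Hp wX wY Z0); rewrite (nn_comb E) expr1n !mul1r !mulr1.
by rewrite -addrA gerDl lt_geF // ltr_pwDl // !mulr_ge0.
Qed.

(** By [om_plucker] the form [om X] has rank two, and it is nondegenerate on the plane of [p1],
    [p2]; the coefficients are those of the projection of [q] to this plane along the radical. *)
Lemma radical_split q : inH q -> exists2 c : C * C,
  let q' := q - c.1 *: p1 - c.2 *: p2 in inH q' /\ om X q' p1 = 0 &
  om X (q - c.1 *: p1 - c.2 *: p2) p2 = 0.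
Proof.
move=> Hq; have p21 : om X p2 p1 != 0 by rewrite omC oppr_eq0.
have o11 p : om X p p = 0 by rewrite /om B11 dot0l mul0r.
exists (om X q p2 / om X p1 p2, om X q p1 / om X p2 p1) => /=.
  split; first by rewrite -!scaleNr; apply: inHD; [apply: inHD|] => //; apply/inHZ/inH_coroot.
  by rewrite -!scaleNr !omDl !omZl o11 mulr0 addr0 mulNr divfK // subrr.
by rewrite -!scaleNr !omDl !omZl o11 mulr0 addr0 mulNr divfK // subrr.
Qed.

(** In the Plücker relation for [q], [s], [p1], [p2] only the product [om X q s * om X p1 p2]
    survives. *)
Lemma radicalP q s : inH q -> inH s -> om X q p1 = 0 -> om X q p2 = 0 ->
  om X q s = 0.
Proof.
move=> Hq Hs q1 q2.
have := om_plucker wX Hq Hs (inH_coroot wX Ha1) (inH_coroot wX Ha2).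
by rewrite q1 q2 !mul0r !addr0 => /eqP; rewrite mulf_eq0 (negPf p12) orbF => /eqP.
Qed.

Lemma weight_sum_neq0 Y : 0 <= inn X Y ->
  exists k, om X (row k.1 h) (row k.2 h) + om Y (row k.1 h) (row k.2 h) != 0.
Proof.
move=> XY; apply/existsP; apply: contraLR XY; rewrite negb_exists => /forallP E.
suff -> : inn X Y = - nn X by rewrite oppr_ge0 lt_geF.
rewrite /inn /nn -sumrN; apply: eq_bigr => k _.
have /eqP := negbNE (E k); rewrite addrC => /eqP; rewrite addr_eq0 => /eqP Ek.
by rewrite /qq Ek !mulrN expr2.
Qed.

Section Other.
Variable Y : U.
Hypotheses (wY : wt Y) (Y_gt0 : 0 < nn Y) (XY_ge0 : 0 <= inn X Y).
(** A weight space may have dimension greater than one: a vector with the same weight as [X] must be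
    taken orthogonal to [X] for the hermitian product. *)
Hypothesis XY_orth : (forall p q, inH p -> inH q -> om Y p q = om X p q) ->
  dot Y (cj X) = 0.

Let XY p : inH p -> B p X Y = 0.
Proof. exact: max_Z. Qed.

Lemma other_C0 : B X (cj X) Y = 0.
Proof.
have [k nz] := weight_sum_neq0 XY_ge0.
exact: (pair_C0 wX wY XY (inH_row k.1) (inH_row k.2) nz).
Qed.

(* If [om Y = om X], then [N q] lies in H and is orthogonal to H.  Otherwise
   [om Y - 2 om X] is longer than [om X], hence not a weight, so [N q] is killed by
   [ad_{p, cj X}] and therefore, by [pair_C0], by [ad_{X, cj X}]. *)
Lemma other_N_coroot q : inH q -> B (coroot X q) (cj X) Y = 0.
Proof.
move=> Hq; have wX' := wt_cj wX.
have [/forallP E|] := boolP [forall k, om Y (row k.1 h) (row k.2 h) == om X (row k.1 h) (row k.2 h)].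
  have {}E := om_rows_eq (fun k => eqP (E k)).
  have Ht := inH_coroot wX Hq.
  apply: inH_nondeg => [|s Hs].
    apply: inH_zero_weight => s t Hs Ht'.
    by rewrite wt_B // om_cj E // addNr scale0r.
  rewrite Bskew B23; case: wX' => _ ->; rewrite // dotNr dotZr XY_orth //.
  by rewrite mulr0 !oppr0.
rewrite negb_forall => /existsP[k neq].
have neq' : qq Y k - qq X k != 0.
  by rewrite /qq -mulrBr mulf_neq0 ?neq0Ci // subr_eq0.
set N := B q (cj X) Y.
(* The derivation [B X (cj X)] applied to [[q, cj X, Y]] leaves only the term
   [[coroot X q, cj X, Y]]. *)
suff N0 : B X (cj X) N = 0.
  have := BFI X (cj X) q (cj X) Y; rewrite -/N N0 B22 B0m addr0 other_C0 B0r addr0.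
  by rewrite -[B X (cj X) q]Bcyc.
have [->|Nn0] := eqVneq N 0; first by rewrite B0r.
have wN := wt_BP Hq wX' wY Nn0.
have qN l : qq N l = qq Y l - qq X l by rewrite qq_B // qq_cj addrC.
(* The right side is the squared norm of [om Y - 2 om X]. It exceeds [nn X] by twice the squared
   norm of [om Y - om X], which is positive, plus [nn X - nn Y], which is nonnegative by
   maximality. *)
have gap : nn X < 4 * nn X + nn Y - 4 * inn X Y.
  have dpos : 0 < nn X + nn Y - 2 * inn X Y.
    have E l : qq N l = (-1) * qq X l + 1 * qq Y l.
      by rewrite qN mulN1r mul1r addrC.
    have -> : nn X + nn Y - 2 * inn X Y = nn N by rewrite (nn_comb E); ring.
    rewrite lt_def nn_ge0 // andbT; apply: contraNneq neq' => /(nn_eq0 wN) /(_ k).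
    by rewrite qN => ->.
  rewrite -subr_gt0.
  have -> : 4 * nn X + nn Y - 4 * inn X Y - nn X =
    (nn X + nn Y - 2 * inn X Y) * 2 + (nn X - nn Y) by ring.
  by rewrite ltr_pwDl ?mulr_gt0 ?subr_ge0 ?X_max.
have XN p : inH p -> B p (cj X) N = 0.
  move=> Hp; apply/eqP; apply: contraT => M0.
  have E l : qq (B p (cj X) N) l = (-2) * qq X l + 1 * qq Y l.
    by rewrite qq_B // qN qq_cj; ring.
  have := X_max (wt_BP Hp wX' wN M0); rewrite (nn_comb E).
  have -> : (-2) ^+ 2 * nn X + 1 ^+ 2 * nn Y + 2 * (-2) * 1 * inn X Y =
     4 * nn X + nn Y - 4 * inn X Y by ring.
  by rewrite lt_geF.
suff [l nz] : exists l, om (cj X) (row l.1 h) (row l.2 h) + om N (row l.1 h) (row l.2 h) != 0.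
  have := pair_C0 wX' wN XN (inH_row l.1) (inH_row l.2) nz.
  by rewrite cjK B12 => /eqP; rewrite oppr_eq0 => /eqP.
(* If all these sums vanish then [om Y = 2 om X], and the right side of [gap] is zero. *)
apply/existsP; apply: contraLR gap; rewrite negb_exists => /forallP E.
have F l : qq Y l = 2 * qq X l.
  have /eqP := negbNE (E l) => /(congr1 ( *%R 'i)); rewrite mulr0 mulrDr.
  rewrite -[_ * om (cj X) _ _]/(qq (cj X) l) -[_ * om N _ _]/(qq N l) qN qq_cj.
  by move=> /eqP; rewrite addrCA addr_eq0 => /eqP ->; ring.
have -> : nn Y = 4 * nn X.
  by rewrite /nn mulr_sumr; apply: eq_bigr => l _; rewrite F; ring.
have -> : inn X Y = 2 * nn X.
  by rewrite /nn /inn mulr_sumr; apply: eq_bigr => l _; rewrite F; ring.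
have -> : 4 * nn X + 4 * nn X - 4 * (2 * nn X) = 0 by ring.
by rewrite lt_gtF.
Qed.

(** The component of [q] in the radical of [om X] is handled by [N_radical], the components along
    [p1] and [p2] by [other_N_coroot]. *)
Lemma other_N q : inH q -> B q (cj X) Y = 0.
Proof.
move=> Hq; have [[c e] /= [Hq' o1] o2] := radical_split Hq.
have := N_radical wX wY Hq' (inH_coroot wX Ha1) (inH_coroot wX Ha2) p12 o1 o2.
by rewrite -!scaleNr !BDl !BZl !other_N_coroot // !scaler0 !addr0.
Qed.

Lemma other_om p q : inH p -> inH q -> om Y q (coroot X p) = 0.
Proof.
move=> Hp Hq; have := B_X_N wX wY XY Hp Hq.
rewrite other_N // other_C0 B0r scaler0 subr0 => /esym/eqP.
by rewrite scaler_eq0; case: wY => /negPf -> _; rewrite orbF => /eqP.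
Qed.

End Other.
(** These conditions make [z] vanish in every bracket with two vectors among [p1], [p2], [X],
    [cj X]. Quantifying over H keeps them stable under [cj]. *)
Definition good (z : U) := [/\ forall p, inH p -> B p X z = 0,
  forall p, inH p -> B p (cj X) z = 0, B X (cj X) z = 0 &
  forall p q, inH p -> inH q -> B q (coroot X p) z = 0].

Definition decomposes (z : U) := exists c : (C * C) * (C * C),
  good (z - (c.1.1 *: p1 + c.1.2 *: p2 + c.2.1 *: X + c.2.2 *: cj X)).

Lemma good_comb a z t : good z -> good t -> good (a *: z + t).
Proof.
case=> z1 z2 z3 z4 [t1 t2 t3 t4]; split=> [p Hp|p Hp||p q Hp Hq]; rewrite Blin.
- by rewrite z1 // t1 // scaler0 addr0.
- by rewrite z2 // t2 // scaler0 addr0.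
- by rewrite z3 // t3 // scaler0 addr0.
- by rewrite z4 // t4 // scaler0 addr0.
Qed.

Lemma good0 : good 0.
Proof. by split=> *; rewrite B0r. Qed.

Lemma decomposes_comb a z t : decomposes z -> decomposes t -> decomposes (a *: z + t).
Proof.
move=> [[[c1 c2] [c3 c4]] gz] [[[e1 e2] [e3 e4]] gt].
exists ((a * c1 + e1, a * c2 + e2), (a * c3 + e3, a * c4 + e4)).
have := good_comb a gz gt; rewrite /=; congr good.
by apply/rowP => i; rewrite !mxE; ring.
Qed.

Lemma decomposes_good z : good z -> decomposes z.
Proof.
by move=> gz; exists ((0, 0), (0, 0)); rewrite //= !scale0r !addr0 subr0.
Qed.

Lemma decomposes_X : decomposes X.
Proof.
exists ((0, 0), (1, 0)); rewrite //= !scale0r !add0r addr0 scale1r subrr.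
exact: good0.
Qed.

Lemma decomposes_cjX : decomposes (cj X).
Proof.
exists ((0, 0), (0, 1)); rewrite //= !scale0r !add0r scale1r subrr.
exact: good0.
Qed.

(** The remainder [q'] lies in the radical of [om X]; then [[X, cj X, q']], which is its coroot, is
    a vector of H orthogonal to H, hence zero. *)
Lemma decomposes_H q : inH q -> decomposes q.
Proof.
move=> Hq; have [[c e] /= [Hq' o1] o2] := radical_split Hq.
exists ((c, e), (0, 0)); rewrite //= !scale0r !addr0 opprD addrA.
set q' := q - _ - _ in Hq' o1 o2 *.
have o s : inH s -> om X s q' = 0.
  by move=> Hs; rewrite omC radicalP ?oppr0.
have [_ wX1] := wX; have [_ wX2] := wt_cj wX; split.
- by move=> p Hp; rewrite B23 wX1 // o // scale0r oppr0.
- by move=> p Hp; rewrite B23 wX2 // om_cj o // oppr0 scale0r oppr0.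
- rewrite -Bcyc -/(coroot X q'); apply: inH_nondeg; first exact: inH_coroot.
  by move=> s Hs; rewrite dot_coroot // omC o // oppr0 mul0r.
- by move=> p s Hp Hs; apply: HB => //; apply: inH_coroot.
Qed.

Lemma good_cj z : good z -> good (cj z).
Proof.
case=> z1 z2 z3 z4; split=> [p Hp|p Hp||p q Hp Hq].
- by rewrite -[p]cjK -{1}[X]cjK -Bcj z2 ?cj0 //; apply: inHcj.
- by rewrite -[p]cjK -Bcj z1 ?cj0 //; apply: inHcj.
- by rewrite -{1}[X]cjK -Bcj B12 z3 oppr0 cj0.
- rewrite -[q]cjK -[coroot X p]cjK -Bcj coroot_cj BNm z4 ?oppr0 ?cj0 //; exact: inHcj.
Qed.

Lemma decomposes_cj z : decomposes z -> decomposes (cj z).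
Proof.
move=> [[[c1 c2] [c3 c4]] /= gz]; set w := (_ + _ + _ + _) in gz.
have -> : cj z = 1 *: cj (z - w) + cj w by rewrite scale1r -cjD subrK.
apply: decomposes_comb; first exact/decomposes_good/good_cj.
rewrite /w !cjD !cjZ cjK addrC; apply: decomposes_comb; first exact: decomposes_X.
rewrite addrC; apply: decomposes_comb; first exact: decomposes_cjX.
by apply: decomposes_comb; apply/decomposes_H; rewrite ?inHZ //; apply/inHcj/inH_coroot.
Qed.

Lemma decomposes_wt_pos Y : wt Y -> 0 < nn Y -> 0 <= inn X Y -> decomposes Y.
Proof.
move=> wY Y0 XY.
have G Z : wt Z -> 0 < nn Z -> 0 <= inn X Z ->
  ((forall p q, inH p -> inH q -> om Z p q = om X p q) -> dot Z (cj X) = 0) ->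
  decomposes Z.
  move=> wZ Z0 XZ oZ; apply: decomposes_good; split.
  - by move=> p Hp; apply: max_Z.
  - by move=> p Hp; apply: other_N.
  - exact: other_C0.
  - move=> p q Hp Hq; case: (wZ) => _ ->; rewrite ?inH_coroot //.
    by rewrite other_om // scale0r.
have [/forallP E|nE] := boolP [forall k, om Y (row k.1 h) (row k.2 h) == om X (row k.1 h) (row k.2 h)]; last first.
  apply: G => // E; case/negP: nE; apply/forallP => k.
  by rewrite E ?inH_row.
have {}E := om_rows_eq (fun k => eqP (E k)).
have tau0 : dot X (cj X) != 0 by rewrite gt_eqF // dot_cj_gt0 //; case: wX.
(* Removing the component along [X] keeps the weight and provides the orthogonality required by
   [XY_orth]. *)
set c := dot Y (cj X) / dot X (cj X); set Z := Y - c *: X.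
have -> : Y = c *: X + Z by rewrite /Z addrC subrK.
apply: decomposes_comb; first exact: decomposes_X.
have [->|Z0] := eqVneq Z 0; first exact/decomposes_good/good0.
have BZ p q : inH p -> inH q -> B p q Z = om Y p q *: Z.
  move=> Hp Hq; rewrite /Z -scaleNr BDr BZr; case: (wX) (wY) => [_ ->] // [_ ->] //.
  by rewrite E // scalerDr !scalerA [in RHS]mulrC.
have wZ := wtI Z0 BZ.
have qZ k : qq Z k = qq Y k by rewrite /qq (omE Z0 (BZ _ _ (inH_row _) (inH_row _))).
apply: G => //.
- by rewrite (_ : nn Z = nn Y) //; apply: eq_bigr => k _; rewrite qZ.
- by rewrite (_ : inn X Z = inn X Y) //; apply: eq_bigr => k _; rewrite qZ.
- by move=> _; rewrite /Z dotDl dotNl dotZl divfK // subrr.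
Qed.

(** A vector of weight zero lies in H. Otherwise [Y] or [cj Y] has nonnegative product with [X], and
    decomposability is stable under [cj]. *)
Lemma decomposes_wt Y : wt Y -> decomposes Y.
Proof.
move=> wY; have := nn_ge0 wY; rewrite le_eqVlt => /orP[/eqP/esym/(nn_eq0 wY) Y0|Y0].
  apply: decomposes_H; apply: inH_zero_weight => p q Hp Hq; case: (wY) => _ -> //.
  suff -> : om Y p q = 0 by rewrite scale0r.
  have E0 u v : om 0 u v = 0 by rewrite /om B0r dot0l mul0r.
  by rewrite -(E0 p q); apply: om_rows_eq => // k; rewrite E0 qq_om.
have [XY|XY] := real_ge0P (inn_real wX wY).
  exact: decomposes_wt_pos.
rewrite -[Y]cjK; apply: decomposes_cj; apply: decomposes_wt_pos.
- exact: wt_cj.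
- rewrite (_ : nn (cj Y) = nn Y) //.
  by apply: eq_bigr => k _; rewrite qq_cj sqrrN.
- rewrite (_ : inn X (cj Y) = - inn X Y) ?oppr_ge0 1?ltW //.
  by rewrite /inn -sumrN; apply: eq_bigr => k _; rewrite qq_cj mulrN.
Qed.

End MaximalWeight.

(** * Common eigenbasis, weight of maximal norm, and the resulting block *)

Lemma Bsum p q (I : finType) (F : I -> U) : B p q (\sum_i F i) = \sum_i B p q (F i).
Proof. by apply: big_morph => [x y|]; [apply: BDr|apply: B0r]. Qed.

Definition adm (p q : U) : 'M[C]_d := \matrix_i B p q (delta_mx 0 i).

Lemma mul_adm p q x : x *m adm p q = B p q x.
Proof.
rewrite mulmx_sum_row {2}[x]row_sum_delta.
rewrite Bsum; apply: eq_bigr => i _; rewrite rowK BZr //.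
Qed.

Lemma adm_inj (A A' : 'M[C]_d) : (forall x : U, x *m A = x *m A') -> A = A'.
Proof. by move=> E; apply/row_matrixP => i; rewrite !rowE E. Qed.

(** The operators given by pairs of rows of [h] commute because [H, H, H] = 0. They are
    skew-hermitian, hence normal and diagonalisable, so they have a common eigenbasis. *)
Lemma weight_basis : exists2 P : 'M[C]_d, P \in unitmx & forall t, wt (row t P).
Proof.
pose As := [seq adm (row k.1 h) (row k.2 h) | k : 'I_r * 'I_r].
have [|P Pu /allP PAs] := (codiagonalizableP As).1.
  split=> [A A' /mapP[k _ ->] /mapP[l _ ->]|A /mapP[k _ ->]].
    apply: adm_inj => x; rewrite !mulmxA !mul_adm BFI.
    by rewrite !(HB (inH_row _) (inH_row _) (inH_row _)) B0l B0m !add0r.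
  have /orthomx_spectralP E : adm (row k.1 h) (row k.2 h) \is normalmx.
    suff E : ((adm (row k.1 h) (row k.2 h)) ^t* = - adm (row k.1 h) (row k.2 h))%sesqui.
      by apply/normalmxP; rewrite E mulmxN mulNmx.
    apply/matrixP => i j; rewrite !mxE.
    have D l (x : U) : x 0 l = dot x (delta_mx 0 l).
      rewrite dotE (bigD1 l) //= mxE !eqxx mulr1 big1 ?addr0 // => m /negPf nm.
      by rewrite mxE nm mulr0.
    have Dr l : cj (delta_mx 0 l) = delta_mx 0 l :> U.
      by apply/rowP => m; rewrite !mxE rmorph_nat.
    rewrite ![B _ _ _ 0 _]D -dot_cj Bcj !cj_row !Dr.
    by rewrite Bskew dotC.
  exists (spectralmx (adm (row k.1 h) (row k.2 h))); first exact: spectral_unit.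
  apply/(similar_diagLR (spectral_unit _)).
  by exists (spectral_diag (adm (row k.1 h) (row k.2 h))); rewrite conjVmx ?spectral_unit.
exists P => // t.
have Pt0 : row t P != 0.
  apply: contraTneq Pu => Pt; apply/negP => Pu.
  have := mulmxV Pu; move/(congr1 (row t)); rewrite row_mul Pt mul0mx.
  by move/rowP/(_ t)/eqP; rewrite !mxE eqxx eq_sym oner_eq0.
have E k : exists c, B (row k.1 h) (row k.2 h) (row t P) = c *: row t P.
  have /similar_diagPex[D /(similarP Pu) E] : similar_diag P (adm (row k.1 h) (row k.2 h)).
    by apply: PAs; apply: map_f; rewrite mem_enum.
  exists (D 0 t); rewrite -mul_adm -row_mul E.
  by rewrite row_mul row_diag_mx -scalemxAl -rowE.
apply: (@wtI _ (om (row t P))) => // p q Hp; move: p Hp q.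
apply: inH_ind => [q Hq|a x y Ex Ey q Hq|i q].
- by rewrite B0l om0l scale0r.
- by rewrite BDl BZl Ex // Ey // omDl omZl scalerDl scalerA.
move: q; apply: inH_ind => [|a x y Ex Ey|j].
- by rewrite B0m omC om0l oppr0 scale0r.
- by rewrite BDm BZm Ex // Ey // omDr omZr scalerDl scalerA.
by have [c Ec] := E (i, j); rewrite (omE Pt0 Ec).
Qed.

Hypothesis Bnz : exists x y z, B x y z != 0.

(** A maximum over the finite eigenbasis suffices, since the weight of any [Y] is that of each basis
    vector occurring in [Y]. Some weight is nonzero: otherwise H would be the whole space and [B]
    zero. *)
Lemma max_weight : exists X, [/\ wt X, 0 < nn X & forall Y, wt Y -> nn Y <= nn X].
Proof.
have [P Pu wP] := weight_basis.
have ex z : z = \sum_t (z *m invmx P) 0 t *: row t P.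
  by rewrite -mulmx_sum_row mulmxKV.
have [t0 nt0] : exists t, nn (row t P) != 0.
  apply/existsP; apply: contraT; rewrite negb_exists => /forallP n0.
  have allH z : inH z.
    apply: inH_zero_weight => p q Hp Hq; rewrite (ex z).
    elim/big_rec: _ => [|t w _ Bw]; first by rewrite B0r.
    rewrite Blin Bw addr0; case: (wP t) => _ -> //.
    have E0 u v : om 0 u v = 0 by rewrite /om B0r dot0l mul0r.
    have -> : om (row t P) p q = 0.
      rewrite -(E0 p q); apply: om_rows_eq => // k; rewrite E0 qq_om //.
      by apply: nn_eq0 => //; apply/eqP/negbNE.
    by rewrite scale0r scaler0.
  by have [x [y [z]]] := Bnz; rewrite HB ?eqxx.
have [|t _ tmax] := real_arg_maxP (P := xpredT) (F := fun t => nn (row t P)) (i0 := t0) isT.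
  by move=> t _; rewrite ger0_real ?nn_ge0.
exists (row t P); split=> [//||Y wY].
  rewrite (lt_le_trans _ (tmax t0 isT)) // lt_def nt0 nn_ge0 //.
have [s cs] : exists s, (Y *m invmx P) 0 s != 0.
  apply/existsP; apply: contraT; rewrite negb_exists => /forallP n0.
  case: wY => /eqP[]; rewrite (ex Y) big1 // => s _.
  by rewrite (eqP (negbNE (n0 s))) scale0r.
have -> : nn Y = nn (row s P); last exact: tmax.
apply: eq_bigr => k _; congr (_ ^+ 2); congr (_ * _).
have := congr1 (fun z => (z *m invmx P) 0 s) (wY.2 _ _ (inH_row k.1) (inH_row k.2)).
rewrite {1}(ex Y).
have -> : B (row k.1 h) (row k.2 h) (\sum_t (Y *m invmx P) 0 t *: row t P) =
   (\row_t ((Y *m invmx P) 0 t * om (row t P) (row k.1 h) (row k.2 h))) *m P.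
  rewrite [RHS]mulmx_sum_row Bsum; apply: eq_bigr => u _.
  by rewrite BZr mxE -scalerA; case: (wP u) => _ ->; rewrite ?inH_row.
rewrite mulmxK // -scalemxAl; set c := Y *m invmx P in cs *.
have -> : (om Y (row k.1 h) (row k.2 h) *: c) 0 s = c 0 s * om Y (row k.1 h) (row k.2 h).
  by rewrite mxE mulrC.
by rewrite mxE => /(mulfI cs).
Qed.

Lemma simple_block_cartan : exists s : 'I_4 -> U,
  [/\ forall i, cj (s i) = s i,
      forall i j, dot (s i) (s j) = (i == j)%:R,
      dot (B (s 0) (s 1) (s 2)) (s 3) != 0 &
      forall z, (forall i, dot (s i) z = 0) -> forall i j, B (s i) (s j) z = 0].
Proof.
have [X [wX X0 Xmax]] := max_weight.
have tau0 : 0 < dot X (cj X) by rewrite dot_cj_gt0 //; case: wX.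
have [k ok] : exists k, om X (row k.1 h) (row k.2 h) != 0.
  apply/existsP; apply: contraLR X0; rewrite negb_exists => /forallP n0.
  rewrite (_ : nn X = 0) ?ltxx //; apply: big1 => k _.
  by rewrite /qq (eqP (negbNE (n0 k))) mulr0 expr0n.
set a := row k.1 h; have Ha : inH a := inH_row _.
(* With [p1] itself as second argument, [p2] is orthogonal to [p1], because [dot p2 p1] is a
   multiple of [om X p1 p1]. Moreover [p1] is imaginary and [p2] is real. *)
set p1 := coroot X a; set p2 := coroot X p1.
have H1 : inH p1 := inH_coroot wX Ha; have H2 : inH p2 := inH_coroot wX H1.
have c1 : cj p1 = - p1 by rewrite coroot_cj cj_row.
have c2 : cj p2 = p2 by rewrite coroot_cj c1 /coroot BNl opprK.
have p1n0 : p1 != 0.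
  apply: contraNneq ok => p10.
  have := dot_coroot wX Ha (inH_row k.2); rewrite -/p1 p10 dot0l => /esym/eqP.
  by rewrite mulf_eq0 (gt_eqF tau0) orbF.
have d1 : dot p1 p1 < 0.
  by have := dot_cj_gt0 p1n0; rewrite c1 dotNr oppr_gt0.
have p2n0 : p2 != 0.
  apply: contraTneq d1 => p20.
  have := dot_coroot wX H1 Ha; rewrite -/p2 p20 dot0l omC mulNr -(dot_coroot wX Ha H1).
  by move=> /eqP; rewrite eq_sym oppr_eq0 => /eqP ->; rewrite ltxx.
have d2 : 0 < dot p2 p2 by have := dot_cj_gt0 p2n0; rewrite c2.
have p12 : om X p1 p2 != 0.
  apply: contraTneq d2 => o0; have := dot_coroot wX H1 H2.
  by rewrite o0 mul0r => ->; rewrite ltxx.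
have dHX p Y : inH p -> wt Y -> om Y p1 p2 != 0 -> dot p Y = 0.
  move=> Hp wY nz; have := Bskew p1 p2 Y p; rewrite (HB H1 H2 Hp) dot0r oppr0.
  by case: wY => _ ->; rewrite // dotZl dotC => /eqP; rewrite mulf_eq0 (negPf nz) => /eqP.
have wcX := wt_cj wX.
have p12c : om (cj X) p1 p2 != 0 by rewrite om_cj oppr_eq0.
have dYY Y : wt Y -> om Y p1 p2 != 0 -> dot Y Y = 0.
  move=> wY nz; have := Bskew p1 p2 Y Y; case: wY => _ ->; rewrite // dotZl dotZr.
  move/eqP; rewrite -addr_eq0 -mulr2n mulrn_eq0 /= mulf_eq0 (negPf nz) => /eqP //.
have XX := dYY _ wX p12; have cXX := dYY _ wcX p12c.
have d12 : dot p1 p2 = 0 by rewrite dotC dot_coroot // /om B11 dot0l !mul0r.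
pose x := X + cj X; pose y := 'i *: (X - cj X).
have sp z : decomposes X a p1 z.
  have [P Pu wP] := weight_basis.
  have -> : z = \sum_t (z *m invmx P) 0 t *: row t P.
    by rewrite -mulmx_sum_row mulmxKV.
  elim/big_rec: _ => [|t w _ Bw]; first exact/decomposes_good/good0.
  exact/decomposes_comb/Bw/decomposes_wt.
have gX p g : good X g -> inH p -> dot g (coroot X p) = 0.
  by move=> [g1 _ _ _] Hp; rewrite /coroot -[LHS]opprK -Bskew g1 // dot0l oppr0.
have gY Y g : good X g -> wt Y -> om Y p1 p2 != 0 -> dot g Y = 0.
  move=> [_ _ _ g4] wY nz; have := Bskew p1 p2 g Y; rewrite g4 // dot0l.
  case: wY => _ ->; rewrite // dotZr => /eqP; rewrite eq_sym oppr_eq0 mulf_eq0.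
  by rewrite (negPf nz) => /eqP.
(* The four pairings read off the four coefficients of [z]: [p1] and [p2] are orthogonal to each
   other and to [X], [cj X], and the isotropic vectors [X], [cj X] pair only with each other. *)
have kill z : dot p1 z = 0 -> dot p2 z = 0 -> dot X z = 0 -> dot (cj X) z = 0 ->
  good X z.
  have [[[e1 e2] [e3 e4]] /= gz] := sp z.
  have [g gg ->] : exists2 g, good X g &
    z = e1 *: p1 + e2 *: p2 + e3 *: X + e4 *: cj X + g.
    by exists (z - (e1 *: p1 + e2 *: p2 + e3 *: X + e4 *: cj X)); rewrite // addrC subrK.
  have g1 : dot p1 g = 0 by rewrite dotC; apply: gX.
  have g2 : dot p2 g = 0 by rewrite dotC; apply: gX.
  have g3 : dot X g = 0 by rewrite dotC; apply: gY.
  have g4 : dot (cj X) g = 0 by rewrite dotC; apply: gY.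
  have h1 := dHX _ _ H1 wX p12; have h2 := dHX _ _ H2 wX p12.
  have h3 := dHX _ _ H1 wcX p12c; have h4 := dHX _ _ H2 wcX p12c.
  rewrite !dotDr !dotZr g1 g2 g3 g4 d12 [dot p2 p1]dotC d12 [dot (cj X) X]dotC.
  rewrite h1 h2 h3 h4 (dotC X p1) (dotC X p2) (dotC (cj X) p1) (dotC (cj X) p2).
  rewrite h1 h2 h3 h4 XX cXX !mulr0 !addr0 !add0r.
  move=> /eqP; rewrite mulf_eq0 (lt_eqF d1) orbF => /eqP ->.
  move=> /eqP; rewrite mulf_eq0 (gt_eqF d2) orbF => /eqP ->.
  move=> /eqP; rewrite mulf_eq0 (gt_eqF tau0) orbF => /eqP ->.
  move=> /eqP; rewrite mulf_eq0 (gt_eqF tau0) orbF => /eqP ->.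
  by rewrite !scale0r !add0r.
(* A real orthogonal basis of the block, still to be normalised. *)
pose v (i : 'I_4) := nth 0 [:: 'i *: p1; p2; x; y] i.
have vP (P : U -> Prop) : P ('i *: p1) -> P p2 -> P x -> P y -> forall i, P (v i).
  by move=> P0 P1 P2 P3; case=> [[|[|[|[|]]]]].
have vreal i : cj (v i) = v i.
  move: i; apply: (vP (fun w => cj w = w)) => //.
  - by rewrite cjZ conjCi c1 scalerN scaleNr opprK.
  - by rewrite /x cjD cjK addrC.
  - by rewrite /y cjZ cjD cjN cjK conjCi scaleNr -scalerN opprB.
have dxx : dot x x = 2 * dot X (cj X).
  by rewrite /x !dotDl !dotDr XX cXX [dot (cj X) X]dotC; ring.
have dyy : dot y y = 2 * dot X (cj X).
  rewrite /y dotZl dotZr mulrA -expr2 sqrCi !dotDl !dotDr !dotNl !dotNr XX cXX.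
  by rewrite [dot (cj X) X]dotC; ring.
have vv0 i : 0 < dot (v i) (v i).
  move: i; apply: (vP (fun w => 0 < dot w w)) => //.
  - by rewrite dotZl dotZr mulrA -expr2 sqrCi mulN1r oppr_gt0.
  - by rewrite dxx mulr_gt0.
  - by rewrite dyy mulr_gt0.
have pv p (i : 'I_4) : (p = p1 \/ p = p2) -> (1 < i)%N -> dot p (v i) = 0.
  move=> pE; have Hp : inH p by case: pE => ->.
  have e1 := dHX _ _ Hp wX p12; have e2 := dHX _ _ Hp wcX p12c.
  case: i => [[|[|[|[|]]]]] //= ? _; rewrite /v /= /x /y ?dotZr !dotDr ?dotNr e1 e2.
    by rewrite addr0.
  by rewrite subrr mulr0.
have dxy : dot x y = 0.
  rewrite /x /y dotZr !dotDl !dotDr !dotNr XX cXX [dot (cj X) X]dotC; ring.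
have vorth (i j : 'I_4) : i != j -> dot (v i) (v j) = 0.
  wlog ij : i j / (i < j)%N.
    move=> W; case: (ltngtP i j) => ij ne; first exact: W.
      by rewrite dotC W // eq_sym.
    by case/eqP: ne; apply: val_inj.
  move=> _; case: i ij => [[|[|[|[|]]]]] //= ? ij.
  - rewrite {1}/v /= dotZl; case: j ij => [[|[|[|[|]]]]] //= ? _.
    + by rewrite /v /= d12 mulr0.
    + by rewrite pv ?mulr0 //; left.
    + by rewrite pv ?mulr0 //; left.
  - by rewrite {1}/v /= pv //; right.
  - by case: j ij => [[|[|[|[|]]]]] //= ? _; rewrite /v /= dxy.
  - by case: j ij => [[|[|[|[|]]]]].
pose n i := (sqrtC (dot (v i) (v i)))^-1.
have n0 i : n i != 0 by rewrite invr_eq0 sqrtC_eq0 gt_eqF.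
exists (fun i => n i *: v i); split.
- move=> i; rewrite cjZ vreal; congr (_ *: _); apply/eqP; rewrite -CrealE.
  by rewrite realV ger0_real // sqrtC_ge0 ltW.
- move=> i j; rewrite dotZl dotZr; have [->|ij] := eqVneq i j; last by rewrite vorth // !mulr0.
  rewrite mulrA -expr2 exprVn sqrtCK mulVf // gt_eqF //.
- rewrite BZl BZm BZr !dotZl dotZr !mulf_neq0 //.
  rewrite /v /= BZl dotZl mulf_neq0 ?neq0Ci //.
  rewrite /x BDr; case: (wX) (wcX) => [_ ->] // [_ ->] //.
  rewrite om_cj scaleNr -scalerBr dotZl mulf_neq0 //.
  rewrite /y dotZr mulf_neq0 ?neq0Ci // !dotDl !dotDr !dotNl !dotNr XX cXX.
  rewrite [dot (cj X) X]dotC opprK add0r addr0 -opprD oppr_eq0 gt_eqF // addr_gt0 //.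
- move=> z zp i j; rewrite BZl BZm.
  have zv l : dot (v l) z = 0.
    have /eqP := zp l; rewrite dotZl mulf_eq0 (negPf (n0 l)) => /eqP //.
  have z1 : dot p1 z = 0.
    by have /eqP := zv 0; rewrite /v /= dotZl mulf_eq0 (negPf (neq0Ci _)) => /eqP.
  have z2 : dot p2 z = 0 := zv 1.
  have z3 : dot X z + dot (cj X) z = 0 by rewrite -dotDl (zv 2).
  have z4 : dot X z - dot (cj X) z = 0.
    have /eqP := zv 3; rewrite /v /= /y dotZl mulf_eq0 (negPf (neq0Ci _)) /=.
    by rewrite dotDl dotNl => /eqP.
  have z5 : dot X z = 0.
    move/eqP: z4; rewrite subr_eq0 => /eqP E; move/eqP: z3; rewrite -E.
    by rewrite -mulr2n mulrn_eq0 => /eqP.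
  have z6 : dot (cj X) z = 0 by move: z3; rewrite z5 add0r.
  have [g1 g2 g3 g4] := kill z z1 z2 z5 z6.
  suff -> : B (v i) (v j) z = 0 by rewrite !scaler0.
  wlog ij : i j / (i < j)%N.
    move=> W; case: (ltngtP i j) => ij; first exact: W.
      by rewrite B12 W // oppr0.
    by rewrite (val_inj ij) B11.
  have ga p (l : 'I_4) : inH p -> (1 < l)%N -> B p (v l) z = 0.
    move=> Hp; case: l => [[|[|[|[|]]]]] //= ? _; rewrite /v /= /x /y ?BZm BDm ?BNm g1 // g2 //.
      by rewrite addr0.
    by rewrite subrr scaler0.
  case: i ij => [[|[|[|[|]]]]] //= ? ij.
  + rewrite {1}/v /= BZl; case: j ij => [[|[|[|[|]]]]] //= ? _.
    * by rewrite /v /= g4 // scaler0.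
    * by rewrite ga ?scaler0.
    * by rewrite ga ?scaler0.
  + by rewrite {1}/v /= ga.
  + case: j ij => [[|[|[|[|]]]]] //= ? _; rewrite /v /= /x /y BZm BDm BNm !BDl !B11.
    by rewrite [B (cj X) X z]B12 g3 oppr0 !addr0 subrr scaler0.
  + by case: j ij => [[|[|[|[|]]]]].
Qed.

End Cartan.

Definition isotropic r (h : 'M[C]_(r, d)) := map_mx Num.conj h = h /\
  forall p q s, inH h p -> inH h q -> inH h s -> B p q s = 0.

(** A real [z] with [H, H, z] = 0 can be adjoined to H: by alternation [z] occurs at most once in a
    nonzero bracket. The codimension bounds the number of such extensions. *)
Lemma cartan_exists : exists r (h : 'M[C]_(r, d)), isotropic h /\
  forall z, cj z = z -> (forall p q, inH h p -> inH h q -> B p q z = 0) -> inH h z.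
Proof.
suff : forall n r (h : 'M[C]_(r, d)), isotropic h -> (d - \rank h <= n)%N ->
  exists r (h : 'M[C]_(r, d)), isotropic h /\
  forall z, cj z = z -> (forall p q, inH h p -> inH h q -> B p q z = 0) -> inH h z.
  move=> /(_ d 0%N (0 : 'M_(0, d))); apply; last exact: leq_subr.
  split; first by rewrite [LHS]flatmx0.
  by move=> p q s /submx0null ->; rewrite B0l.
elim=> [|n IHn] r h iso dn.
  exists r, h; split=> // z _ _; rewrite /inH submx_full // /row_full.
  by rewrite eqn_leq rank_leq_col -subn_eq0 -leqn0.
case: (classic (forall z, cj z = z ->
    (forall p q, inH h p -> inH h q -> B p q z = 0) -> inH h z)) => [|nmax].
  by exists r, h.
have [z nz] := not_all_ex_not _ _ nmax.
have [zr nz'] := imply_to_and _ _ nz; have [zB zh] := imply_to_and _ _ nz'.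
have [hr hB] := iso; pose h' := col_mx h z.
apply: (IHn _ h'); last first.
  have lt : (\rank h < \rank h')%N.
    apply: rank_ltmx; rewrite ltmxE; apply/andP; split.
      by apply/submxP; exists (row_mx 1%:M 0); rewrite mul_row_col mul1mx mul0mx addr0.
    apply/negP => /(submx_trans _) H; apply: zh; apply: H.
    by apply/submxP; exists (row_mx 0 1%:M); rewrite mul_row_col mul1mx mul0mx add0r.
  by rewrite leq_subLR; move: dn; rewrite leq_subLR => dn; apply: (leq_trans dn); rewrite addnS -addSn leq_add2r.
split.
  by rewrite /h' map_col_mx hr; congr col_mx.
have dec p : inH h' p -> exists2 p', inH h p' & exists a, p = p' + a *: z.
  move=> /submxP[D ->]; rewrite -[D]hsubmxK mul_row_col.
  exists (lsubmx D *m h); first exact: submxMl.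
  by exists (rsubmx D 0 0); rewrite {1}[rsubmx D]mx11_scalar mul_scalar_mx.
move=> p q s /dec[p' Hp [a ->]] /dec[q' Hq [c ->]] /dec[s' Hs [e ->]].
have zB1 u w : inH h u -> inH h w -> B u z w = 0.
  by move=> Hu Hw; rewrite B23 zB ?oppr0.
have zB2 u w : inH h u -> inH h w -> B z u w = 0.
  by move=> Hu Hw; rewrite Bcyc zB.
rewrite !(BDl, BDm, BDr, BZl, BZm, BZr) !B11 !B22 (hB p' q' s') // zB // zB1 // zB2 //.
by rewrite [B z q' z]Bcyc B22 !scaler0 !addr0.
Qed.

Theorem simple_block3 : (exists x y z, B x y z != 0) ->
  exists s : 'I_4 -> U,
  [/\ forall i, cj (s i) = s i,
      forall i j, dot (s i) (s j) = (i == j)%:R,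
      dot (B (s 0) (s 1) (s 2)) (s 3) != 0 &
      forall z, (forall i, dot (s i) z = 0) -> forall i j, B (s i) (s j) z = 0].
Proof.
by have [r [h [[hr hB] hmax]]] := cartan_exists; apply: simple_block_cartan hr hB hmax.
Qed.

End Complex3Algebra.

(** * Invariant forms on euclidean spaces *)

Section Update.
Variables (T : Type) (k : nat).
Implicit Types (x : 'I_k -> T) (i j : 'I_k).

Lemma upd_same x i y : upd x i y i = y.
Proof. by rewrite /upd eqxx. Qed.

Lemma upd_neq x i j y : j != i -> upd x i y j = x j.
Proof. by rewrite /upd => /negPf ->. Qed.

Lemma upd_id x i : upd x i (x i) = x.
Proof. by apply: functional_extensionality => j; rewrite /upd; case: eqP => // ->. Qed.

Lemma upd_upd x i y z : upd (upd x i y) i z = upd x i z.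
Proof. by apply: functional_extensionality => j; rewrite /upd; case: eqP. Qed.

Lemma updC x i j y z : i != j -> upd (upd x i y) j z = upd (upd x j z) i y.
Proof.
move=> ij; apply: functional_extensionality => t; rewrite /upd.
by case: eqP => // ->; rewrite eq_sym (negPf ij).
Qed.

End Update.

Definition fcons (T : Type) k (c : T) (y : 'I_k -> T) : 'I_k.+1 -> T :=
  fun i => if unlift ord0 i is Some j then y j else c.

Section Cons.
Variables (T : Type) (k : nat).
Implicit Types (y : 'I_k -> T) (c z : T).

Lemma fcons0 c y : fcons c y ord0 = c.
Proof. by rewrite /fcons unlift_none. Qed.

Lemma fconsS c y i : fcons c y (lift ord0 i) = y i.
Proof. by rewrite /fcons liftK. Qed.

Lemma fcons_eta (x : 'I_k.+1 -> T) : fcons (x ord0) (fun i => x (lift ord0 i)) = x.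
Proof.
apply: functional_extensionality => j; rewrite /fcons.
by case: unliftP => [i ->|->].
Qed.

Lemma upd_fcons0 c y z : upd (fcons c y) ord0 z = fcons z y.
Proof.
apply: functional_extensionality => j; rewrite /upd /fcons.
by case: unliftP => [i ->|->].
Qed.

Lemma upd_fconsS c y i z : upd (fcons c y) (lift ord0 i) z = fcons c (upd y i z).
Proof.
apply: functional_extensionality => j; rewrite /upd /fcons.
by case: unliftP => [t ->|->]; rewrite ?(inj_eq lift_inj).
Qed.

End Cons.

Section Forms.
Variables (R : rcfType) (V : vectType R).

(** * Alternating multilinear forms over an arbitrary space *)

Section Multilinear.
Variable K : nat.
Implicit Types (F : ('I_K -> V) -> R) (x : 'I_K -> V).

Definition mlin F := forall x i a y z,
  F (upd x i (a *: y + z)) = a * F (upd x i y) + F (upd x i z).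

Definition altf F := forall x i j, i != j -> x i = x j -> F x = 0.

(** Infinitesimal invariance: the derivative of [F] along the flow of [D] is zero. *)
Definition kills (D : V -> V) F :=
  forall y, \sum_t F (upd y t (D (y t))) = 0.

Variables (F : ('I_K -> V) -> R).
Hypotheses (mF : mlin F) (aF : altf F).

Lemma mlin0 x i : F (upd x i 0) = 0.
Proof.
have := mF x i 1 0 0; rewrite scale1r mul1r addr0 => /eqP.
by rewrite -[X in X == _]addr0 (inj_eq (addrI _)) eq_sym => /eqP.
Qed.

Lemma mlinD x i y z : F (upd x i (y + z)) = F (upd x i y) + F (upd x i z).
Proof. by rewrite -{1}[y]scale1r mF mul1r. Qed.

Lemma mlinZ x i a y : F (upd x i (a *: y)) = a * F (upd x i y).
Proof. by rewrite -[a *: y]addr0 mF mlin0 addr0. Qed.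

Lemma mlin_sum x i (I : finType) (G : I -> V) :
  F (upd x i (\sum_j G j)) = \sum_j F (upd x i (G j)).
Proof. by apply: (big_morph (fun z => F (upd x i z))) => [y z|]; [apply: mlinD|apply: mlin0]. Qed.

Lemma altf_swap x i j y z : i != j ->
  F (upd (upd x i y) j z) = - F (upd (upd x i z) j y).
Proof.
move=> ij; have E w : F (upd (upd x i w) j w) = 0.
  by apply: (aF ij); rewrite upd_same upd_neq // upd_same.
have := E (y + z); rewrite mlinD !(updC _ _ _ ij) !mlinD -!(updC _ _ _ ij) !E.
by rewrite add0r addr0 addrC => /eqP; rewrite addr_eq0 => /eqP.
Qed.

Lemma altf_tperm x i j : i != j -> F (x \o tperm i j) = - F x.
Proof.
move=> ij; rewrite -[in RHS](upd_id x i) -[in RHS](upd_id (upd x i (x i)) j).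
rewrite altf_swap // opprK; congr F; apply: functional_extensionality => t /=.
rewrite /upd (eq_sym j i) (negPf ij).
by case: tpermP => [->|->|/eqP/negPf -> /eqP/negPf ->] //; rewrite ?eqxx ?(negPf ij).
Qed.

Lemma altf_perm x (s : 'S_K) : F (x \o s) = (-1) ^+ s * F x.
Proof.
have [ts -> dts] := prod_tpermP s.
elim: ts dts x => [_ x|t ts IH /= /andP[dt dts] x].
  rewrite big_nil odd_perm1 mul1r; congr F.
  by apply: functional_extensionality => i /=; rewrite perm1.
rewrite big_cons odd_permM odd_tperm; case: (t) dt => i j /= ij; rewrite ij.
have -> : x \o (tperm i j * \prod_(i <- ts) tperm i.1 i.2)%g =
  (x \o (\prod_(i <- ts) tperm i.1 i.2)%g) \o tperm i j.
  by apply: functional_extensionality => l /=; rewrite permM.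
by rewrite altf_tperm // IH // signr_addb expr1 mulN1r mulNr.
Qed.

(** The linear span of [P], encoded by its induction principle, so that [P] may be any proposition
    and no generating list is needed. *)
Definition hull (P : V -> Prop) (x : V) := forall Q : V -> Prop, Q 0 ->
  (forall a y z, Q y -> Q z -> Q (a *: y + z)) -> (forall y, P y -> Q y) -> Q x.

Lemma hull_in P (x : V) : P x -> hull P x.
Proof. by move=> Px Q _ _; apply. Qed.

Lemma hull0 P : hull P 0.
Proof. by move=> Q. Qed.

Lemma hull_comb P a (x y : V) : hull P x -> hull P y -> hull P (a *: x + y).
Proof. by move=> hx hy Q Q0 Qc QP; apply: (Qc); [apply: hx|apply: hy]. Qed.

Lemma hullD P (x y : V) : hull P x -> hull P y -> hull P (x + y).
Proof. by rewrite -{2}[x]scale1r; apply: hull_comb. Qed.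

Lemma hull_sum P (I : finType) (G : I -> V) (c : I -> R) :
  (forall i, hull P (G i)) -> hull P (\sum_i c i *: G i).
Proof.
move=> hG; apply: (big_ind (hull P)); [exact: hull0|exact: hullD|move=> i _].
by rewrite -[_ *: _]addr0; apply: hull_comb => //; exact: hull0.
Qed.

(** Slots are reduced to generators one at a time; [n] bounds those still to be treated. As [P]
    depends on the slot, a distinguished entry can be kept fixed. *)
Lemma mlin_hull (P : 'I_K -> V -> Prop) :
  (forall y, (forall i, P i (y i)) -> F y = 0) ->
  forall y, (forall i, hull (P i) (y i)) -> F y = 0.
Proof.
move=> F0.
suff H n : forall y, (forall i : 'I_K, (i < n)%N -> hull (P i) (y i)) ->
    (forall i : 'I_K, (n <= i)%N -> P i (y i)) -> F y = 0.
  move=> y hy; apply: (H K) => [i _|i]; first exact: hy.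
  by rewrite leqNgt ltn_ord.
elim: n => [|n IHn] y hy Py; first by apply: F0 => i; apply: Py.
case: (ltnP n K) => [nK|Kn]; last first.
  by apply: IHn => [i ni|i ni]; [apply: hy; rewrite ltnW|have := ltn_ord i; rewrite ltnNge (leq_trans Kn)].
pose i0 := Ordinal nK; rewrite -(upd_id y i0).
apply: (hy i0 (ltnSn n) (fun z => F (upd y i0 z) = 0)).
- exact: mlin0.
- by move=> a u v Fu Fv; rewrite mF Fu Fv mulr0 addr0.
move=> z Pz; apply: IHn => i ni.
  rewrite upd_neq; first by apply: hy; rewrite ltnW.
  by rewrite -val_eqE /= ltn_eqF.
have [->|ne] := eqVneq i i0; first by rewrite upd_same.
by rewrite upd_neq //; apply: Py; rewrite ltn_neqAle ni andbT eq_sym.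
Qed.

Lemma kills_scale a D : kills D F -> kills (fun z => a *: D z) F.
Proof.
move=> kD y; rewrite -[RHS](mulr0 a) -[in RHS](kD y) mulr_sumr.
by apply: eq_bigr => t _; rewrite mlinZ.
Qed.

End Multilinear.

Lemma mlin_fcons K (F : ('I_K.+1 -> V) -> R) c : mlin F -> mlin (fun y => F (fcons c y)).
Proof. by move=> mF x i a y z; rewrite -!upd_fconsS mF. Qed.

Lemma altf_fcons K (F : ('I_K.+1 -> V) -> R) c : altf F -> altf (fun y => F (fcons c y)).
Proof.
move=> aF x i j ij xij; apply: (aF _ (lift ord0 i) (lift ord0 j)).
  by rewrite (inj_eq lift_inj).
by rewrite !fconsS.
Qed.

(** * Orthonormal families, rotations, invariant forms and blocks *)

Variable b : V -> V -> R.
Hypothesis bsb : sym_bilinear b.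

Lemma bC x y : b x y = b y x. Proof. exact: bsb.2. Qed.

Lemma b0l y : b 0 y = 0.
Proof.
have := bsb.1 1 0 0 y; rewrite scale1r mul1r addr0 => /eqP.
by rewrite -[X in X == _]addr0 (inj_eq (addrI _)) eq_sym => /eqP.
Qed.

Lemma bDl x y z : b (x + y) z = b x z + b y z.
Proof. by rewrite -{1}[x]scale1r bsb.1 mul1r. Qed.

Lemma bZl a x z : b (a *: x) z = a * b x z.
Proof. by rewrite -[a *: x]addr0 bsb.1 b0l addr0. Qed.

Lemma bNl x z : b (- x) z = - b x z.
Proof. by rewrite -scaleN1r bZl mulN1r. Qed.

Lemma b0r y : b y 0 = 0. Proof. by rewrite bC b0l. Qed.

Lemma bDr x y z : b z (x + y) = b z x + b z y.
Proof. by rewrite ![b z _]bC bDl. Qed.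

Lemma bZr a x z : b z (a *: x) = a * b z x.
Proof. by rewrite ![b z _]bC bZl. Qed.

Lemma bNr x z : b z (- x) = - b z x.
Proof. by rewrite ![b z _]bC bNl. Qed.

Lemma b_suml (I : finType) (G : I -> V) z : b (\sum_i G i) z = \sum_i b (G i) z.
Proof. by apply: (big_morph (b^~ z)) => [x y|]; [apply: bDl|apply: b0l]. Qed.

Lemma b_sumr (I : finType) (G : I -> V) z : b z (\sum_i G i) = \sum_i b z (G i).
Proof. by rewrite bC b_suml; apply: eq_bigr => i _; rewrite bC. Qed.

Definition orthonormal (I : finType) (e : I -> V) :=
  forall i j, b (e i) (e j) = (i == j)%:R.

Lemma orthonormal_coef (I : finType) (e : I -> V) (c : I -> R) i : orthonormal e ->
  b (e i) (\sum_j c j *: e j) = c i.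
Proof.
move=> oe; rewrite b_sumr (bigD1 i) //= bZr oe eqxx mulr1 big1 ?addr0 // => j ji.
by rewrite bZr oe eq_sym (negPf ji) mulr0.
Qed.

Lemma orthonormal_inj (I : finType) (e : I -> V) : orthonormal e -> injective e.
Proof.
move=> oe i j eij; apply/eqP; have := oe i j; rewrite eij oe eqxx.
by case: eqP => // _ /eqP; rewrite oner_eq0.
Qed.

Definition perp (I : finType) (e : I -> V) z := z - \sum_i b (e i) z *: e i.

Lemma perpP (I : finType) (e : I -> V) z i : orthonormal e -> b (e i) (perp e z) = 0.
Proof. by move=> oe; rewrite /perp bDr bNr orthonormal_coef // subrr. Qed.

Lemma perpE (I : finType) (e : I -> V) z : z = \sum_i b (e i) z *: e i + perp e z.
Proof. by rewrite /perp addrC subrK. Qed.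

Lemma orthonormal_free (I : finType) (e : I -> V) : orthonormal e ->
  free [seq e i | i : I].
Proof.
move=> oe; apply/(@freeP _ _ _ (codom_tuple e)) => c c0 i.
have E (j : 'I_#|I|) : (codom_tuple e)`_j = e (enum_val j).
  by rewrite /= nth_image.
have := congr1 (b (e (enum_val i))) c0; rewrite b0r b_sumr (bigD1 i) //= E bZr.
rewrite oe eqxx mulr1 big1 ?addr0 // => j ji.
by rewrite E bZr oe (inj_eq enum_val_inj) eq_sym (negPf ji) mulr0.
Qed.

Lemma orthonormal_dim (I : finType) (e : I -> V) : orthonormal e ->
  (#|I| <= \dim (fullv : {vspace V}))%N.
Proof.
move=> oe; have /eqP fr := orthonormal_free oe.
by have := dimvS (subvf <<[seq e i | i : I]>>); rewrite fr size_image.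
Qed.

Definition rot K (e : 'I_K -> V) l m z := b (e l) z *: e m - b (e m) z *: e l.

(** Invariance is evaluated on [y] with [e l] in slot [i]: the rotation turns this entry into [e m]
    and kills all the others. *)
Lemma kills_rot_zero K n (F : ('I_n -> V) -> R) (e : 'I_K -> V) l m y i :
  mlin F -> orthonormal e -> l != m -> kills (rot e l m) F ->
  y i = e m -> (forall j, j != i -> b (e l) (y j) = 0 /\ b (e m) (y j) = 0) ->
  F y = 0.
Proof.
move=> mF oe lm kr yi yo; have := kr (upd y i (e l)).
rewrite (bigD1 i) //= upd_same upd_upd big1 ?addr0 => [|j ji]; last first.
  rewrite upd_neq // /rot; have [-> ->] := yo j ji.
  by rewrite !scale0r subrr mlin0.
by rewrite /rot !oe eqxx eq_sym (negPf lm) scale1r scale0r subr0 -yi upd_id.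
Qed.


(** For the form of a metric bracket the operators [D] are the maps [ad] up to sign, and [kills D F]
    combines the derivation property with skew-symmetry. *)
Definition inv_form K (F : ('I_K -> V) -> R) := [/\ mlin F, altf F &
  forall x i j, i != j -> exists2 D : V -> V,
    (forall z w, b (D z) w = F (upd (upd x i z) j w)) & kills D F].

(** Two slots are left free because two free slots define an operator; the last clause is what
    identifies this operator with a multiple of a rotation. *)
Definition block K (F : ('I_K -> V) -> R) (e : 'I_K -> V) :=
  [/\ orthonormal e, F e != 0 & forall l m z w, l != m ->
     (forall i, b (e i) z = 0) -> F (upd (upd e l z) m w) = 0].

Hypothesis bpos : euclidean b.

Lemma b_nondeg x y : (forall w, b x w = b y w) -> x = y.
Proof.
move=> E; apply/eqP; rewrite -subr_eq0; apply: contraT => /bpos.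
by rewrite bDl bNl E subrr ltxx.
Qed.

Section Block.
Variables (K : nat) (F : ('I_K -> V) -> R) (e : 'I_K -> V).
Hypotheses (iF : inv_form F) (be : block F e).

Let mF : mlin F. Proof. by case: iF. Qed.
Let aF : altf F. Proof. by case: iF. Qed.
Let oe : orthonormal e. Proof. by case: be. Qed.

(** Expanding [z] and [w] along the block, alternation leaves only the terms in [e l] and [e m]. *)
Lemma block_two l m z w : l != m ->
  F (upd (upd e l z) m w) =
  F e * (b (e l) z * b (e m) w - b (e m) z * b (e l) w).
Proof.
move=> lm; have [_ _ bz] := be.
have G0 i w' : i != l -> i != m -> F (upd (upd e l (e i)) m w') = 0.
  move=> il im; apply: (aF il); rewrite upd_neq // upd_neq // upd_neq // upd_same //.
have G1 i j w' : i != j -> F (upd e i w') = b (e i) w' * F e.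
  move=> ij; rewrite {1}[w'](perpE e) mlinD // mlin_sum // (bigD1 i) //= mlinZ // upd_id.
  rewrite big1 ?addr0 => [|t ti]; last first.
    rewrite mlinZ // (_ : F _ = 0) ?mulr0 //; apply: (aF ti).
    by rewrite upd_neq // upd_same.
  have -> : upd e i (perp e w') = upd (upd e j (e j)) i (perp e w') by rewrite upd_id.
  rewrite -updC // bz ?addr0 // => t; exact: perpP.
have Gll w' : F (upd (upd e l (e l)) m w') = b (e m) w' * F e.
  by rewrite upd_id (@G1 m l) // eq_sym.
have Gml w' : F (upd (upd e l (e m)) m w') = - (b (e l) w' * F e).
  by rewrite altf_swap // updC // upd_id (@G1 l m).
rewrite {1}[z](perpE e) updC // mlinD // mlin_sum // -updC // bz // ?addr0; last first.
  by move=> i; apply: perpP.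
rewrite (bigD1 l) //= (bigD1 m) /= 1?eq_sym // big1 ?addr0.
  by rewrite !mlinZ // -(updC _ (e l)) // -(updC _ (e m)) // Gll Gml; ring.
by move=> i /andP[il im]; rewrite mlinZ // -updC // G0 // mulr0.
Qed.

Lemma block_kills l m : l != m -> kills (rot e l m) F.
Proof.
move=> lm; have [_ _ /(_ e l m lm)[D DE kD]] := iF; have [_ Fe _] := be.
have -> : rot e l m = fun z => (F e)^-1 *: D z; last exact: kills_scale.
apply: functional_extensionality => z; apply: b_nondeg => w.
by rewrite /rot bZl DE block_two // bDl bNl !bZl mulKf // [b (e m) w]bC.
Qed.

End Block.

Section FullBlock.
Variables (K : nat) (F : ('I_K -> V) -> R) (e : 'I_K -> V).
Hypotheses (mF : mlin F) (aF : altf F) (oe : orthonormal e).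
Hypothesis kF : forall l m, l != m -> kills (rot e l m) F.

(** This is the orthogonal splitting: [F] vanishes as soon as a block vector meets a vector
    orthogonal to the block. The other slots reduce to block vectors or orthogonal ones. Since slot
    [j] holds no block vector, some [e m] is missing, and the rotation of [e m] and [e l]
    applies. *)
Lemma block_full y i j l : i != j -> y i = e l ->
  (forall t, b (e t) (y j) = 0) -> F y = 0.
Proof.
move=> ij yi yj.
pose ort z := forall t, b (e t) z = 0.
pose P t z := if t == i then z = e l else if t == j then ort z else
  ort z \/ exists m, z = e m.
apply: (mlin_hull mF (P := P)) => [{y yi yj} y Py|t]; last first.
  rewrite /P; case: eqP => [->|_]; first exact: hull_in.
  case: eqP => [->|_]; first exact: hull_in.
  rewrite [y t](perpE e); apply: hullD.
    by apply: hull_sum => k; apply: hull_in; right; exists k.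
  by apply: hull_in; left => k; apply: perpP.
have yi : y i = e l by have := Py i; rewrite /P eqxx.
have yj : ort (y j) by have := Py j; rewrite /P eq_sym (negPf ij) eqxx.
have yt t : ort (y t) \/ exists m, y t = e m.
  have := Py t; rewrite /P; case: (t == i) => [->|]; first by right; exists l.
  by case: (t == j) => // ?; left.
case: (classic (exists2 t, t != i & y t = e l)) => [[t ti ytl]|nl].
  by apply: (aF ti); rewrite ytl.
(* If every block vector occurred, the map choosing its slot would be injective, hence onto, and
   slot [j] would hold a block vector. *)
have [m nm] : exists m, forall t, y t <> e m.
  apply: NNPP => /not_ex_all_not nm.
  have /fin_all_exists[f fE] m : exists t, y t = e m.
    by apply: NNPP => /not_ex_all_not ?; apply: (nm m).
  have fI : injective f.
    by move=> m m' ff; apply: (orthonormal_inj oe); rewrite -!fE ff.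
  have := yj (invF fI j); rewrite -{2}(f_invF fI j) fE oe eqxx => /eqP.
  by rewrite oner_eq0.
have ml : m != l by apply/eqP => ml; apply: (nm i); rewrite ml.
apply: (kills_rot_zero mF oe ml (kF ml) yi) => t ti.
case: (yt t) => [o|[k yk]]; first by split; apply: o.
rewrite yk !oe; split; case: eqP => // kE.
  by case: (nm t); rewrite yk kE.
by case: nl; exists t; rewrite // yk kE.
Qed.

End FullBlock.

(** The vector [c] already fills a slot of the tuple defining [D], so [D c = 0] by alternation and
    the slot of [c] contributes nothing. *)
Lemma inv_form_fcons K (F : ('I_K.+1 -> V) -> R) c : inv_form F ->
  inv_form (fun y => F (fcons c y)).
Proof.
move=> [mF aF iF]; split; [exact: mlin_fcons|exact: altf_fcons|move=> x i j ij].
have ij' : lift ord0 i != lift ord0 j by rewrite (inj_eq lift_inj).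
have [D DE kD] := iF (fcons c x) _ _ ij'; exists D.
  by move=> z w; rewrite DE !upd_fconsS.
have Dc : D c = 0.
  apply: b_nondeg => w; rewrite DE b0l !upd_fconsS.
  rewrite -(upd_id (fcons c _) ord0) fcons0 -[X in upd X ord0](upd_id _ (lift ord0 i)).
  apply: (aF _ ord0 (lift ord0 i)); first by rewrite eq_sym.
  by rewrite upd_same upd_neq 1?eq_sym // upd_same fconsS upd_neq // upd_same.
move=> y; have := kD (fcons c y); rewrite big_ord_recl fcons0 Dc mlin0 // add0r => kE.
rewrite -[RHS]kE.
by apply: eq_bigr => t _; rewrite fconsS upd_fconsS.
Qed.

Lemma normalize x : x != 0 -> exists2 a, a != 0 & b (a *: x) (a *: x) = 1.
Proof.
move=> /bpos x0; exists (Num.sqrt (b x x))^-1.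
  by rewrite invr_eq0 sqrtr_eq0 -ltNge.
by rewrite bZl bZr mulrA -expr2 exprVn sqr_sqrtr ?ltW // mulVf // gt_eqF.
Qed.

Lemma orthonormal_fcons K (e : 'I_K -> V) x : orthonormal e -> b x x = 1 ->
  (forall i, b (e i) x = 0) -> orthonormal (fcons x e).
Proof.
move=> oe x1 ex i j.
case: (unliftP ord0 i) => [i' ->|->]; case: (unliftP ord0 j) => [j' ->|->];
  rewrite ?fconsS ?fcons0 //.
by rewrite bC ex.
Qed.

Lemma orthonormal_basis : exists d (o : 'I_d -> V), orthonormal o /\
  forall z, z = \sum_i b (o i) z *: o i.
Proof.
suff H n : forall d (o : 'I_d -> V), orthonormal o ->
    (\dim (fullv : {vspace V}) - d <= n)%N ->
    exists d (o : 'I_d -> V), orthonormal o /\ forall z, z = \sum_i b (o i) z *: o i.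
  apply: (H (\dim (fullv : {vspace V})) 0 (fun=> 0)); last exact: leq_subr.
  by case.
elim: n => [|n IHn] d o oo dn; case: (classic (exists z, perp o z != 0)) => [[z zn]|nz].
- have [a a0 a1] := normalize zn.
  have /orthonormal_dim : orthonormal (fcons (a *: perp o z) o).
    by apply: orthonormal_fcons => // i; rewrite bZr perpP // mulr0.
  by rewrite card_ord => /(leq_ltn_trans _) H; have := H d (leqnn _); rewrite ltnNge -subn_eq0 -leqn0 dn.
- exists d, o; split=> // z; apply/eqP; rewrite -subr_eq0.
  by apply/negPn/negP => zn; apply: nz; exists z.
- have [a a0 a1] := normalize zn.
  apply: (IHn _ (fcons (a *: perp o z) o)).
    by apply: orthonormal_fcons => // i; rewrite bZr perpP // mulr0.
  by rewrite subnS; case: (_ - _)%N dn.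
- exists d, o; split=> // z; apply/eqP; rewrite -subr_eq0.
  by apply/negPn/negP => zn; apply: nz; exists z.
Qed.

(** The rotations of [e] are operators of [F] itself, up to a factor, hence kill [F]. The vector
    completing the block is the one dual to [F] with [e] in the last slots; [c] only served to find
    [e] and need not lie in the new block. *)
Lemma block_step K (F : ('I_K.+1 -> V) -> R) c (e : 'I_K -> V) : (2 < K)%N ->
  inv_form F -> block (fun y => F (fcons c y)) e ->
  exists e' : 'I_K.+1 -> V, block F e'.
Proof.
move=> K2 iF be; have iFc := inv_form_fcons c iF; have [mF aF dF] := iF.
have [oe Fce _] := be.
have kF l m : l != m -> kills (rot e l m) F.
  move=> lm; have lm' : lift ord0 l != lift ord0 m by rewrite (inj_eq lift_inj).
  have [D DE kD] := dF (fcons c e) _ _ lm'.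
  have -> : rot e l m = fun z => (F (fcons c e))^-1 *: D z; last exact: kills_scale.
  apply: functional_extensionality => z; apply: b_nondeg => w.
  rewrite /rot bZl DE !upd_fconsS (block_two iFc be) // bDl bNl !bZl mulKf //.
have [i0 _] : {i0 : 'I_K | true} by exists (Ordinal (ltnW (ltnW K2))).
have [p pE] : exists p, forall z, b p z = F (fcons z e).
  have ne : lift ord0 i0 != ord0 by rewrite eq_sym.
  have [D DE _] := dF (fcons 0 e) _ _ ne; exists (D (e i0)) => z.
  by rewrite DE upd_fconsS upd_id upd_fcons0.
have pn0 : p != 0 by apply: contraNneq Fce => p0; rewrite -pE p0 b0l.
have ep i : b (e i) p = 0.
  rewrite bC pE; apply: (aF _ ord0 (lift ord0 i)); first by rewrite eq_sym.
  by rewrite fcons0 fconsS.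
have [a a0 a1] := normalize pn0; set q := a *: p in a1.
have eq i : b (e i) q = 0 by rewrite bZr ep mulr0.
exists (fcons q e); split.
- exact: orthonormal_fcons.
- by rewrite -pE bZr mulf_neq0 // gt_eqF // bpos.
have kz l m y i : l != m -> y i = e m ->
    (forall j, j != i -> b (e l) (y j) = 0 /\ b (e m) (y j) = 0) -> F y = 0.
  by move=> lm; apply: (kills_rot_zero mF oe lm (kF _ _ lm)).
(* First case: slot 0 is one of the two free slots. The component of [w] along [e l] gives a
   multiple of [b p z], and its orthogonal component dies under a rotation of [e l] with another
   [e m]. *)
have A l z w : (forall i, b (e i) z = 0) -> b q z = 0 -> F (fcons w (upd e l z)) = 0.
  move=> ez qz; rewrite -(upd_fcons0 0) {1}[w](perpE e).
  rewrite mlinD // mlin_sum // (bigD1 l) //= mlinZ //.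
  have -> : F (upd (fcons 0 (upd e l z)) ord0 (e l)) = 0.
    have := altf_swap mF aF (fcons 0 e) (e l) z (_ : ord0 != lift ord0 l).
    rewrite !upd_fcons0 !upd_fconsS upd_id -pE => /(_ isT) ->.
    move/eqP: qz; rewrite bZl mulf_eq0 (negPf a0) => /eqP -> //=.
    by rewrite oppr0.
  rewrite mulr0 add0r big1 ?add0r => [|i il]; last first.
    rewrite mlinZ // upd_fcons0 (_ : F _ = 0) ?mulr0 //.
    apply: (aF _ ord0 (lift ord0 i)); first by rewrite eq_sym.
    by rewrite fcons0 fconsS upd_neq.
  have [m ml] : exists m, m != l.
    apply: NNPP => /not_ex_all_not nm; have := subset_leq_card (subset_predT (pred1 l)).
    have /eq_card -> : predT =i pred1 l.
      by move=> m; rewrite !inE; apply/esym/negPn/negP/nm.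
    move=> _; have /eq_card : 'I_K =i pred1 l.
      by move=> m; rewrite !inE; apply/esym/negPn/negP/nm.
    by rewrite card_ord card1 => KE; move: K2; rewrite KE.
  rewrite upd_fcons0; apply: (kz l m _ (lift ord0 m)); first by rewrite eq_sym.
    by rewrite fconsS upd_neq.
  move=> j; rewrite /fcons; case: unliftP => [j' ->|-> _]; last by rewrite !perpP.
  rewrite (inj_eq lift_inj) => jm; rewrite /upd; case: eqP => // jl.
  by rewrite !oe eq_sym; case: eqP => [/esym //|_]; rewrite eq_sym (negPf jm).
move=> l m z w lm zo.
have ez i : b (e i) z = 0 by have := zo (lift ord0 i); rewrite fconsS.
have qz : b q z = 0 by have := zo ord0; rewrite fcons0.
case: (unliftP ord0 l) lm => [l' ->|->]; case: (unliftP ord0 m) => [m' ->|->] //.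
- rewrite (inj_eq lift_inj) !upd_fconsS => lm.
  have [j jl jm] : exists2 j, j != l' & j != m'.
    have : (0 < #|~: [set l'; m']|)%N.
      by rewrite cardsCs setCK card_ord cards2 lm subn_gt0.
    by case/card_gt0P => j; rewrite !inE negb_or => /andP[]; exists j.
  (* Second case: both free slots are among those of [e]. A third vector [e j] is still present, and
     it is rotated with the absent [e t]. *)
  have Z t w' : (t = l' \/ t = m') -> b (e t) w' = 0 -> b (e j) w' = 0 ->
      F (fcons q (upd (upd e l' z) m' w')) = 0.
    move=> tE tw jw; have tj : t != j by case: tE => ->; rewrite eq_sym.
    apply: (kz t j _ (lift ord0 j)) => //; first by rewrite fconsS !upd_neq.
    move=> i; rewrite /fcons; case: unliftP => [i' ->|-> _]; last by rewrite !eq.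
    rewrite (inj_eq lift_inj) => ij; rewrite /upd; case: eqP => // im.
    case: eqP => // il; rewrite !oe [j == _]eq_sym (negPf ij).
    by case: eqP => // ti; case: tE => tE; [case: il|case: im]; rewrite -ti.
  rewrite -upd_fconsS {1}[w](perpE e) mlinD // mlin_sum //.
  rewrite upd_fconsS (Z l') ?perpP //; [rewrite addr0|by left].
  apply: big1 => i _; rewrite mlinZ // upd_fconsS.
  have [->|ij] := eqVneq i j.
    rewrite (_ : F _ = 0) ?mulr0 //; apply: (aF _ (lift ord0 m') (lift ord0 j)).
      by rewrite (inj_eq lift_inj) eq_sym.
    by rewrite !fconsS upd_same !upd_neq.
  have [il|il] := eqVneq i l'.
    by rewrite (Z m') ?mulr0 //; [right|rewrite il oe eq_sym (negPf lm)|rewrite oe eq_sym (negPf ij)].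
  by rewrite (Z l') ?mulr0 //; [left|rewrite oe eq_sym (negPf il)|rewrite oe eq_sym (negPf ij)].
- by move=> _; rewrite upd_fconsS upd_fcons0 A.
- move=> lm; rewrite altf_swap // upd_fcons0 upd_fconsS A ?oppr0 //.
Qed.

Definition mk4 (x y z w : V) : 'I_4 -> V := fun i => nth 0 [:: x; y; z; w] i.

(** * Forms of arity four, through the complexification of the associated 3-bracket *)

Section FourForm.
Variable F : ('I_4 -> V) -> R.
Hypothesis iF : inv_form F.
Variables (d : nat) (o : 'I_d -> V).
Hypothesis oo : orthonormal o.
Hypothesis oE : forall z, z = \sum_i b (o i) z *: o i.
Local Notation f4 x y z w := (F (mk4 x y z w)).

Let mF : mlin F. Proof. by case: iF. Qed.
Let aF : altf F. Proof. by case: iF. Qed.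

Lemma mk4_eta y : y = mk4 (y 0) (y 1) (y 2) (y 3).
Proof.
apply: functional_extensionality; case=> [[|[|[|[|]]]]] //= i;
  by congr y; apply: val_inj.
Qed.

Lemma upd_mk4 x y z w t :
  (upd (mk4 x y z w) 0 t = mk4 t y z w) * (upd (mk4 x y z w) 1 t = mk4 x t z w) *
  (upd (mk4 x y z w) 2 t = mk4 x y t w) * (upd (mk4 x y z w) 3 t = mk4 x y z t).
Proof.
by do ![split]; apply: functional_extensionality; case=> [[|[|[|[|]]]]].
Qed.

Lemma f4_12 x y z w : f4 x y z w = - f4 y x z w.
Proof.
have := altf_swap mF aF (mk4 0 0 z w) x y (isT : (0 : 'I_4) != 1).
by rewrite !upd_mk4.
Qed.

Lemma f4_23 x y z w : f4 x y z w = - f4 x z y w.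
Proof.
have := altf_swap mF aF (mk4 x 0 0 w) y z (isT : (1 : 'I_4) != 2).
by rewrite !upd_mk4.
Qed.

Lemma f4_34 x y z w : f4 x y z w = - f4 x y w z.
Proof.
have := altf_swap mF aF (mk4 x y 0 0) z w (isT : (2 : 'I_4) != 3).
by rewrite !upd_mk4.
Qed.

Definition br3 x y z := \sum_l f4 x y z (o l) *: o l.

Lemma b_br3 x y z w : b (br3 x y z) w = f4 x y z w.
Proof.
rewrite /br3 b_suml -[in RHS](upd_mk4 x y z 0 w).2 {2}[w]oE mlin_sum //.
by apply: eq_bigr => i _; rewrite bZl mlinZ // upd_mk4 mulrC.
Qed.

Lemma br3_lin x y a z t : br3 x y (a *: z + t) = a *: br3 x y z + br3 x y t.
Proof.
apply: b_nondeg => w; rewrite bDl bZl !b_br3.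
by have := mF (mk4 x y 0 w) 2 a z t; rewrite !upd_mk4.
Qed.

Lemma br3_12 x y z : br3 x y z = - br3 y x z.
Proof. by apply: b_nondeg => w; rewrite bNl !b_br3 f4_12. Qed.

Lemma br3_23 x y z : br3 x y z = - br3 x z y.
Proof. by apply: b_nondeg => w; rewrite bNl !b_br3 f4_23. Qed.

(** The operator of slots 2 and 3 is [br3 x y]; its invariance on [z], [t], [w], [u] is the claim
    paired with [u]. *)
Lemma br3_FI x y z t w : br3 x y (br3 z t w) =
  br3 (br3 x y z) t w + br3 z (br3 x y t) w + br3 z t (br3 x y w).
Proof.
have [_ _ /(_ (mk4 x y 0 0) 2 3 isT)[D DE kD]] := iF.
have {}DE u : D u = br3 x y u.
  by apply: b_nondeg => v; rewrite DE b_br3 !upd_mk4.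
apply: b_nondeg => u; rewrite !bDl !b_br3 f4_34 -b_br3 bC b_br3.
have := kD (mk4 z t w u); rewrite !big_ord_recl big_ord0 addr0.
have -> : lift ord0 (ord0 : 'I_3) = 1 by apply: val_inj.
have -> : lift ord0 (lift ord0 (ord0 : 'I_2)) = 2 by apply: val_inj.
have -> : lift ord0 (lift ord0 (lift ord0 (ord0 : 'I_1))) = 3 by apply: val_inj.
rewrite !upd_mk4 /mk4 /= -!/(mk4 _ _ _ _) !DE.
by rewrite addrA addrA => /eqP; rewrite addr_eq0 => /eqP ->.
Qed.

Lemma br3_linl a x t y z : br3 (a *: x + t) y z = a *: br3 x y z + br3 t y z.
Proof.
by rewrite br3_12 br3_23 opprK br3_lin [in RHS]br3_12 [br3 y x z]br3_23
  [br3 t y z]br3_12 [br3 y t z]br3_23 !opprK.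
Qed.

Lemma br3_linm x a y t z : br3 x (a *: y + t) z = a *: br3 x y z + br3 x t z.
Proof. by rewrite br3_23 br3_lin opprD -scalerN -!br3_23. Qed.

Local Notation C := (complex R).
Local Notation rc := (real_complex R).

Definition cplx z : 'rV[C]_d := \row_i rc (b (o i) z).

Definition brC (x y z : 'rV[C]_d) : 'rV[C]_d :=
  \sum_i x 0 i *: \sum_j y 0 j *: \sum_k z 0 k *: cplx (br3 (o i) (o j) (o k)).

Lemma cplxD a x y : cplx (a *: x + y) = rc a *: cplx x + cplx y.
Proof. by apply/rowP => i; rewrite !mxE bDr bZr rmorphD rmorphM. Qed.

Lemma cplx_add x y : cplx (x + y) = cplx x + cplx y.
Proof. by apply/rowP => i; rewrite !mxE bDr rmorphD. Qed.

Lemma cplx0 : cplx 0 = 0.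
Proof. by apply/rowP => i; rewrite !mxE b0r rmorph0. Qed.

Lemma cplxN x : cplx (- x) = - cplx x.
Proof. by apply/rowP => i; rewrite !mxE bNr rmorphN. Qed.

Lemma cplx_o i : cplx (o i) = delta_mx 0 i.
Proof. by apply/rowP => j; rewrite !mxE oo eqxx /= eq_sym rmorph_nat. Qed.

Lemma dot_cplx x y : dot (cplx x) (cplx y) = rc (b x y).
Proof.
rewrite dotE {2}[x]oE b_suml rmorph_sum; apply: eq_bigr => i _.
by rewrite !mxE bZl rmorphM.
Qed.

Lemma cplx_inj : injective cplx.
Proof.
move=> x y E; rewrite [x]oE [y]oE; apply: eq_bigr => i _; congr (_ *: _).
by have /rowP/(_ i) := E; rewrite !mxE => /(@complexI R).
Qed.

Lemma cj_cplx x : cj (cplx x) = cplx x.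
Proof.
apply/rowP => i; rewrite !mxE; apply: conj_Creal.
by apply/complex_realP; exists (b (o i) x).
Qed.

Lemma cplx_real s : cj s = s -> exists x, s = cplx x.
Proof.
move=> sr; have Rl i : exists k, s 0 i = rc k.
  by apply/complex_realP; rewrite CrealE; have /rowP/(_ i) := sr; rewrite mxE => ->.
have [f fE] := fin_all_exists Rl; exists (\sum_i f i *: o i).
by apply/rowP => i; rewrite mxE orthonormal_coef.
Qed.

Lemma V_ind (Q : V -> Prop) : Q 0 -> (forall a x y, Q x -> Q y -> Q (a *: x + y)) ->
  (forall i, Q (o i)) -> forall x, Q x.
Proof. by move=> Q0 Qc Qo x; rewrite [x]oE; elim/big_rec: _ => // i y _; apply: Qc. Qed.

(** Real basis vectors span the complex space, so the identities of [br3] pass to [brC] one variable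
    at a time. *)
Lemma U_ind (Q : 'rV[C]_d -> Prop) : Q 0 ->
  (forall a x y, Q x -> Q y -> Q (a *: x + y)) ->
  (forall i, Q (cplx (o i))) -> forall x, Q x.
Proof.
move=> Q0 Qc Qo x; rewrite [x]row_sum_delta; elim/big_rec: _ => // i y _.
by apply: Qc; rewrite -cplx_o.
Qed.

Lemma brC_linl a x t y z : brC (a *: x + t) y z = a *: brC x y z + brC t y z.
Proof.
rewrite /brC scaler_sumr -big_split; apply: eq_bigr => i _ /=.
by rewrite !mxE scalerDl scalerA.
Qed.

Lemma brC_linm x a y t z : brC x (a *: y + t) z = a *: brC x y z + brC x t z.
Proof.
rewrite /brC scaler_sumr -big_split; apply: eq_bigr => i _ /=.
rewrite scalerA mulrC -scalerA -scalerDr; congr (_ *: _).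
rewrite scaler_sumr -big_split; apply: eq_bigr => j _ /=.
by rewrite !mxE scalerDl scalerA.
Qed.

Lemma brC_lin x y a z t : brC x y (a *: z + t) = a *: brC x y z + brC x y t.
Proof.
rewrite /brC scaler_sumr -big_split; apply: eq_bigr => i _ /=.
rewrite scalerA mulrC -scalerA -scalerDr; congr (_ *: _).
rewrite scaler_sumr -big_split; apply: eq_bigr => j _ /=.
rewrite scalerA mulrC -scalerA -scalerDr; congr (_ *: _).
rewrite scaler_sumr -big_split; apply: eq_bigr => k _ /=.
by rewrite !mxE scalerDl scalerA.
Qed.

Lemma brC0l y z : brC 0 y z = 0.
Proof. by rewrite /brC big1 // => i _; rewrite mxE scale0r. Qed.

Lemma brC0m x z : brC x 0 z = 0.
Proof.
rewrite /brC big1 // => i _; rewrite big1 ?scaler0 // => j _.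
by rewrite mxE scale0r.
Qed.

Lemma brC0r x y : brC x y 0 = 0.
Proof.
rewrite /brC big1 // => i _; rewrite big1 ?scaler0 // => j _.
by rewrite big1 ?scaler0 // => k _; rewrite mxE scale0r.
Qed.

Lemma brC_cplx x y z : brC (cplx x) (cplx y) (cplx z) = cplx (br3 x y z).
Proof.
have br30l y' z' : br3 0 y' z' = 0.
  by have := br3_linl (-1) 0 0 y' z'; rewrite scaler0 add0r scaleN1r addNr.
have br30r y' z' : br3 y' z' 0 = 0.
  by have := br3_lin y' z' (-1) 0 0; rewrite scaler0 add0r scaleN1r addNr.
have br30m y' z' : br3 y' 0 z' = 0.
  by have := br3_linm y' (-1) 0 0 z'; rewrite scaler0 add0r scaleN1r addNr.
move: x; apply: V_ind => [|a x x' Ex Ex'|i]; first by rewrite br30l cplx0 brC0l.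
  by rewrite cplxD brC_linl Ex Ex' -cplxD br3_linl.
move: y; apply: V_ind => [|a x x' Ex Ex'|j]; first by rewrite br30m cplx0 brC0m.
  by rewrite cplxD brC_linm Ex Ex' -cplxD br3_linm.
move: z; apply: V_ind => [|a x x' Ex Ex'|k]; first by rewrite br30r cplx0 brC0r.
  by rewrite cplxD brC_lin Ex Ex' -cplxD br3_lin.
have sd l (G : 'I_d -> 'rV[C]_d) : \sum_t (delta_mx 0 l : 'rV[C]_d) 0 t *: G t = G l.
  rewrite (bigD1 l) //= mxE !eqxx scale1r big1 ?addr0 // => t tl.
  by rewrite mxE (negPf tl) scale0r.
by rewrite !cplx_o /brC !sd.
Qed.

Lemma brC_12 x y z : brC x y z = - brC y x z.
Proof.
move: x; apply: U_ind => [|a x x' Ex Ex'|i]; first by rewrite brC0l brC0m oppr0.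
  by rewrite brC_linl brC_linm Ex Ex' scalerN opprD.
move: y; apply: U_ind => [|a x x' Ex Ex'|j]; first by rewrite brC0l brC0m oppr0.
  by rewrite brC_linl brC_linm Ex Ex' scalerN opprD.
move: z; apply: U_ind => [|a x x' Ex Ex'|k]; first by rewrite !brC0r oppr0.
  by rewrite !brC_lin Ex Ex' scalerN opprD.
by rewrite !brC_cplx br3_12 cplxN.
Qed.

Lemma brC_23 x y z : brC x y z = - brC x z y.
Proof.
move: x; apply: U_ind => [|a x x' Ex Ex'|i]; first by rewrite !brC0l oppr0.
  by rewrite !brC_linl Ex Ex' scalerN opprD.
move: y; apply: U_ind => [|a x x' Ex Ex'|j]; first by rewrite brC0r brC0m oppr0.
  by rewrite brC_lin brC_linm Ex Ex' scalerN opprD.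
move: z; apply: U_ind => [|a x x' Ex Ex'|k]; first by rewrite brC0r brC0m oppr0.
  by rewrite brC_lin brC_linm Ex Ex' scalerN opprD.
by rewrite !brC_cplx br3_23 cplxN.
Qed.

Lemma brC_skew x y z t : dot (brC x y z) t = - dot z (brC x y t).
Proof.
move: x; apply: U_ind => [|a x x' Ex Ex'|i]; first by rewrite !brC0l dot0l dot0r oppr0.
  by rewrite !brC_linl dotDl dotZl dotDr dotZr Ex Ex' mulrN opprD.
move: y; apply: U_ind => [|a x x' Ex Ex'|j]; first by rewrite !brC0m dot0l dot0r oppr0.
  by rewrite !brC_linm dotDl dotZl dotDr dotZr Ex Ex' mulrN opprD.
move: z; apply: U_ind => [|a x x' Ex Ex'|k]; first by rewrite brC0r !dot0l oppr0.
  by rewrite brC_lin !dotDl !dotZl Ex Ex' mulrN opprD.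
move: t; apply: U_ind => [|a x x' Ex Ex'|l]; first by rewrite brC0r !dot0r oppr0.
  by rewrite brC_lin !dotDr !dotZr Ex Ex' mulrN opprD.
by rewrite !brC_cplx !dot_cplx b_br3 bC b_br3 f4_34 rmorphN.
Qed.

Lemma brC_cj x y z : cj (brC x y z) = brC (cj x) (cj y) (cj z).
Proof.
move: x; apply: U_ind => [|a x x' Ex Ex'|i]; first by rewrite cj0 !brC0l cj0.
  by rewrite brC_linl !cjD !cjZ Ex Ex' brC_linl.
move: y; apply: U_ind => [|a x x' Ex Ex'|j]; first by rewrite cj0 !brC0m cj0.
  by rewrite brC_linm !cjD !cjZ Ex Ex' brC_linm.
move: z; apply: U_ind => [|a x x' Ex Ex'|k]; first by rewrite cj0 !brC0r cj0.
  by rewrite brC_lin !cjD !cjZ Ex Ex' brC_lin.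
by rewrite !cj_cplx brC_cplx cj_cplx.
Qed.

Lemma comb3 (a : C) (A A' B B' D D' : 'rV[C]_d) :
  a *: (A + B + D) + (A' + B' + D') = (a *: A + A') + (a *: B + B') + (a *: D + D').
Proof. by rewrite !scalerDr addrACA [in LHS](addrACA (a *: A)). Qed.

Lemma brC_FI x y z t w : brC x y (brC z t w) =
  brC (brC x y z) t w + brC z (brC x y t) w + brC z t (brC x y w).
Proof.
move: x; apply: U_ind => [|a x x' Ex Ex'|i].
- by rewrite !brC0l brC0m brC0r !addr0.
- by rewrite !brC_linl !brC_linm !brC_lin Ex Ex' comb3.
move: y; apply: U_ind => [|a x x' Ex Ex'|j].
- by rewrite !brC0m !brC0l !brC0r !addr0.
- by rewrite !brC_linm !brC_linl !brC_lin Ex Ex' comb3.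
move: z; apply: U_ind => [|a x x' Ex Ex'|k].
- by rewrite !brC0l !brC0r !brC0l !addr0.
- by rewrite !brC_linl !brC_lin !brC_linl Ex Ex' comb3.
move: t; apply: U_ind => [|a x x' Ex Ex'|l].
- by rewrite !brC0m !brC0r !brC0m !addr0.
- by rewrite !brC_linm !brC_lin !brC_linm Ex Ex' comb3.
move: w; apply: U_ind => [|a x x' Ex Ex'|m].
- by rewrite !brC0r !addr0.
- by rewrite !brC_lin Ex Ex' comb3.
by rewrite !brC_cplx br3_FI !cplx_add.
Qed.

Lemma block4_basis : (exists y, F y != 0) -> exists e, block F e.
Proof.
move=> [y Fy].
have nz : exists x y z, brC x y z != 0.
  exists (cplx (y 0)), (cplx (y 1)), (cplx (y 2)); rewrite brC_cplx.
  apply: contraNneq Fy; rewrite -cplx0 => /cplx_inj B0.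
  by rewrite (mk4_eta y) -b_br3 B0 b0l.
have [s [sr so sF sk]] :=
  simple_block3 brC_lin brC_12 brC_23 brC_skew brC_FI brC_cj nz.
have [e eE] := fin_all_exists (fun i => cplx_real (sr i)).
exists e; split.
- by move=> i j; apply: (@complexI R); rewrite -dot_cplx -!eE so rmorph_nat.
- apply: contraNneq sF => Fe; rewrite !eE brC_cplx dot_cplx b_br3.
  by rewrite -(mk4_eta e) Fe rmorph0.
move=> l m z w lm ez.
(* [K] to [K11] are the twelve placements of [z] and of a free argument in the four slots, all
   deduced from the first by alternation. *)
have K i j u : f4 (e i) (e j) z u = 0.
  rewrite -b_br3 (_ : br3 _ _ _ = 0) ?b0l //; apply: cplx_inj.
  rewrite -brC_cplx cplx0 -!eE sk // => t; rewrite eE dot_cplx ez rmorph0 //.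
have K1 i j u : f4 (e i) z (e j) u = 0 by rewrite f4_23 K oppr0.
have K2 i j u : f4 z (e i) (e j) u = 0 by rewrite f4_12 K1 oppr0.
have K3 i j u : f4 (e i) (e j) u z = 0 by rewrite f4_34 K oppr0.
have K4 i j u : f4 (e i) u (e j) z = 0 by rewrite f4_23 K3 oppr0.
have K5 i j u : f4 u (e i) (e j) z = 0 by rewrite f4_12 K4 oppr0.
have K6 i j u : f4 (e i) z u (e j) = 0 by rewrite f4_34 K1 oppr0.
have K7 i j u : f4 z (e i) u (e j) = 0 by rewrite f4_12 K6 oppr0.
have K8 i j u : f4 z u (e i) (e j) = 0 by rewrite f4_23 K7 oppr0.
have K9 i j u : f4 (e i) u z (e j) = 0 by rewrite f4_34 K4 oppr0.
have K10 i j u : f4 u (e i) z (e j) = 0 by rewrite f4_12 K9 oppr0.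
have K11 i j u : f4 u z (e i) (e j) = 0 by rewrite f4_23 K10 oppr0.
have I4 (t : 'I_4) : [\/ t = 0, t = 1, t = 2 | t = 3].
  case: t => [[|[|[|[|]]]]] //= p; [apply: Or41|apply: Or42|apply: Or43|apply: Or44];
  exact: val_inj.
rewrite (mk4_eta e).
case: (I4 l) lm => ->; case: (I4 m) => -> // _; rewrite !upd_mk4.
all: by rewrite ?(K, K1, K2, K3, K4, K5, K6, K7, K8, K9, K10, K11).
Qed.

End FourForm.

Lemma block4 (F : ('I_4 -> V) -> R) : inv_form F -> (exists y, F y != 0) ->
  exists e, block F e.
Proof. by move=> iF; have [d [o [oo oE]]] := orthonormal_basis; apply: (block4_basis iF oo oE). Qed.

(** Contracting with the first entry of a tuple where [F] does not vanish keeps the form nonzero and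
    lowers its arity, down to four. *)
Theorem block_exists n (F : ('I_n.+4 -> V) -> R) : inv_form F ->
  (exists y, F y != 0) -> exists e, block F e.
Proof.
elim: n F => [|n IHn] F iF; first exact: block4.
move=> [y Fy]; have [||e be] := IHn (fun x => F (fcons (y ord0) x)).
- exact: inv_form_fcons.
- by exists (fun i => y (lift ord0 i)); rewrite fcons_eta.
by have [] := @block_step n.+4 F (y ord0) e isT iF be => e' be'; exists e'.
Qed.

Lemma perp_comb (I : finType) (e : I -> V) a x y :
  perp e (a *: x + y) = a *: perp e x + perp e y.
Proof.
rewrite /perp scalerDr addrACA; congr (_ + _); rewrite scalerN -opprD; congr (- _).
rewrite scaler_sumr -big_split; apply: eq_bigr => i _ /=.
by rewrite bDr bZr scalerDl scalerA.
Qed.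

Lemma perp_id (I : finType) (e : I -> V) z : (forall i, b (e i) z = 0) -> perp e z = z.
Proof. by move=> ez; rewrite /perp big1 ?subr0 // => i _; rewrite ez scale0r. Qed.

Lemma perp_e (I : finType) (e : I -> V) i : orthonormal e -> perp e (e i) = 0.
Proof.
move=> oe; rewrite /perp (bigD1 i) //= oe eqxx scale1r big1 ?addr0 ?subrr // => j ji.
by rewrite oe (negPf ji) scale0r.
Qed.

Lemma b_perp (I : finType) (e : I -> V) x y : orthonormal e ->
  b (perp e x) y = b x (perp e y).
Proof.
move=> oe; have L u v : b (perp e u) v = b (perp e u) (perp e v).
  rewrite {1}[v](perpE e) bDr b_sumr big1 ?add0r // => i _.
  by rewrite bZr [b (perp e u) _]bC perpP ?mulr0.
by rewrite L [b x _]bC (L y x) bC.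
Qed.

Lemma block_one K (F : ('I_K -> V) -> R) (e : 'I_K -> V) i w : (1 < K)%N ->
  inv_form F -> block F e -> F (upd e i w) = b (e i) w * F e.
Proof.
move=> K1 iF be; have [oe _ _] := be.
have [j ji] : exists j, j != i.
  have : (0 < #|~: [set i]|)%N by rewrite cardsCs setCK card_ord cards1 subn_gt0.
  by case/card_gt0P => j; rewrite !inE; exists j.
rewrite -[X in upd X i w](upd_id e j) block_two // !oe eqxx.
have /negPf -> : i != j by rewrite eq_sym.
by rewrite mul1r mul0r subr0 mulrC.
Qed.

(** * Orthogonal families of blocks *)

Section Family.
Variables (n : nat).
Local Notation K := n.+4.
Variable F : ('I_K -> V) -> R.
Hypothesis iF : inv_form F.

Definition uncur m (e : 'I_m -> 'I_K -> V) (p : 'I_m * 'I_K) := e p.1 p.2.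

Section Residual.
Variables (m : nat) (e : 'I_m -> 'I_K -> V).
Hypotheses (oe : orthonormal (uncur e)) (be : forall a, block F (e a)).
Local Notation pi := (perp (uncur e)).

Let mF : mlin F. Proof. by case: iF. Qed.
Let aF : altf F. Proof. by case: iF. Qed.

Lemma family_block_full y i j a l : i != j -> y i = e a l ->
  (forall t, b (e a t) (y j) = 0) -> F y = 0.
Proof.
move=> ij; apply: (block_full mF aF _ _ ij); first by case: (be a).
by move=> *; apply: block_kills.
Qed.

Lemma family_perp y i j w : i != j -> (forall p, b (uncur e p) (y j) = 0) ->
  F (upd y i w) = F (upd y i (pi w)).
Proof.
move=> ij yj; rewrite {1}[w](perpE (uncur e)) mlinD // mlin_sum // big1 ?add0r // => p _.
rewrite mlinZ // (@family_block_full _ i j p.1 p.2) ?mulr0 ?upd_same // => t.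
by rewrite upd_neq 1?eq_sym //; apply: (yj (p.1, t)).
Qed.

Lemma upd_perp (x : 'I_K -> V) i z : (fun t => pi (upd x i z t)) = upd (fun t => pi (x t)) i (pi z).
Proof. by apply: functional_extensionality => t; rewrite /upd; case: eqP. Qed.

(** [D] maps the orthogonal complement of the blocks to itself, because [F] vanishes when a block
    vector meets a vector orthogonal to that block. *)
Lemma inv_form_residual : inv_form (fun x => F (fun t => pi (x t))).
Proof.
split.
- by move=> x i a y z; rewrite !upd_perp perp_comb mF.
- by move=> x i j ij xij; apply: (aF ij); rewrite xij.
move=> x i j ij; have [_ _ /(_ (fun t => pi (x t)) _ _ ij)[D DE kD]] := iF.
have Do z : pi (D (pi z)) = D (pi z).
  apply: perp_id => p; rewrite bC DE (@family_block_full _ j i p.1 p.2) //.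
  - by rewrite eq_sym.
  - by rewrite upd_same.
  - by move=> t; rewrite upd_neq // upd_same (perpP _ (p.1, t)).
exists (fun z => D (pi z)).
  by move=> z w; rewrite !upd_perp -DE -[in LHS]Do b_perp.
move=> y; have kE := kD (fun t => pi (y t)); rewrite -[RHS]kE.
by apply: eq_bigr => t _; rewrite upd_perp Do.
Qed.

(** The residual form vanishes on the family, so its blocks are orthogonal to it. Such a block is
    also one of [F]: a third slot still holds some [e0 j], which allows [z] and [w] to be replaced
    by their projections. *)
Lemma family_extend : (exists2 y, F y != 0 & forall i p, b (uncur e p) (y i) = 0) ->
  exists e0 : 'I_K -> V, block F e0 /\ forall i p, b (uncur e p) (e0 i) = 0.
Proof.
move=> [y Fy yo]; have iF' := inv_form_residual.
have [|e0 be0] := block_exists iF'.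
  exists y; rewrite (_ : (fun t => pi (y t)) = y) //.
  by apply: functional_extensionality => t; apply: perp_id.
have [oe0 Fe0 b0] := be0.
have e0o i p : b (uncur e p) (e0 i) = 0.
  have := @block_one _ _ _ i (uncur e p) isT iF' be0.
  rewrite upd_perp perp_e // mlin0 // => /esym/eqP.
  by rewrite mulf_eq0 (negPf Fe0) orbF bC => /eqP.
exists e0; split=> //; split=> //.
  move: Fe0; rewrite (_ : (fun t => pi (e0 t)) = e0) //.
  by apply: functional_extensionality => t; apply: perp_id.
move=> l k z w lk ez.
have [j jl jk] : exists2 j, j != l & j != k.
  have : (0 < #|~: [set l; k]|)%N by rewrite cardsCs setCK card_ord cards2 lk subn_gt0.
  by case/card_gt0P => j; rewrite !inE negb_or => /andP[]; exists j.
rewrite (@family_perp _ k j) 1?eq_sym //; last first.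
  by move=> p; rewrite upd_neq.
rewrite updC // (@family_perp _ l j) 1?eq_sym //; last first.
  by move=> p; rewrite upd_neq.
rewrite -updC //; have := b0 l k (pi z) w lk; rewrite !upd_perp.
rewrite (perp_id (fun p => perpP _ p oe)) (_ : (fun t => pi (e0 t)) = e0).
  by apply=> i; rewrite -[LHS]b_perp // perp_id.
by apply: functional_extensionality => t; apply: perp_id.
Qed.

End Residual.

(** Blocks are added while [F] is nonzero on the complement; orthonormality bounds their number by
    the dimension. *)
Theorem block_decomposition : exists m (e : 'I_m -> 'I_K -> V),
  [/\ orthonormal (uncur e), forall a, block F (e a) &
      forall y, (forall i p, b (uncur e p) (y i) = 0) -> F y = 0].
Proof.
suff H N : forall m (e : 'I_m -> 'I_K -> V), orthonormal (uncur e) ->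
    (forall a, block F (e a)) -> (\dim (fullv : {vspace V}) - m <= N)%N ->
    exists m (e : 'I_m -> 'I_K -> V), [/\ orthonormal (uncur e),
      forall a, block F (e a) &
      forall y, (forall i p, b (uncur e p) (y i) = 0) -> F y = 0].
  apply: (H (\dim (fullv : {vspace V})) 0 (fun _ _ => 0)); last exact: leq_subr.
    by case=> [[]].
  by case.
elim: N => [|N IHN] m e oe be mN;
  case: (classic (exists2 y, F y != 0 & forall i p, b (uncur e p) (y i) = 0)) => [ex|nex].
2,4: exists m, e; split=> // y yo; apply/eqP/negPn/negP => Fy; apply: nex; by exists y.
all: have [e0 [be0 e0o]] := family_extend oe be ex.
all: have oe' : orthonormal (uncur (fcons e0 e)).
1,3: move=> [a i] [a' i']; rewrite /uncur /= xpair_eqE.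
1,2: case: (unliftP ord0 a) => [c ->|->]; case: (unliftP ord0 a') => [c' ->|->];
     rewrite ?fconsS ?fcons0 ?(inj_eq lift_inj).
1,5: exact: (oe (c, i) (c', i')).
1,4: exact: (e0o i' (c, i)).
1,3: by rewrite bC (e0o i (c', i')).
1,2: by case: be0.
- have := orthonormal_dim oe'; rewrite card_prod !card_ord => H.
  have : (m.+1 <= \dim (fullv : {vspace V}))%N.
    by apply: leq_trans H; rewrite leq_pmulr.
  by rewrite ltnNge -subn_eq0 -leqn0 mN.
- apply: (IHN _ (fcons e0 e)) => //; last by rewrite subnS; case: (_ - _)%N mN.
  by move=> a; case: (unliftP ord0 a) => [c ->|->]; rewrite ?fconsS ?fcons0.
Qed.

End Family.
End Forms.

(** * Lorentzian algebras *)

Section BracketForm.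
Variables (R : rcfType) (V : vectType R) (k : nat).
Variables (br : ('I_k -> V) -> V) (b : V -> V -> R).
Hypothesis M : metric_lie_alg br b.

Definition brf (y : 'I_k.+1 -> V) := b (y ord0) (br (fun i => y (lift ord0 i))).

Let bsb : sym_bilinear b. Proof. by case: M. Qed.

Lemma brf_fcons z x : brf (fcons z x) = b z (br x).
Proof.
rewrite /brf fcons0; congr (b z (br _)).
by apply: functional_extensionality => i; rewrite fconsS.
Qed.

Lemma bracket_eq0 x : (forall z, brf (fcons z x) = 0) -> br x = 0.
Proof.
move=> E; have [_ _ nd _] := M; apply: nd => z.
by rewrite (bC bsb) -brf_fcons.
Qed.

Lemma brf_mlin : mlin brf.
Proof.
have [[ml _ _] _ _ _] := M; move=> x i a y z.
rewrite -(fcons_eta x); case: (unliftP ord0 i) => [j ->|->].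
  by rewrite !upd_fconsS !brf_fcons ml (bDr bsb) (bZr bsb).
by rewrite !upd_fcons0 !brf_fcons (bDl bsb) (bZl bsb).
Qed.

Lemma brf_alt : altf brf.
Proof.
have [[_ al _] _ _ sk] := M.
have A x i : b (x i) (br x) = 0.
  have := sk x i (x i) (x i); rewrite /ad upd_id [b (br x) _](bC bsb) => /eqP.
  by rewrite -mulr2n mulrn_eq0 => /eqP.
move=> x i j; rewrite -(fcons_eta x).
case: (unliftP ord0 i) => [i' ->|->]; case: (unliftP ord0 j) => [j' ->|->] //;
  rewrite ?fconsS ?fcons0 brf_fcons.
- by rewrite (inj_eq lift_inj) => ij E; rewrite (al _ i' j') // (b0r bsb).
- by move=> _ <-; apply: (A (fun t => x (lift ord0 t))).
- by move=> _ ->; apply: (A (fun t => x (lift ord0 t))).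
Qed.

Lemma ad_kills x i : kills (ad br x i) brf.
Proof.
have [[_ _ de] _ _ sk] := M; move=> y; rewrite -(fcons_eta y).
set z := fun t => y (lift ord0 t); rewrite big_ord_recl fcons0 upd_fcons0 brf_fcons.
under eq_bigr => t _ do rewrite fconsS upd_fconsS brf_fcons.
by rewrite -(b_sumr bsb) -de; apply: sk.
Qed.

(** With [w] in slot 0 the operator is [ad] itself; the other pairs of slots reduce to this case by
    a transposition, whence the factor -1. *)
Lemma brf_inv : inv_form b brf.
Proof.
split; [exact: brf_mlin|exact: brf_alt|move=> x i j ij].
suff H x' i' : exists2 D : V -> V,
    (forall z w, b (D z) w = brf (upd (upd x' (lift ord0 i') z) ord0 w)) & kills D brf.
  case: (unliftP ord0 j) ij => [j' ->|->]; last first.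
    by case: (unliftP ord0 i) => [i' ->|->] // _; apply: H.
  case: (unliftP ord0 i) => [i' ->|->].
    rewrite (inj_eq lift_inj) => ij.
    have [D DE kD] := H (upd x (lift ord0 j') (x ord0)) i'.
    exists (fun z => (-1) *: D z); last exact: (kills_scale brf_mlin).
    move=> z w; rewrite (bZl bsb) DE mulN1r.
    have -> : upd x (lift ord0 i') z = upd (upd x (lift ord0 i') z) ord0 (x ord0).
      by rewrite -[in X in upd _ ord0 X](@upd_neq _ _ x (lift ord0 i') ord0 z) // upd_id.
    rewrite [RHS](altf_swap brf_mlin brf_alt) //; congr (- brf _).
    apply: functional_extensionality => t; rewrite /upd.
    case: (eqVneq t ord0) => [->|_] //; case: (eqVneq t (lift ord0 i')) => [->|_] //.
    by rewrite (inj_eq lift_inj) (negPf ij).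
  move=> _; have [D DE kD] := H x j'; exists (fun z => (-1) *: D z).
    by move=> z w; rewrite (bZl bsb) DE mulN1r [RHS](altf_swap brf_mlin brf_alt) // -updC.
  exact: (kills_scale brf_mlin).
exists (ad br (fun t => x' (lift ord0 t)) i'); last exact: ad_kills.
move=> z w; rewrite -(fcons_eta x') upd_fconsS upd_fcons0 brf_fcons (bC bsb).
by congr (b w (br (upd _ _ _))); apply: functional_extensionality => t; rewrite fconsS.
Qed.

End BracketForm.

(** * Subspaces given by predicates, and null vectors in lorentzian signature *)

Section Subspaces.
Variables (R : rcfType) (V : vectType R).

(** A subspace contained in [P] and maximal there is all of [P]; the dimension bounds its growth. *)
Lemma pred_vspace (P : V -> Prop) : P 0 -> (forall a x y, P x -> P y -> P (a *: x + y)) ->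
  exists W : {vspace V}, forall z, z \in W <-> P z.
Proof.
move=> P0 Pc.
suff H N : forall W : {vspace V}, (forall z, z \in W -> P z) ->
    (\dim (fullv : {vspace V}) - \dim W <= N)%N ->
    exists W : {vspace V}, forall z, z \in W <-> P z.
  apply: (H (\dim (fullv : {vspace V})) 0%VS); last exact: leq_subr.
  by move=> z; rewrite memv0 => /eqP ->.
elim: N => [|N IHN] W WP dW; case: (classic (exists2 z, P z & z \notin W)) => [[z Pz zW]|nz].
2,4: exists W => z; split=> [/WP //|Pz]; apply/negPn/negP => zW; apply: nz; by exists z.
all: have lt : (\dim W < \dim (W + <[z]>))%N.
1,3: rewrite ltn_neqAle dimvS ?addvSl // andbT; apply: contraNneq zW => dE;
  have /eqP -> : W == (W + <[z]>)%VS by rewrite eqEdim addvSl dE leqnn.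
1,2: exact: (subvP (addvSr _ _) _ (memv_line z)).
- have := leq_trans lt (dimvS (subvf _)).
  by rewrite ltnNge -subn_eq0 -leqn0 dW.
apply: (IHN (W + <[z]>)%VS).
  move=> x /memv_addP[w /WP Pw [y /vlineP[a ->] ->]].
  by rewrite addrC; apply: Pc.
apply: leq_trans (leq_sub2l _ lt) _.
by rewrite subnS; case: (_ - _)%N dW.
Qed.

Variable b : V -> V -> R.
Hypothesis bsb : sym_bilinear b.

(** The form in which the signature is used below. *)
Lemma lorentzian_time : lorentzian b -> exists2 t, b t t = -1 &
  forall z, z != 0 -> b z t = 0 -> 0 < b z z.
Proof.
move=> [e [be oe e0 ei]].
have se : (0 < size e)%N.
  case: e {be oe ei} e0 => //=; rewrite (b0l bsb) => /eqP.
  by rewrite eq_sym oppr_eq0 oner_eq0.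
exists e`_0 => // z zn zt.
have zE : z = \sum_(i < size e) coord (in_tuple e) i z *: e`_i.
  by apply: coord_span; rewrite (span_basis be) memvf.
set c := coord (in_tuple e) in zE.
pose i0 : 'I_(size e) := Ordinal se.
have bz i : b z e`_(i : 'I_(size e)) = c i z * b e`_i e`_i.
  rewrite {1}zE (b_suml bsb) (bigD1 i) //= (bZl bsb) big1 ?addr0 // => j ji.
  by rewrite (bZl bsb) oe ?mulr0.
have c0 : c i0 z = 0.
  by have := bz i0; rewrite zt e0 mulrN1 => /eqP; rewrite eq_sym oppr_eq0 => /eqP.
have bzz : b z z = \sum_(i < size e) c i z ^+ 2.
  rewrite {2}zE (b_sumr bsb); apply: eq_bigr => i _; rewrite (bZr bsb) bz expr2.
  have [->|ni] := eqVneq i i0; first by rewrite c0 !mul0r.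
  by rewrite ei ?mulr1 // ltn_ord andbT lt0n.
rewrite bzz lt_def sumr_ge0 ?andbT => [|i _]; last exact: sqr_ge0.
apply: contraNneq zn => /eqP; rewrite psumr_eq0 => [/allP A|i _]; last exact: sqr_ge0.
rewrite zE big1 // => i _; have := A i (mem_index_enum _).
by rewrite sqrf_eq0 => /eqP ->; rewrite scale0r.
Qed.

Section Null.
Hypothesis lor : lorentzian b.
Variable v : V.
Hypotheses (v0 : v != 0) (vv : b v v = 0).

(** Subtracting a multiple of [v] makes [w] orthogonal to the timelike [t] without changing
    [b w w]. *)
Lemma null_perp w : b w v = 0 -> 0 < b w w \/ exists c, w = c *: v.
Proof.
move=> wv; have [t tt tp] := lorentzian_time lor.
have vt : b v t != 0.
  by apply: contraTneq (lexx (0 : R)) => vt; have := tp v v0 vt; rewrite vv ltxx.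
pose z := w - (b w t / b v t) *: v.
have zt : b z t = 0 by rewrite /z (bDl bsb) (bNl bsb) (bZl bsb) divfK // subrr.
have zz : b z z = b w w.
  rewrite /z !(bDl bsb, bDr bsb, bNl bsb, bNr bsb, bZl bsb, bZr bsb) vv wv.
  by rewrite [b v w](bC bsb) wv !(mulr0, oppr0, addr0).
have [z0|zn] := eqVneq z 0; last by left; rewrite -zz; apply: tp.
by right; exists (b w t / b v t); apply/eqP; rewrite -subr_eq0; apply/eqP.
Qed.

Lemma null_partner : exists2 u, b u u = 0 & b u v = 1.
Proof.
have [t tt tp] := lorentzian_time lor.
have vt : b v t != 0.
  by apply: contraTneq (lexx (0 : R)) => vt; have := tp v v0 vt; rewrite vv ltxx.
have [s sv] : exists s, b s v = 1.
  by exists ((b v t)^-1 *: t); rewrite (bZl bsb) [b t v](bC bsb) mulVf.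
exists (s - (b s s / 2) *: v); last first.
  by rewrite (bDl bsb) (bNl bsb) (bZl bsb) vv mulr0 subr0.
rewrite !(bDl bsb, bDr bsb, bNl bsb, bNr bsb, bZl bsb, bZr bsb) vv [b v s](bC bsb) sv.
by field.
Qed.

End Null.
End Subspaces.

Lemma mlin_scale (R : rcfType) (V : vectType R) K (F : ('I_K -> V) -> R) (c : 'I_K -> R) y :
  mlin F -> F (fun j => c j *: y j) = (\prod_j c j) * F y.
Proof.
move=> mF.
have H N : F (fun j : 'I_K => if (j < N)%N then c j *: y j else y j) =
    (\prod_(j < K | (j < N)%N) c j) * F y.
  elim: N => [|N IHN]; first by rewrite big_pred0 // mul1r.
  case: (ltnP N K) => [NK|KN]; last first.
    have lt (j : 'I_K) : ((j < N.+1)%N = true) * ((j < N)%N = true).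
      by split; rewrite ?leqW //; apply: leq_trans (ltn_ord j) _; rewrite ?leqW.
    rewrite (_ : (fun j : 'I_K => if (j < N.+1)%N then c j *: y j else y j) =
      (fun j : 'I_K => if (j < N)%N then c j *: y j else y j)).
      by rewrite IHN; congr (_ * _); apply: eq_bigl => j; rewrite !lt.
    by apply: functional_extensionality => j; rewrite !lt.
  pose j0 := Ordinal NK; rewrite (bigD1 j0) /=; last exact: ltnSn.
  rewrite (_ : (fun j : 'I_K => if (j < N.+1)%N then c j *: y j else y j) =
    upd (fun j : 'I_K => if (j < N)%N then c j *: y j else y j) j0 (c j0 *: y j0)).
    rewrite mlinZ // (_ : upd _ j0 (y j0) = fun j : 'I_K => if (j < N)%N then c j *: y j else y j).
      rewrite IHN mulrA; congr (_ * _ * _); apply: eq_bigl => j.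
      by rewrite ltnS -val_eqE /= andbC -ltn_neqAle.
    by apply: functional_extensionality => j; rewrite /upd; case: eqP => // ->; rewrite ltnn.
  apply: functional_extensionality => j; rewrite /upd; case: eqP => [->|/eqP ne].
    by rewrite ltnSn.
  by rewrite ltnS leq_eqVlt; move: ne; rewrite -val_eqE /= => /negPf ->.
rewrite -[RHS](_ : (\prod_(j < K | (j < K)%N) c j) * F y = _).
  rewrite -H; congr F; apply: functional_extensionality => j; by rewrite ltn_ord.
by congr (_ * _); apply: eq_bigl => j; rewrite ltn_ord.
Qed.

Lemma positive_root (R : rcfType) (a : R) N : 0 < a -> exists2 t, 0 < t & t ^+ N.+1 = a.
Proof.
move=> a0; have := @poly_ivt R ('X^(N.+1) - a%:P) 0 (1 + a).
case=> [||t /andP[t0 _]].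
- by rewrite addr_ge0 ?ler01 // ltW.
- rewrite !hornerE expr0n /= sub0r oppr_le0 ltW //= subr_ge0.
  apply: le_trans (_ : 1 + a <= _); first by rewrite lerDr ler01.
  by rewrite ler_eXnr // lerDl ltW.
rewrite /root !hornerE subr_eq0 => /eqP tE; exists t => //.
rewrite lt_def t0 andbT; apply: contraTneq a0 => t00.
by rewrite -tE t00 expr0n ltxx.
Qed.

Lemma lift_ord_max_max k : ord_max = lift ord0 (ord_max : 'I_k.+1).
Proof. exact: val_inj. Qed.

Lemma tcons_fcons (U : zmodType) k (c : U) (y : 'I_k -> U) : @tcons U k.+1 k c y = fcons c y.
Proof.
apply: functional_extensionality => j; case: (unliftP ord0 j) => [i ->|->].
  by rewrite fconsS /tcons /= valK.
by rewrite fcons0.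
Qed.

Lemma tsnoc_lift (U : zmodType) k (c : U) (y : 'I_k -> U) i :
  @tsnoc U k.+1 k y c (lift ord_max i) = y i.
Proof. by rewrite /tsnoc [val _]lift_max valK. Qed.

Lemma tsnoc_max (U : zmodType) k (c : U) (y : 'I_k -> U) :
  @tsnoc U k.+1 k y c ord_max = c.
Proof. by rewrite /tsnoc insubN //= ltnn. Qed.

(** * Algebras with a central null vector v *)

Section NullExtension.
Variables (R : rcfType) (V : vectType R) (n' : nat).
Local Notation n := n'.+4.
Variables (br : ('I_n -> V) -> V) (b : V -> V -> R).
Hypothesis M : metric_lie_alg br b.
Variables (u v : V) (W : {vspace V}).
Hypotheses (uu : b u u = 0) (vv : b v v = 0) (uv : b u v = 1).
Hypothesis WP : forall z, z \in W <-> b u z = 0 /\ b v z = 0.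
Hypothesis Wpos : forall w, w \in W -> w != 0 -> 0 < b w w.
Local Notation Phi := (brf br b).
Hypothesis central : forall y i, y i = v -> Phi y = 0.
Hypothesis indec : indecomposable br b.

Let bsb : sym_bilinear b. Proof. by case: M. Qed.
Let mPhi : mlin Phi. Proof. exact: brf_mlin. Qed.
Let aPhi : altf Phi. Proof. exact: brf_alt. Qed.
Let nd : Defs.nondegenerate b. Proof. by case: M. Qed.

Lemma nondeg_eq x y : (forall z, b x z = b y z) -> x = y.
Proof.
move=> E; apply/eqP; rewrite -subr_eq0; apply/eqP/nd => z.
by rewrite (bDl bsb) (bNl bsb) E subrr.
Qed.

Lemma Phi_v y i a : Phi (upd y i (a *: v)) = 0.
Proof. by rewrite mlinZ // (@central _ i) ?upd_same ?mulr0. Qed.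

(** Locked, so that the expansion rules for [b] do not see through it. *)
Definition pr z := locked (z - b z v *: u - b z u *: v).

Lemma pr_W z : pr z \in W.
Proof.
apply/WP; rewrite /pr -lock !(bDr bsb, bNr bsb, bZr bsb) uu vv uv [b v u](bC bsb) uv.
by rewrite [b u z](bC bsb) [b v z](bC bsb); split; ring.
Qed.

Lemma prE z : z = b z v *: u + (b z u *: v + pr z).
Proof. by rewrite /pr -lock [_ *: v + _]addrC subrK addrC subrK. Qed.

Lemma b_pr z w : w \in W -> b (pr z) w = b z w.
Proof.
move=> /WP[uw vw]; rewrite /pr -lock !(bDl bsb, bNl bsb, bZl bsb) uw vw.
by rewrite !mulr0 !subr0.
Qed.

Definition bW (a c : subvs_of W) := b (vsval a) (vsval c).

Lemma bW_sb : sym_bilinear bW.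
Proof.
split=> [a x y z|x y]; last exact: (bC bsb).
by rewrite /bW linearP /= (bDl bsb) (bZl bsb).
Qed.

Lemma bW_pos : euclidean bW.
Proof.
move=> x x0; apply: Wpos; first exact: subvsP.
by apply: contraNneq x0 => x0; apply/eqP/subvs_inj; rewrite x0 linear0.
Qed.

Lemma vsval_upd k (y : 'I_k -> subvs_of W) i z :
  (fun t => vsval (upd y i z t)) = upd (fun t => vsval (y t)) i (vsval z).
Proof. by apply: functional_extensionality => t; rewrite /upd; case: eqP. Qed.

Lemma vsproj_fun k (y : 'I_k -> V) : (forall t, y t \in W) ->
  (fun t => vsval (vsproj W (y t))) = y.
Proof. by move=> yW; apply: functional_extensionality => t; rewrite vsprojK. Qed.

Definition FW (y : 'I_n.+1 -> subvs_of W) := Phi (fun t => vsval (y t)).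

Lemma Phi_pr y i z : b z v = 0 -> Phi (upd y i (pr z)) = Phi (upd y i z).
Proof.
by move=> zv; rewrite {2}[z]prE zv scale0r add0r [RHS]mlinD // Phi_v add0r.
Qed.

(** Compressing [D] to W loses only a multiple of [v], since [D z] is orthogonal to [v] by
    centrality, and such multiples do not affect [Phi]. *)
Lemma FW_inv : inv_form bW FW.
Proof.
split.
- by move=> x i a y z; rewrite /FW !vsval_upd linearP /= mPhi.
- by move=> x i j ij xij; apply: (aPhi ij); rewrite xij.
move=> x i j ij; have [_ _ /(_ (fun t => vsval (x t)) _ _ ij)[D DE kD]] := brf_inv M.
exists (fun z => vsproj W (pr (D (vsval z)))).
  move=> z w; rewrite /bW /FW !vsval_upd -DE vsprojK ?pr_W // b_pr //; exact: subvsP.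
move=> y; have kE := kD (fun t => vsval (y t)); rewrite -[RHS]kE.
apply: eq_bigr => t _; rewrite /FW vsval_upd vsprojK ?pr_W // Phi_pr //.
by rewrite DE (@central _ j) ?upd_same.
Qed.

(** * A block of the form on W contradicts indecomposability *)

Section SimpleBlock.
Variable ew : 'I_n.+1 -> subvs_of W.
Hypothesis bew : block bW FW ew.
Local Notation e t := (vsval (ew t)).
Let lam := Phi (fun t => e t).

Let eW t : e t \in W. Proof. exact: subvsP. Qed.

Let oe i j : b (e i) (e j) = (i == j)%:R.
Proof. by case: bew => H _ _; apply: H. Qed.

Let lam0 : lam != 0.
Proof. by case: bew. Qed.

Lemma W_block_full y i j l : i != j -> (forall t, y t \in W) -> y i = e l ->
  (forall t, b (e t) (y j) = 0) -> Phi y = 0.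
Proof.
move=> ij yW yi yj; have [mF aF _] := FW_inv; have [oew _ _] := bew.
have := @block_full _ _ bW bW_sb _ FW ew mF aF oew _ (fun t => vsproj W (y t)) i j l ij.
rewrite /FW vsproj_fun //; apply.
- by move=> *; apply: (block_kills bW_sb bW_pos FW_inv bew).
- by apply: subvs_inj; rewrite vsprojK.
- by move=> t; rewrite /bW vsprojK.
Qed.

Lemma e_v t : b (e t) v = 0.
Proof. by have /WP[_] := eW t; rewrite (bC bsb). Qed.

Lemma W_eq z w : (forall x, x \in W -> b z x = b w x) -> b z v = 0 -> b w v = 0 ->
  exists c, z = w + c *: v.
Proof.
move=> E zv wv; exists (b z u - b w u); apply: nondeg_eq => x; rewrite [x]prE.
rewrite !(bDl bsb, bDr bsb, bZl bsb, bZr bsb) zv wv vv [b v u](bC bsb) uv (E _ (pr_W x)).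
by have /WP[_ ->] := pr_W x; ring.
Qed.

(** On W the dual vector is [lam *: e i] by [block_one]; the constant [c] accounts for the value at
    [u]. *)
Lemma dual_e i : exists c, forall z, Phi (upd (fun t => e t) i z) = lam * b (e i + c *: v) z.
Proof.
exists (Phi (upd (fun t => e t) i u) / lam) => z.
have eu : b (e i) u = 0 by have /WP[] := eW i; rewrite (bC bsb).
rewrite [z]prE !mlinD // !mlinZ // (@central (upd _ i v) i) ?upd_same // mulr0 add0r.
rewrite !(bDl bsb, bDr bsb, bZl bsb, bZr bsb) eu e_v vv [b v u](bC bsb) uv.
have /WP[_ ->] := pr_W z.
have -> : Phi (upd (fun t => e t) i (pr z)) = b (e i) (pr z) * lam.
  have := @block_one _ _ bW bW_sb _ FW ew i (vsproj W (pr z)) isT FW_inv bew.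
  by rewrite /FW vsval_upd /bW vsprojK ?pr_W.
by field.
Qed.

(* The lifts [e' = e + kap *: v] are chosen so that [lam *: e' i] is dual to
   [Phi (upd e i _)]; their span is the nondegenerate ideal. *)
Lemma simple_block_absurd : False.
Proof.
have [kap kapE] := fin_all_exists dual_e.
pose e' t := e t + kap t *: v.
(* [u] made orthogonal to all the lifts [e'], keeping [b u' v = 1]. *)
pose u' := u - \sum_t kap t *: e t.
have e'e i j : b (e' i) (e' j) = (i == j)%:R.
  rewrite /e' !(bDl bsb, bDr bsb, bZl bsb, bZr bsb) oe e_v vv [b v _](bC bsb) e_v; ring.
have e'W i x : x \in W -> b (e' i) x = b (e i) x.
  by move=> /WP[_ vx]; rewrite /e' (bDl bsb) (bZl bsb) vx mulr0 addr0.
have e'v i : b (e' i) v = 0 by rewrite /e' (bDl bsb) (bZl bsb) e_v vv; ring.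
have u'v : b u' v = 1.
  rewrite /u' (bDl bsb) (bNl bsb) (b_suml bsb) big1 ?subr0 // => i _.
  by rewrite (bZl bsb) e_v mulr0.
have u'e i : b u' (e' i) = 0.
  rewrite /u' (bDl bsb) (bNl bsb) (b_suml bsb) (bigD1 i) //= big1 => [|j ji]; last first.
    by rewrite (bZl bsb) (bC bsb) e'W // oe eq_sym (negPf ji) mulr0.
  have -> : b u (e' i) = kap i.
    by rewrite /e' (bDr bsb) (bZr bsb) uv; have /WP[-> _] := eW i; rewrite add0r mulr1.
  by rewrite (bZl bsb) [b (e i) _](bC bsb) e'W // oe eqxx mulr1 addr0 subrr.
pose rest z := z \in W /\ forall t, b (e t) z = 0.
(* [D] acts on the block as [lam] times a rotation, but with values in the lifts. On [rest] it
   produces only multiples of [v], and it sends [u'] into [rest] up to such multiples. *)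
have Dop l m : l != m -> exists2 D : V -> V, kills D Phi &
  [/\ D (e m) = (- lam) *: e' l, forall j, j != l -> j != m -> D (e j) = 0,
      forall z, rest z -> exists c, D z = c *: v &
      exists2 w, rest w & exists c, D u' = w + c *: v].
  move=> lm; have [_ _ /(_ (fun t => e t) _ _ lm)[D DE kD]] := brf_inv M.
  have Dv z : b (D z) v = 0 by rewrite DE (@central _ m) ?upd_same.
  have Dsk z w : b (D z) w = - b z (D w).
    by rewrite [b z _](bC bsb) !DE altf_swap.
  have Dm : D (e m) = (- lam) *: e' l.
    apply: nondeg_eq => w; rewrite DE altf_swap // updC // upd_id kapE (bZl bsb).
    by rewrite mulNr.
  have Dl : D (e l) = lam *: e' m.
    by apply: nondeg_eq => w; rewrite DE upd_id kapE (bZl bsb).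
  have D0 j : j != l -> j != m -> D (e j) = 0.
    move=> jl jm; apply: nondeg_eq => w; rewrite DE (b0l bsb); apply: (aPhi jl).
    by rewrite upd_neq // upd_neq // upd_neq // upd_same.
  exists D => //; split=> // [z [zW ze]|].
    have [t tl tm] : exists2 t, t != l & t != m.
      have : (0 < #|~: [set l; m]|)%N by rewrite cardsCs setCK card_ord cards2 lm subn_gt0.
      by case/card_gt0P => t; rewrite !inE negb_or => /andP[]; exists t.
    have [||c Ec] := W_eq (z := D z) (w := 0) _ (Dv z); last by exists c; rewrite Ec add0r.
    + move=> x xW; rewrite DE (b0l bsb).
      apply: (@W_block_full _ t l t) => //; last by move=> s; rewrite upd_neq // upd_same.
        by move=> s; rewrite /upd; case: eqP => [_ //|_]; case: eqP => [_ //|_].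
      by rewrite !upd_neq.
    + exact: (b0l bsb).
  exists (pr (D u')); last first.
    by exists (b (D u') u); rewrite {1}[D u']prE Dv scale0r add0r addrC.
  split=> [|t]; first exact: pr_W.
  rewrite (bC bsb) b_pr // Dsk; apply/eqP; rewrite oppr_eq0; apply/eqP.
  have [->|tl] := eqVneq t l; first by rewrite Dl (bZr bsb) u'e mulr0.
  have [->|tm] := eqVneq t m; first by rewrite Dm (bZr bsb) u'e mulr0.
  by rewrite D0 // (b0r bsb).
pose pure z := [\/ z = u', z = v, rest z | exists l, z = e l].
have pure_hull z : hull (fun z => [\/ z = u', z = v | rest z]) (z - \sum_t b (e' t) z *: e t).
  pose w := z - b z v *: u'.
  have wv : b w v = 0 by rewrite /w (bDl bsb) (bNl bsb) (bZl bsb) u'v mulr1 subrr.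
  have wE : w = b w u *: v + pr w by rewrite {1}[w]prE wv scale0r add0r.
  have e'w t : b (e' t) w = b (e' t) z.
    by rewrite /w (bDr bsb) (bNr bsb) (bZr bsb) [b (e' t) u'](bC bsb) u'e mulr0 subr0.
  have epr t : b (e t) (pr w) = b (e' t) z.
    by rewrite -e'w [in RHS]wE (bDr bsb) (bZr bsb) e'v mulr0 add0r e'W ?pr_W.
  have -> : z - \sum_t b (e' t) z *: e t =
      b z v *: u' + (b w u *: v + (pr w - \sum_t b (e t) (pr w) *: e t)).
    under [in RHS]eq_bigr => t _ do rewrite epr.
    by rewrite [_ *: v + _]addrA -wE /w addrA [_ *: u' + _]addrC subrK.
  apply: hull_comb; first by apply: hull_in; apply: Or31.
  apply: hull_comb; first by apply: hull_in; apply: Or32.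
  apply: hull_in; apply: Or33; split.
    by apply: rpredB; [exact: pr_W|apply: rpred_sum => t _; apply: rpredZ].
  move=> t; rewrite (bDr bsb) (bNr bsb) (@orthonormal_coef _ _ b bsb _ (fun t => e t)) ?subrr //.
(* Centrality and [W_block_full] leave tuples with exactly one entry [u']. Some [e m] is then
   missing, and invariance under [D], tested with [e m] in place of [e l], returns [- lam * Phi y]
   plus a term on W that vanishes. *)
have key y i j l : i != j -> y i = e l -> [\/ y j = u', y j = v | rest (y j)] ->
    (forall t, pure (y t)) -> Phi y = 0.
  move=> ij yi yj py.
  case: (classic (exists t, y t = v)) => [[t yt]|nv]; first exact: central yt.
  case: (classic (exists s, y s = u')) => [[s ys]|nu]; last first.
    apply: (W_block_full ij _ yi); last by case: yj => [E|E|[]] //; [case: nu|case: nv]; exists j.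
    move=> t; case: (py t) => [E|E|[]|[k ->]] //; first by case: nu; exists t.
    by case: nv; exists t.
  have is_ : i != s.
    apply/eqP => E; have := e_v l; rewrite -yi E ys u'v => /eqP; by rewrite oner_eq0.
  case: (classic (exists2 t, t != s & y t = u')) => [[t ts yt]|nu].
    by apply: (aPhi ts); rewrite yt.
  case: (classic (exists2 t, t != i & y t = e l)) => [[t ti yt]|nl].
    by apply: (aPhi ti); rewrite yt.
  have [m nm] : exists m, forall t, y t <> e m.
    apply: NNPP => /not_ex_all_not nm.
    have /fin_all_exists[f fE] m : exists t, y t = e m.
      by apply: NNPP => /not_ex_all_not ?; apply: (nm m).
    have fI : injective f.
      move=> m m' ff; apply/eqP; have := oe m m'; rewrite -fE ff fE oe eqxx.
      by case: eqP => // _ /eqP; rewrite oner_eq0.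
    have := e_v (invF fI s); rewrite -fE f_invF ys u'v => /eqP.
    by rewrite oner_eq0.
  have lm : l != m by apply/eqP => lm; apply: (nm i); rewrite -lm.
  have [D kD [Dm D0 Dr [w rw [c Du]]]] := Dop _ _ lm.
  have := kD (upd y i (e m)).
  rewrite (bigD1 i) //= upd_same upd_upd Dm mlinZ // /e' mlinD // Phi_v addr0 -yi upd_id.
  rewrite (bigD1 s) 1?eq_sym //= [X in _ + (_ + X)]big1 ?addr0 => [|t /andP[ti ts]]; last first.
    rewrite upd_neq //; case: (py t) => [E|E|rt|[k E]].
    - by case: nu; exists t.
    - by case: nv; exists t.
    - by have [a ->] := Dr _ rt; rewrite Phi_v.
    - rewrite E D0 ?mlin0 //; apply/eqP => kE; last by apply: (nm t); rewrite E kE.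
      by apply: nl; exists t; rewrite // E kE.
  rewrite upd_neq 1?eq_sym // ys Du mlinD // Phi_v addr0.
  rewrite (@W_block_full (upd (upd y i (e m)) s w) i s m) //.
  - by rewrite addr0 => /eqP; rewrite mulf_eq0 oppr_eq0 (negPf lam0) => /eqP.
  - move=> t; rewrite /upd; case: eqP => [_|/eqP ts]; first by case: rw.
    case: eqP => // ti; case: (py t) => [E|E|[]|[k ->]] //.
      by case: nu; exists t.
    by case: nv; exists t.
  - by rewrite upd_neq // upd_same.
  - by move=> t; rewrite upd_same; case: rw.
have key2 x i l z : x i = e' l -> (forall t, b (e' t) z = 0) -> b z (br x) = 0.
  move=> xi ze; rewrite -brf_fcons.
  have E : fcons z x = upd (fcons z x) (lift ord0 i) (e' l).
    by rewrite -xi upd_fconsS upd_id.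
  rewrite E /e' mlinD // Phi_v addr0.
  pose P t x := if t == lift ord0 i then x = e l else if t == ord0 then
    [\/ x = u', x = v | rest x] else pure x.
  apply: (mlin_hull mPhi (P := P)) => [y Py|t].
    have yi : y (lift ord0 i) = e l by have := Py (lift ord0 i); rewrite /P eqxx.
    have y0 : [\/ y ord0 = u', y ord0 = v | rest (y ord0)] by have := Py ord0.
    apply: (key y (lift ord0 i) ord0 l) => // t.
    have := Py t; rewrite /P; case: eqP => [_ ->|_]; first by apply: Or44; exists l.
    by case: eqP => // _ [?|?|?]; [apply: Or41|apply: Or42|apply: Or43].
  rewrite /P; case: (unliftP ord0 t) => [t' ->|->] /=; last first.
    rewrite upd_fconsS fcons0; have := pure_hull z; rewrite big1 ?subr0 // => s _.
    by rewrite ze scale0r.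
  case: eqP => [->|ne]; first by rewrite upd_same; apply: hull_in.
  rewrite upd_neq; last by apply/eqP.
  rewrite fconsS; have -> : x t' = \sum_s b (e' s) (x t') *: e s +
      (x t' - \sum_s b (e' s) (x t') *: e s) by rewrite addrC subrK.
  apply: hullD.
    by apply: hull_sum => s; apply: hull_in; apply: Or44; exists s.
  apply: (pure_hull (x t')); [exact: hull0|exact: hull_comb|].
  by move=> y py; apply: hull_in; case: py => ?; [apply: Or41|apply: Or42|apply: Or43].
(* The span of the lifts, described as the fixed vectors of the orthogonal projection onto it. *)
have [T TP] : exists T : {vspace V}, forall z, z \in T <-> z = \sum_t b (e' t) z *: e' t.
  apply: pred_vspace => [|a x y Ex Ey].
    by rewrite big1 // => t _; rewrite (b0r bsb) scale0r.
  rewrite {1}Ex {1}Ey scaler_sumr -big_split; apply: eq_bigr => t _ /=.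
  by rewrite (bDr bsb) (bZr bsb) scalerDl scalerA.
have e'T t : e' t \in T.
  apply/TP; rewrite (bigD1 t) //= e'e eqxx scale1r big1 ?addr0 // => s st.
  by rewrite e'e (negPf st) scale0r.
have idT : ideal br T.
  move=> x i /TP xi; apply/TP; apply: nondeg_eq => z.
  have [a aE] : exists a, forall t, b (e' t) (z - a) = 0 /\ a = \sum_t b (e' t) z *: e' t.
    exists (\sum_t b (e' t) z *: e' t) => t; split=> //.
    rewrite (bDr bsb) (bNr bsb) (@orthonormal_coef _ _ b bsb _ e') ?subrr //.
  have za : b (br x) (z - a) = 0.
    rewrite (bC bsb) -(upd_id x i) xi.
    have [[ml _ _] _ _ _] := M.
    apply: (big_ind (fun w => b (z - a) (br (upd x i w)) = 0)).
    - have := ml x i (-1) 0 0; rewrite scaler0 add0r scaleN1r addNr => ->.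
      exact: (b0r bsb).
    - move=> y w Ey Ew; have := ml x i 1 y w; rewrite !scale1r => ->.
      by rewrite (bDr bsb) Ey Ew addr0.
    move=> t _; rewrite -[_ *: _]addr0 ml (bDr bsb) (bZr bsb).
    rewrite (@key2 _ i t) ?upd_same //; last by move=> s; case: (aE s).
    have := ml x i (-1) 0 0; rewrite scaler0 add0r scaleN1r addNr => ->.
    by rewrite (b0r bsb) mulr0 addr0.
  have -> : b (br x) z = b (br x) a.
    by apply/eqP; rewrite -subr_eq0 -(bNr bsb) -(bDr bsb) za.
  have [_ ->] := aE ord0; rewrite (b_sumr bsb) (b_suml bsb); apply: eq_bigr => t _.
  by rewrite (bZr bsb) (bZl bsb) [b (br x) _](bC bsb) mulrC.
have [|T0|TV] := indec idT.
- move=> x /TP xE xo; rewrite xE big1 // => t _.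
  by rewrite (bC bsb) xo ?scale0r.
- by have := e'T ord0; rewrite T0 memv0 => /eqP E; have := e'e ord0 ord0;
    rewrite E (b0l bsb) eqxx => /eqP; rewrite eq_sym oner_eq0.
have /TP : v \in T by rewrite TV memvf.
rewrite big1 => [vE|t _]; last by rewrite e'v scale0r.
by have := uv; rewrite vE (b0r bsb) => /eqP; rewrite eq_sym oner_eq0.
Qed.

End SimpleBlock.

Lemma Phi_W0 y : (forall t, y t \in W) -> Phi y = 0.
Proof.
move=> yW; apply/eqP/negPn/negP => Py.
have [|ew bew] := @block_exists _ _ bW bW_sb bW_pos n'.+1 FW FW_inv.
  by exists (fun t => vsproj W (y t)); rewrite /FW vsproj_fun.
exact: simple_block_absurd bew.
Qed.

(** * The (n-1)-bracket on W *)

Definition brW (y : 'I_n'.+3 -> subvs_of W) : subvs_of W :=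
  vsproj W (br (fcons u (fun j => vsval (y j)))).

Lemma br_u_W y : br (fcons u y) \in W.
Proof.
apply/WP; rewrite -!brf_fcons; split; last by apply: (@central _ ord0); rewrite fcons0.
by apply: (aPhi (i := ord0) (j := lift ord0 ord0)); rewrite // fcons0 fconsS fcons0.
Qed.

Lemma vsval_brW y : vsval (brW y) = br (fcons u (fun j => vsval (y j))).
Proof. by rewrite /brW vsprojK ?br_u_W. Qed.

(** Brackets of W are brackets of V with [u] in front. In the derivation identity the term acting on
    [u] drops out by alternation. *)
Lemma metric_W : metric_lie_alg brW bW.
Proof.
have [[ml al de] _ _ sk] := M.
have vad x i w : vsval (ad brW x i w) =
    ad br (fcons u (fun j => vsval (x j))) (lift ord0 i) (vsval w).
  by rewrite /ad vsval_brW vsval_upd upd_fconsS.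
split; first split.
- move=> x i a y z; apply: subvs_inj; rewrite linearP /= !vsval_brW !vsval_upd.
  by rewrite linearP /= -!upd_fconsS ml.
- move=> x i j ij xij; apply: subvs_inj; rewrite vsval_brW linear0.
  by apply: (al _ (lift ord0 i) (lift ord0 j)); rewrite ?(inj_eq lift_inj) // !fconsS xij.
- move=> x i z; apply: subvs_inj; rewrite vad vsval_brW de linear_sum /= big_ord_recl.
  have au : ad br (fcons u (fun j => vsval (x j))) (lift ord0 i) u = 0.
    apply: (al _ ord0 (lift ord0 i)); first by [].
    by rewrite upd_same upd_neq // fcons0.
  have br0 y j : br (upd y j 0) = 0.
    by have := ml y j (-1) 0 0; rewrite scaler0 add0r scaleN1r addNr.
  rewrite fcons0 au br0 add0r; apply: eq_bigr => j _.
  by rewrite vsval_brW vsval_upd vad fconsS upd_fconsS.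
- exact: bW_sb.
- move=> x xo; apply: (b_nondeg bW_sb bW_pos) => w; rewrite xo (b0l bW_sb) //.
- by move=> x i y z; rewrite /bW !vad sk.
Qed.

Local Notation Psi := (brf brW bW).

Lemma Psi_Phi y : Psi y = Phi (fcons (vsval (y ord0))
  (fcons u (fun j => vsval (y (lift ord0 j))))).
Proof. by rewrite brf_fcons /brf /bW vsval_brW. Qed.

Lemma hull_uvW z : hull (fun z => [\/ z = u, z = v | z \in W]) z.
Proof.
rewrite [z]prE; apply: hull_comb; first by apply: hull_in; apply: Or31.
apply: hull_comb; first by apply: hull_in; apply: Or32.
by apply: hull_in; apply: Or33; apply: pr_W.
Qed.

(** [Phi] vanishes on W and on tuples containing [v] or two entries [u], so a single [u] remains; a
    transposition brings it to slot 1, where [Phi] becomes [Psi]. *)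
Lemma central_W (z : subvs_of W) : (forall y i, y i = z -> Psi y = 0) ->
  forall y i, y i = vsval z -> Phi y = 0.
Proof.
move=> zPsi y i yi.
pose P t x := if t == i then x = vsval z else [\/ x = u, x = v | x \in W].
apply: (mlin_hull mPhi (P := P)) => [{y yi} y Py|t]; last first.
  by rewrite /P; case: eqP => [->|_]; [apply: hull_in|apply: hull_uvW].
have yi : y i = vsval z by have := Py i; rewrite /P eqxx.
have {}Py t : [\/ y t = u, y t = v | y t \in W].
  have := Py t; rewrite /P; case: eqP => // _ ->.
  by apply: Or33; apply: subvsP.
case: (classic (exists t, y t = v)) => [[t yt]|nv]; first exact: central yt.
case: (classic (exists s, y s = u)) => [[s ys]|nu]; last first.
  apply: Phi_W0 => t; case: (Py t) => // E; first by case: nu; exists t.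
  by case: nv; exists t.
case: (classic (exists2 t, t != s & y t = u)) => [[t ts yt]|nu].
  by apply: (aPhi ts); rewrite yt.
have yW t : t != s -> y t \in W.
  move=> ts; case: (Py t) => // E; first by case: nu; exists t.
  by case: nv; exists t.
have uW : u \notin W.
  by apply/negP => /WP[_]; rewrite (bC bsb) uv => /eqP; rewrite oner_eq0.
have is_ : i != s.
  by apply/eqP => E; move: uW; rewrite -ys -E yi subvsP.
pose one : 'I_n.+1 := lift ord0 ord0.
pose y1 := y \o tperm one s.
have y1u : y1 one = u by rewrite /y1 /= tpermL.
have y1W t : t != one -> y1 t \in W.
  move=> t1; rewrite /y1 /= yW //.
  by rewrite -[X in _ != X](tpermL one s) (inj_eq perm_inj).
pose y2 : 'I_n -> subvs_of W := fcons (vsproj W (y1 ord0))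
  (fun j => vsproj W (y1 (lift ord0 (lift ord0 j)))).
have E : Psi y2 = Phi y1.
  rewrite Psi_Phi; congr Phi; apply: functional_extensionality => t.
  case: (unliftP ord0 t) => [t' ->|->]; last by rewrite fcons0 /y2 fcons0 vsprojK ?y1W.
  case: (unliftP ord0 t') => [t'' ->|->]; last by rewrite fconsS fcons0 y1u.
  by rewrite !fconsS /y2 fconsS vsprojK ?y1W.
suff : Phi y1 = 0.
  rewrite /y1 altf_perm // => /eqP; rewrite mulf_eq0 signr_eq0 => /eqP //.
rewrite -E; have [j jE] : exists j, y1 j = vsval z /\ j != one.
  exists (tperm one s i); rewrite /y1 /= tpermK; split=> //.
  by rewrite -[X in _ != X](tpermR one s) (inj_eq perm_inj).
case: (unliftP ord0 j) jE => [j' ->|-> [jz _]]; last first.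
  by apply: (zPsi _ ord0); rewrite /y2 fcons0 jz vsvalK.
case: (unliftP ord0 j') => [j'' -> [jz _]|->]; last by case; rewrite eqxx.
by apply: (zPsi _ (lift ord0 j'')); rewrite /y2 fconsS jz vsvalK.
Qed.

Lemma central_W0 (z : subvs_of W) : (forall y i, y i = z -> Psi y = 0) -> z = 0.
Proof.
move=> zPsi; apply/eqP/negPn/negP => z0.
have zz := bW_pos z0.
have id : ideal br <[vsval z]>%VS.
  move=> x i /vlineP[a xa].
  suff -> : br x = 0 by exact: mem0v.
  apply: (bracket_eq0 M) => w.
  have -> : fcons w x = upd (fcons w x) (lift ord0 i) (a *: vsval z).
    by rewrite -xa upd_fconsS upd_id.
  by rewrite mlinZ // (central_W zPsi (i := lift ord0 i)) ?upd_same ?mulr0.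
have [|E|E] := indec id.
- move=> x /vlineP[a ->] /(_ _ (memv_line _)); rewrite (bZl bsb) => /eqP.
  by rewrite mulf_eq0 (gt_eqF zz) orbF => /eqP ->; rewrite scale0r.
- have := memv_line (vsval z); rewrite E memv0 => /eqP z1.
  by move: zz; rewrite /bW z1 (b0l bsb) ltxx.
- have : v \in <[vsval z]>%VS by rewrite E memvf.
  move=> /vlineP[a va]; have := uv; rewrite va (bZr bsb).
  by have /WP[-> _] := subvsP z; rewrite mulr0 => /eqP; rewrite eq_sym oner_eq0.
Qed.

(** If W were zero the bracket would vanish, and the line of [u + v], of norm 2, would be a proper
    nondegenerate ideal. *)
Lemma W_neq0 : exists z : subvs_of W, z != 0.
Proof.
apply: NNPP => nz.
have W0 z : z \in W -> z = 0.
  move=> zW; rewrite -(vsprojK zW); apply/eqP/negPn/negP => zn; apply: nz.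
  by exists (vsproj W z); apply: contraNneq zn => ->; rewrite linear0.
have Phi0 y : Phi y = 0.
  apply: (mlin_hull mPhi (P := fun=> fun z => [\/ z = u, z = v | z \in W])) => [{}y Py|t]; last exact: hull_uvW.
  case: (classic (exists t, y t = v)) => [[t yt]|nv]; first exact: central yt.
  have yu t : y t = u \/ y t = 0.
    by case: (Py t) => [|E|/W0]; [left|case: nv; exists t|right].
  case: (yu ord0) => y0; last by rewrite -(upd_id y ord0) y0 mlin0.
  case: (yu ord_max) => y1; last by rewrite -(upd_id y ord_max) y1 mlin0.
  by apply: (aPhi (i := ord0) (j := ord_max)); rewrite // y0.
have id : ideal br <[u + v]>%VS.
  move=> x i _; suff -> : br x = 0 by exact: mem0v.
  by apply: (bracket_eq0 M) => w; apply: Phi0.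
have ww : b (u + v) (u + v) = 2.
  by rewrite (bDl bsb) !(bDr bsb) uu vv [b v u](bC bsb) uv; ring.
have [|E|E] := indec id.
- move=> x /vlineP[a ->] /(_ _ (memv_line _)); rewrite (bZl bsb) ww => /eqP.
  by rewrite mulf_eq0 pnatr_eq0 orbF => /eqP ->; rewrite scale0r.
- have := memv_line (u + v); rewrite E memv0 => /eqP z1.
  by move: ww; rewrite z1 (b0l bsb) => /eqP; rewrite eq_sym pnatr_eq0.
- have : v \in <[u + v]>%VS by rewrite E memvf.
  move=> /vlineP[a va]; have := congr1 (b v) va.
  rewrite (bZr bsb) (bDr bsb) vv addr0 [b v u](bC bsb) uv mulr1 => a0.
  by have := uv; rewrite va -a0 scale0r (b0r bsb) => /eqP; rewrite eq_sym oner_eq0.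
Qed.

(** The bracket is orthogonal to [v] and to W, hence [b u] of it times [v]. Moving [w] from the last
    to the first of n+1 slots is a cycle of sign (-1)^n. *)
Lemma br_tsnoc (y : 'I_n'.+3 -> subvs_of W) (w : subvs_of W) :
  br (tsnoc (fun j => vsval (y j)) (vsval w)) = ((-1) ^+ n * bW (brW y) w) *: v.
Proof.
set x := tsnoc _ _.
have xW t : x t \in W.
  rewrite /x; case: (unliftP ord_max t) => [i ->|->]; rewrite ?tsnoc_lift ?tsnoc_max;
  exact: subvsP.
have [|||c cE] := W_eq (z := br x) (w := 0).
- move=> z zW; rewrite (b0l bsb) (bC bsb) -brf_fcons Phi_W0 // => t.
  by case: (unliftP ord0 t) => [i ->|->]; rewrite ?fconsS ?fcons0.
- by rewrite (bC bsb) -brf_fcons (@central _ ord0) ?fcons0.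
- exact: (b0l bsb).
rewrite cE add0r; congr (_ *: _).
have -> : c = b u (br x) by rewrite cE add0r (bZr bsb) uv mulr1.
rewrite (bC bW_sb) /bW vsval_brW -!brf_fcons.
set g := fcons (vsval w) _.
have -> : fcons u x = g \o lift_perm ord_max ord0 1.
  apply: functional_extensionality => t /=.
  case: (unliftP ord_max t) => [i ->|->]; last first.
    by rewrite lift_perm_id /g fcons0 lift_ord_max_max fconsS /x tsnoc_max.
  rewrite lift_perm_lift perm1 /g fconsS.
  case: (unliftP ord0 i) => [j ->|->].
    rewrite fconsS (_ : lift ord_max (lift ord0 j) = lift ord0 (lift ord_max j)).
      by rewrite fconsS /x tsnoc_lift.
    by apply: ord_inj; rewrite lift_max !lift0 lift_max.
  by rewrite fcons0 (_ : lift ord_max ord0 = ord0) ?fcons0 //; apply: val_inj.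
rewrite altf_perm // odd_lift_perm odd_perm1 -[in RHS]signr_odd.
by congr ((-1) ^+ (nat_of_bool _) * _); rewrite /= !addbF.
Qed.

(** * Decomposition of W into copies of the simple euclidean algebra *)

Section Decomposed.
Variables (m : nat) (e : 'I_m -> 'I_n -> subvs_of W).
Hypothesis oe : orthonormal bW (uncur e).
Hypothesis be : forall a, block bW Psi (e a).
Hypothesis residual : forall y, (forall i p, bW (uncur e p) (y i) = 0) -> Psi y = 0.

Let iPsi : inv_form bW Psi. Proof. exact: brf_inv metric_W. Qed.
Let mPsi : mlin Psi. Proof. by case: iPsi. Qed.
Let aPsi : altf Psi. Proof. by case: iPsi. Qed.

Lemma Psi_block_full y i j a l : i != j -> y i = e a l ->
  (forall t, bW (e a t) (y j) = 0) -> Psi y = 0.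
Proof. exact: (family_block_full bW_sb bW_pos iPsi be). Qed.

(** Such a [z] kills [Psi], either next to a block vector or by [residual], hence is central. *)
Lemma residual_W0 z : (forall p, bW (uncur e p) z = 0) -> z = 0.
Proof.
move=> zo; apply: central_W0 => y i yi.
pose P t x := if t == i then x = z else
  (exists p, x = uncur e p) \/ (forall p, bW (uncur e p) x = 0).
apply: (mlin_hull mPsi (P := P)) => [{y yi} y Py|t]; last first.
  rewrite /P; case: eqP => [->|_]; first exact: hull_in.
  rewrite [y t](perpE bW (uncur e)); apply: hullD.
    by apply: hull_sum => p; apply: hull_in; left; exists p.
  by apply: hull_in; right => p; apply: (perpP bW_sb).
have yi : y i = z by have := Py i; rewrite /P eqxx.
case: (classic (exists2 t, t != i & exists p, y t = uncur e p)) => [[t ti [p yt]]|ne].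
  apply: (Psi_block_full ti yt) => s; rewrite yi; exact: (zo (p.1, s)).
apply: residual => t p; have := Py t; rewrite /P; case: eqP => [_ ->|/eqP ti]; first exact: zo.
by case=> // ex; case: ne; exists t.
Qed.

Lemma decomposed_expand z : z = \sum_p bW (uncur e p) z *: uncur e p.
Proof.
rewrite {1}[z](perpE bW (uncur e)) (_ : perp bW (uncur e) z = 0) ?addr0 //.
by apply: residual_W0 => p; apply: (perpP bW_sb).
Qed.

(* [c.1] is the common squared norm of the rescaled block and [c.2] the rescaling;
   flipping the sign of one vector adjusts the orientation. *)
Lemma decomposed_scale a : exists c : R * ('I_n -> R),
  [/\ 0 < c.1, forall i, c.2 i ^+ 2 = c.1 & (\prod_i c.2 i) * Psi (e a) = - c.1].
Proof.
have [_ lam0 _] := be a; set lam := Psi (e a) in lam0 *.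
(* Scaling all n vectors by [t] multiplies the form by t^n, and the result must have absolute value
   t^2; hence t^(n-2) is the inverse of [|lam|]. *)
have [|t t0 tE] := @positive_root _ `|lam|^-1 n'.+1; first by rewrite invr_gt0 normr_gt0.
pose eps := - Num.sg lam.
exists (t ^+ 2, fun i => if i == ord0 then eps * t else t) => /=; split.
- exact: exprn_gt0.
- by move=> i; case: eqP => // _; rewrite exprMn sqrrN sqr_sg lam0 mul1r.
rewrite big_ord_recl /= (eq_bigr (fun=> t)) // prodr_const card_ord.
have -> : eps * t * t ^+ n'.+3 * lam = eps * (t ^+ n'.+2 * t ^+ 2) * lam.
  by rewrite -exprD addn2 [t ^+ n'.+4]exprS; ring.
rewrite tE /eps !mulNr; congr (- _).
have -> : Num.sg lam * (`|lam|^-1 * t ^+ 2) * lam =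
  (Num.sg lam * lam) * (`|lam|^-1 * t ^+ 2) by ring.
by rewrite -normrEsg mulrA mulfV ?normr_eq0 // mul1r.
Qed.

Lemma decomposed_copies : sum_of_simple_copies brW bW m.
Proof.
have [c cE] := fin_all_exists decomposed_scale.
pose s a i := (c a).2 i.
have s0 a i : s a i != 0.
  have [c0 c2 _] := cE a; apply: contraTneq c0; rewrite /s => si.
  by rewrite -(c2 i) si expr0n ltxx.
exists (fun a => (c a).1), (fun a i => s a i *: e a i); split.
- by move=> a; case: (cE a).
- rewrite basisEdim; apply/andP; split; last first.
    rewrite size_map -cardE; exact: (orthonormal_dim bW_sb oe).
  apply/subvP => z _; rewrite [z]decomposed_expand; apply: rpred_sum => p _.
  rewrite -[uncur e p]scale1r -(mulVf (s0 p.1 p.2)) -scalerA; do 2 apply: rpredZ.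
  by apply: memv_span; apply/imageP; exists p.
- move=> a i a' i'; rewrite (bZl bW_sb) (bZr bW_sb).
  rewrite -[bW _ _]/(bW (uncur e (a, i)) (uncur e (a', i'))) oe xpair_eqE.
  case: eqP => [->|_] /=; last by rewrite !mulr0.
  case: eqP => [->|_] /=; last by rewrite !mulr0.
  by rewrite mulr1 -expr2; case: (cE a') => _ ->.
- move=> a i; apply: (b_nondeg bW_sb bW_pos) => w.
  rewrite (bC bW_sb) -brf_fcons (bZl bW_sb) (bZl bW_sb).
  (* Moving [w] from slot 0 to the omitted slot [i] costs (-1)^i; the remaining sign in
     [(-1) ^+ i.+1] is that of [- c.1] in [decomposed_scale]. The factor [(s a i)^-1] undoes the
     scaling of that slot. *)
  have -> : fcons w (fun j => s a (lift i j) *: e a (lift i j)) =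
    (fun j => s a j *: upd (e a) i ((s a i)^-1 *: w) j) \o lift_perm ord0 i 1.
    apply: functional_extensionality => j /=.
    case: (unliftP ord0 j) => [j' ->|->].
      by rewrite fconsS lift_perm_lift perm1 upd_neq // eq_sym neq_lift.
    by rewrite fcons0 lift_perm_id upd_same scalerA divff ?scale1r.
  rewrite altf_perm // odd_lift_perm odd_perm1 /= addbF signr_odd mlin_scale //.
  rewrite mlinZ // (@block_one _ _ bW bW_sb _ Psi (e a) i w isT iPsi (be a)).
  have [_ c2 cP] := cE a.
  have -> : \prod_j s a j * ((s a i)^-1 * (bW (e a i) w * Psi (e a))) =
    (\prod_j s a j * Psi (e a)) * (s a i)^-1 * bW (e a i) w by ring.
  rewrite cP -(c2 i) -/(s a i) [(-1) ^+ i.+1]exprS; move: ((-1) ^+ i) (s0 a i) => k; move: (s a i) => t t0.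
  by field.
move=> f [j [j' jj]]; apply: (b_nondeg bW_sb bW_pos) => w.
rewrite (bC bW_sb) -brf_fcons (b0l bW_sb).
set g := fcons w _.
have -> : g = upd g (lift ord0 j) (s (f j).1 (f j).2 *: e (f j).1 (f j).2).
  by rewrite /g upd_fconsS (upd_id (fun j => s (f j).1 (f j).2 *: e (f j).1 (f j).2)).
rewrite mlinZ // (@Psi_block_full _ (lift ord0 j) (lift ord0 j') (f j).1 (f j).2) ?mulr0 //.
- by rewrite (inj_eq lift_inj); apply: contraNneq jj => ->.
- by rewrite upd_same.
move=> t; rewrite upd_neq; last first.
  by rewrite (inj_eq lift_inj) eq_sym; apply: contraNneq jj => ->.
rewrite /g fconsS (bZr bW_sb).
rewrite -[bW _ _]/(bW (uncur e ((f j).1, t)) (uncur e (f j'))) oe.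
by case: (f j') jj => a' i' /= jj; rewrite xpair_eqE (negPf jj) mulr0.
Qed.

End Decomposed.

(** * Assembling case (iii) *)

Lemma W_direct : directv (<[u]> + <[v]> + W).
Proof.
have cap0 (A B : {vspace V}) : (forall x, x \in A -> x \in B -> x = 0) -> (A :&: B == 0)%VS.
  move=> AB; rewrite -subv0; apply/subvP => x; rewrite memv_cap memv0.
  by move=> /andP[xA xB]; apply/eqP/AB.
rewrite directv_addE directv_addE !directv_trivial /=; apply/andP; split.
  apply: cap0 => x /vlineP[a ->] /vlineP[c E].
  have := congr1 (b^~ v) E; rewrite !(bZl bsb) uv vv mulr0 mulr1 => ->.
  by rewrite scale0r.
apply: cap0 => x /memv_addP[y /vlineP[a ->] [z /vlineP[c ->] ->]] /WP.
rewrite !(bDr bsb) !(bZr bsb) uu vv uv [b v u](bC bsb) uv !mulr0 !mulr1 add0r addr0.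
by move=> [-> ->]; rewrite !scale0r addr0.
Qed.

Lemma W_sum : (<[u]> + <[v]> + W)%VS = fullv.
Proof.
apply/eqP; rewrite eqEsubv subvf; apply/subvP => z _; rewrite [z]prE addrA.
apply: memv_add; last exact: pr_W.
by apply: memv_add; apply: rpredZ; apply: memv_line.
Qed.

Lemma extension_case_iii : case_iii br b.
Proof.
exists u, v, W; split=> //.
- by move=> w /WP.
- by split; [exact: W_sum|exact: W_direct].
exists brW; split.
- split=> [x [i xi]|x [i [j [ij [xi xj]]]]].
    apply: (bracket_eq0 M) => w; apply: (@central _ (lift ord0 i)).
    by rewrite fconsS.
  by case: M => [[_ al _] _ _ _]; apply: (al _ i j); rewrite // xi.
- by move=> y; rewrite tcons_fcons vsval_brW.
- exact: br_tsnoc.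
- by split; [exact: metric_W|exact: bW_pos].
have [m [e [oe be re]]] := block_decomposition bW_sb bW_pos (brf_inv metric_W).
have copies := decomposed_copies oe be re.
exists m; last split=> //.
  have [z z0] := W_neq0; case: (m) e oe be re {copies} => // e oe be re.
  by case/eqP: z0; apply: (residual_W0 oe be re) => -[[]].
rewrite -W_sum (directvP W_direct) /= !dim_vline.
have -> : u != 0.
  by apply/eqP => u0; have := uv; rewrite u0 (b0l bsb) => /eqP; rewrite eq_sym oner_eq0.
have -> : v != 0.
  by apply/eqP => v0; have := uv; rewrite v0 (b0r bsb) => /eqP; rewrite eq_sym oner_eq0.
have [_ [e' [_ be' _ _ _]]] := copies.
have /andP[/eqP sp /eqP] := be'; rewrite sp size_map -cardE card_prod !card_ord.
by rewrite dimvf addnC => <-.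
Qed.

End NullExtension.

Theorem theorem3p1 (R : rcfType) (V : vectType R) (n : nat)
    (br : ('I_n -> V) -> V) (b : V -> V -> R) :
  (4 <= n)%N ->
  metric_lie_alg br b -> lorentzian b -> indecomposable br b ->
  [/\ \dim (fullv : {vspace V}) = 1%N \/ simple br \/ case_iii br b,
      ~ (\dim (fullv : {vspace V}) = 1%N /\ simple br),
      ~ (\dim (fullv : {vspace V}) = 1%N /\ case_iii br b) &
      ~ (simple br /\ case_iii br b)].
Proof.
move=> n4 M lor indec; split.
- case: n n4 br M indec => [|[|[|[|n']]]] // _ br M indec.
  have [[ml al de] bsb nd sk] := M.
  case: (classic (\dim (fullv : {vspace V}) = 1%N)) => [|d1]; first by left.
  case: (classic (simple br)) => [|ns]; first by right; left.
  right; right.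
  have [I [idI In0 InV]] : exists I : {vspace V}, [/\ ideal br I, I <> 0%VS & I <> fullv].
    apply: NNPP => nI; apply: ns; split; first exact/eqP.
    move=> I idI; case: (classic (I = 0%VS)) => [|I0]; first by left.
    by case: (classic (I = fullv)) => [|IV]; [right|case: nI; exists I].
  have [v [vI vo v0]] : exists v, [/\ v \in I, forall y, y \in I -> b v y = 0 & v != 0].
    apply: NNPP => nv; have [|E|E] := indec I idI; [|exact: In0|exact: InV].
    move=> x xI xo; apply/eqP/negPn/negP => x0; apply: nv; by exists x.
  have vv : b v v = 0 by apply: vo.
  (* By skewness the bracket lies in [I] and is orthogonal to [I], like [v]; it is thus null and
     orthogonal to [v], so [null_perp] makes it a multiple of [v]. *)
  have brv x i : x i = v -> exists c, br x = c *: v.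
    move=> xi; have xI : br x \in I by apply: (idI _ i); rewrite xi.
    have xo y : y \in I -> b (br x) y = 0.
      move=> yI; have := sk x i v y; rewrite /ad -{1}xi upd_id (vo (br (upd x i y))).
        by rewrite addr0.
      by apply: (idI _ i); rewrite upd_same.
    have [|//] := null_perp bsb lor v0 vv (xo v vI).
    by rewrite xo // ltxx.
  have [u uu uv] := null_partner bsb lor v0 vv.
  have [W WP] : exists W : {vspace V}, forall z, z \in W <-> b u z = 0 /\ b v z = 0.
    apply: pred_vspace => [|a x y [ux vx] [uy vy]]; first by rewrite !(b0r bsb).
    by rewrite !(bDr bsb) !(bZr bsb) ux vx uy vy mulr0 addr0.
  have Wpos w : w \in W -> w != 0 -> 0 < b w w.
    move=> /WP[uw vw] w0; have [|//|[c wE]] := null_perp bsb lor v0 vv (w := w).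
      by rewrite (bC bsb).
    by move: uw w0; rewrite wE (bZr bsb) uv mulr1 => ->; rewrite scale0r eqxx.
  have mPhi := brf_mlin M; have aPhi := brf_alt M.
  have hul z : hull (fun z => [\/ z = u, z = v | z \in W]) z.
    have -> : z = b z v *: u + (b z u *: v + (z - b z v *: u - b z u *: v)).
      by rewrite [_ *: v + _]addrC subrK addrC subrK.
    apply: hull_comb; first by apply: hull_in; apply: Or31.
    apply: hull_comb; first by apply: hull_in; apply: Or32.
    apply: hull_in; apply: Or33; apply/WP.
    rewrite !(bDr bsb, bNr bsb, bZr bsb) uu vv uv [b v u](bC bsb) uv.
    by rewrite [b u z](bC bsb) [b v z](bC bsb); split; ring.
  (* [br x] is a multiple of [v] as soon as [v] is among the arguments, so the
     form vanishes when [v] meets [W]; the other arguments are then all [u]. *)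
  have central y i : y i = v -> brf br b y = 0.
    move=> yi.
    pose P t x := if t == i then x = v else [\/ x = u, x = v | x \in W].
    apply: (mlin_hull mPhi (P := P)) => [{y yi} y Py|t]; last first.
      by rewrite /P; case: eqP => [->|_]; [apply: hull_in|apply: hul].
    have yi : y i = v by have := Py i; rewrite /P eqxx.
    have {}Py t : t != i -> [\/ y t = u, y t = v | y t \in W].
      by move=> /negPf ti; have := Py t; rewrite /P ti.
    case: (classic (exists2 t, t != i & y t = v)) => [[t ti yt]|nv].
      by apply: (aPhi _ _ _ ti); rewrite yt.
    case: (classic (exists2 t, t != i & y t \in W)) => [[t ti yt]|nW].
      have Z x j : x ord0 \in W -> x (lift ord0 j) = v -> brf br b x = 0.
        move=> /WP[_ x0] xj; rewrite /brf; have [c ->] := brv (fun l => x (lift ord0 l)) j xj.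
        by rewrite (bZr bsb) (bC bsb) x0 mulr0.
      suff : brf br b (y \o tperm ord0 t) = 0.
        by rewrite (altf_perm mPhi aPhi) => /eqP; rewrite mulf_eq0 signr_eq0 => /eqP.
      have : tperm ord0 t i != ord0.
        by rewrite -[X in _ != X](tpermR ord0 t) (inj_eq perm_inj) eq_sym.
      case: (unliftP ord0 (tperm ord0 t i)) => [j jE _|->]; last by rewrite eqxx.
      by apply: (Z _ j) => /=; rewrite ?tpermL // -jE tpermK.
    have [s [t [st si ti]]] : exists s t : 'I_n'.+4.+1, [/\ s != t, s != i & t != i].
      have : (1 < #|~: [set i]|)%N by rewrite cardsCs setCK card_ord cards1.
      case/card_gt1P => s [t [si ti st]]; exists s, t.
      by move: si ti; rewrite !inE.
    have yu l : l != i -> y l = u.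
      by move=> li; case: (Py l li) => // E; [case: nv|case: nW]; exists l.
    by apply: (aPhi _ _ _ st); rewrite !yu.
  exact: (extension_case_iii M uu vv uv WP Wpos central indec).
- by move=> [d1 [/eqP]].
- move=> [d1 [u [v [W [_ _ _ _ [brW [_ _ _ _ [m m0 [_ dE]]]]]]]]].
  by move: dE; rewrite d1 addn2.
- move=> [[_ si] [u [v [W [[_ [vv uv]] _ _ _ [brW [[brv _] _ _ _ [m m0 [_ dE]]]]]]]]].
  have [[ml _ _] bsb _ _] := M.
  (* The line of [v] is an ideal, since brackets containing [v] vanish, and by the dimension formula
     it is not all of V. *)
  have [|E|E] := si <[v]>%VS.
  + move=> x i /vlineP[a xa]; rewrite -(upd_id x i) xa -[a *: v]addr0 ml.
    have -> : br (upd x i v) = 0 by apply: brv; exists i; rewrite upd_same.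
    have := ml x i (-1) 0 0; rewrite scaler0 add0r scaleN1r addNr => ->.
    by rewrite scaler0 addr0 mem0v.
  + have := memv_line v; rewrite E memv0 => /eqP v0; move: uv.
    by rewrite v0 (b0r bsb) => /eqP; rewrite eq_sym oner_eq0.
  + move: dE; rewrite -E dim_vline addn2; case: (v != 0) => //.
Qed.
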